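(* Let $\mathbf{k}$ be an algebraically closed field of characteristic $p>0$ and let $\mathcal{C}$ be a tensor category over $\mathbf{k}$ with projective objects. The following conditions are equivalent: (1) $\mathcal{C}$ is Frobenius-exact; (2) the inductive system $\mathbf{B}_{\mathcal{P}r}[\mathcal{C}]$ is closed; (3) the trivial representation $\mathbf{1}$ of $S_p$ belongs to $\mathbf{B}^p_{\mathcal{P}r}[\mathcal{C}]$; (4) $\mathbf{B}^p_{\mathcal{P}r}[\mathcal{C}]$ is not contained in the category of projective $\mathbf{k}S_p$-modules; (5) for the projective cover $q:Q\twoheadrightarrow\mathbf{1}$ of the tensor unit, the surjection $$\mathrm{Hom}(Q,Q^{\otimes p})\xrightarrow{\mathrm{Hom}(Q,q^{\otimes p})}\mathrm{Hom}(Q,\mathbf{1})\simeq\mathbf{k}$$ has an $S_p$-equivariant section; (6) for every projective $P\in\mathcal{C}$, every composition $\lambda$ of length $l$ and every $l$ epimorphisms $\{Y_i\twoheadrightarrow Z_i\mid1\le i\le l\}$ in $\mathcal{C}$, the surjection $$\mathrm{Hom}(P,Y_1^{\otimes\lambda_1}\otimes\cdots\otimes Y_l^{\otimes\lambda_l})\twoheadrightarrow\mathrm{Hom}(P,Z_1^{\otimes\lambda_1}\otimes\cdots\otimes Z_l^{\otimes\lambda_l})$$ has an $S_\lambda$-equivariant section.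
   Context: A tensor category over $\mathbf{k}$ is an essentially small $\mathbf{k}$-linear symmetric monoidal category $(\mathcal{C},\otimes,\mathbf{1})$ which is abelian with all objects of finite length, rigid, and with $\mathbf{k}\to\mathrm{End}(\mathbf{1})$ an isomorphism. It ''has projective objects'' if it has a non-zero projective object (equivalently, every object has a projective cover). Symmetric groups act on tensor powers $X^{\otimes n}$ through the symmetric braiding, and $S_\lambda=S_{\lambda_1}\times\cdots\times S_{\lambda_l}$ acts on $Y_1^{\otimes\lambda_1}\otimes\cdots\otimes Y_l^{\otimes\lambda_l}$ accordingly; $S_p$ acts trivially on $\mathrm{Hom}(Q,\mathbf{1})$. Frobenius-exactness: for $X\in\mathcal{C}$ let $g=\sigma-1$, with $\sigma$ the braid action on $X^{\otimes p}$ of a $p$-cycle in $S_p$, and put $\mathrm{Fr}_i(X)=(\mathrm{Ker}\,g\cap\mathrm{Im}\,g^{i-1})/(\mathrm{Ker}\,g\cap\mathrm{Im}\,g^i)$ for $1\le i\le p-1$. These are the components of the Frobenius functor $\mathrm{Fr}:\mathcal{C}\to\mathcal{C}\boxtimes\mathrm{Ver}_p$, $X\mapsto\bigoplus_i\mathrm{Fr}_i(X)\boxtimes L_i$, where $X^{\otimes p}$ is viewed as a representation of the cyclic group $C_p<S_p$ in $\mathcal{C}$ and one applies the semisimplification functor $\mathrm{Rep}\,C_p\to\mathrm{Ver}_p$, with $L_i$ the image of the $i$-dimensional indecomposable. $\mathcal{C}$ is Frobenius-exact if $\mathrm{Fr}$ is exact, i.e. all $\mathrm{Fr}_i$ are exact.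 $\mathbf{B}^n_{\mathcal{P}r}[\mathcal{C}]\subset\mathrm{Rep}\,S_n$ (finite-dimensional representations) is the full subcategory of direct summands of finite direct sums of representations $\mathrm{Hom}(P,X^{\otimes n})$ with $P,X\in\mathcal{C}$ projective. These form an inductive system: an assignment $n\mapsto\mathbf{A}^n\subset\mathrm{Rep}\,S_n$ ($n\ge1$) of full subcategories closed under finite direct sums and summands, such that $\mathbf{A}^{n-1}$ is generated under direct sums and summands by the restrictions of objects of $\mathbf{A}^n$ to $S_{n-1}$. An inductive system $\mathbf{A}$ is closed if each $\mathbf{A}^n$ is closed under tensor products and duals and contains the trivial representation, and $\mathrm{Ind}^{S_{m+n}}_{S_m\times S_n}(M\boxtimes N)\in\mathbf{A}^{m+n}$ for all $M\in\mathbf{A}^m$, $N\in\mathbf{A}^n$. *)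

(* Defs.v *)
From mathcomp Require Import all_boot all_order all_fingroup all_algebra.
From mathcomp Require Import mxrepresentation character.

Set Implicit Arguments.
Unset Strict Implicit.
Unset Printing Implicit Defensive.

Import GRing.Theory.
Local Open Scope ring_scope.

Declare Scope cat_scope.
Delimit Scope cat_scope with cat.
Local Open Scope cat_scope.

Reserved Notation "g ∘ f" (at level 40, left associativity).
Reserved Notation "X ⊗ Y" (at level 38, right associativity).
Reserved Notation "f ⊗' g" (at level 38, right associativity).

(** * Tensor categories *)

(* Objects form a type and morphisms form k-modules in fixed universes: this
   is the smallness of the category.  Equality of morphisms is Leibniz
   equality. *)
Record linear_category (k : fieldType) := LinearCategory {
  ob :> Type;
  mor : ob -> ob -> lmodType k;
  idm : forall X, mor X X;
  comp : forall X Y Z, mor Y Z -> mor X Y -> mor X Z;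
  comp_idl : forall X Y (f : mor X Y), comp (idm Y) f = f;
  comp_idr : forall X Y (f : mor X Y), comp f (idm X) = f;
  compA : forall W X Y Z (h : mor Y Z) (g : mor X Y) (f : mor W X),
    comp h (comp g f) = comp (comp h g) f;
  comp_linearl : forall X Y Z (f : mor X Y) (a : k) (g g' : mor Y Z),
    comp (a *: g + g') f = a *: comp g f + comp g' f;
  comp_linearr : forall X Y Z (g : mor Y Z) (a : k) (f f' : mor X Y),
    comp g (a *: f + f') = a *: comp g f + comp g f'
}.

Arguments mor {k l} X Y : rename.
Arguments idm {k l} X : rename.
Arguments comp {k l X Y Z} g f : rename.

Notation "g ∘ f" := (comp g f) : cat_scope.

Definition is_iso (k : fieldType) (C : linear_category k) (X Y : C)
    (f : mor X Y) : Prop :=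
  exists g : mor Y X, g ∘ f = idm X /\ f ∘ g = idm Y.

Definition mono (k : fieldType) (C : linear_category k) (X Y : C)
    (f : mor X Y) : Prop :=
  forall (W : C) (g h : mor W X), f ∘ g = f ∘ h -> g = h.

Definition epi (k : fieldType) (C : linear_category k) (X Y : C)
    (f : mor X Y) : Prop :=
  forall (Z : C) (g h : mor Y Z), g ∘ f = h ∘ f -> g = h.

Definition is_zero (k : fieldType) (C : linear_category k) (X : C) : Prop :=
  idm X = 0.

Definition is_kernel (k : fieldType) (C : linear_category k) (K X Y : C)
    (f : mor X Y) (i : mor K X) : Prop :=
  f ∘ i = 0 /\
  forall (W : C) (h : mor W X), f ∘ h = 0 -> exists! u : mor W K, i ∘ u = h.

Definition is_cokernel (k : fieldType) (C : linear_category k) (X Y Q : C)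
    (f : mor X Y) (q : mor Y Q) : Prop :=
  q ∘ f = 0 /\
  forall (Z : C) (h : mor Y Z), h ∘ f = 0 -> exists! u : mor Q Z, u ∘ q = h.

(* 0 -> X -> Y -> Z -> 0 *)
Definition short_exact (k : fieldType) (C : linear_category k) (X Y Z : C)
    (f : mor X Y) (g : mor Y Z) : Prop :=
  is_kernel g f /\ is_cokernel f g.

Record abelian_category (k : fieldType) (C : linear_category k) : Prop :=
    AbelianCategory {
  abelian_zero : exists X : C, is_zero X;
  abelian_biproduct : forall X Y : C, exists (S : C) (i1 : mor X S)
      (i2 : mor Y S) (p1 : mor S X) (p2 : mor S Y),
    [/\ p1 ∘ i1 = idm X, p2 ∘ i2 = idm Y, p1 ∘ i2 = 0, p2 ∘ i1 = 0
      & i1 ∘ p1 + i2 ∘ p2 = idm S];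
  abelian_kernel : forall (X Y : C) (f : mor X Y),
    exists (K : C) (i : mor K X), is_kernel f i;
  abelian_cokernel : forall (X Y : C) (f : mor X Y),
    exists (Q : C) (q : mor Y Q), is_cokernel f q;
  abelian_mono : forall (X Y : C) (f : mor X Y), mono f ->
    exists (Z : C) (g : mor Y Z), is_kernel g f;
  abelian_epi : forall (X Y : C) (f : mor X Y), epi f ->
    exists (W : C) (g : mor W X), is_cokernel g f
}.

Definition simple_object (k : fieldType) (C : linear_category k) (S : C) :
    Prop :=
  ~ is_zero S /\
  forall (X : C) (f : mor X S), mono f -> is_zero X \/ is_iso f.

Inductive finite_length (k : fieldType) (C : linear_category k) : C -> Prop :=
| finite_length_zero X : is_zero X -> finite_length X
| finite_length_ext (X Y S : C) (f : mor X Y) (g : mor Y S) :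
    short_exact f g -> finite_length X -> simple_object S -> finite_length Y.

Definition projective (k : fieldType) (C : linear_category k) (P : C) : Prop :=
  forall (Y Z : C) (e : mor Y Z) (f : mor P Z), epi e ->
  exists h : mor P Y, e ∘ h = f.

Definition projective_cover (k : fieldType) (C : linear_category k) (X Q : C)
    (q : mor Q X) : Prop :=
  [/\ projective Q, epi q
    & forall (Y : C) (h : mor Y Q), epi (q ∘ h) -> epi h].

Record sym_monoidal_category (k : fieldType) := SymMonoidalCategory {
  sm_cat :> linear_category k;
  tunit : sm_cat;
  tens : sm_cat -> sm_cat -> sm_cat;
  tensm : forall X X' Y Y' : sm_cat,
    mor X X' -> mor Y Y' -> mor (tens X Y) (tens X' Y');
  assoc : forall X Y Z : sm_cat,
    mor (tens (tens X Y) Z) (tens X (tens Y Z));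
  assocV : forall X Y Z : sm_cat,
    mor (tens X (tens Y Z)) (tens (tens X Y) Z);
  lunit : forall X : sm_cat, mor (tens tunit X) X;
  runit : forall X : sm_cat, mor (tens X tunit) X;
  braiding : forall X Y : sm_cat, mor (tens X Y) (tens Y X);
  tensm_id : forall X Y, tensm (idm X) (idm Y) = idm (tens X Y);
  tensm_comp : forall X X' X'' Y Y' Y'' (f' : mor X' X'') (f : mor X X')
      (g' : mor Y' Y'') (g : mor Y Y'),
    tensm (f' ∘ f) (g' ∘ g) = tensm f' g' ∘ tensm f g;
  tensm_linearl : forall X X' Y Y' (a : k) (f f' : mor X X') (g : mor Y Y'),
    tensm (a *: f + f') g = a *: tensm f g + tensm f' g;
  tensm_linearr : forall X X' Y Y' (a : k) (f : mor X X') (g g' : mor Y Y'),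
    tensm f (a *: g + g') = a *: tensm f g + tensm f g';
  assocK : forall X Y Z, assocV X Y Z ∘ assoc X Y Z = idm _;
  assocVK : forall X Y Z, assoc X Y Z ∘ assocV X Y Z = idm _;
  lunit_iso : forall X, is_iso (lunit X);
  runit_iso : forall X, is_iso (runit X);
  assoc_natural : forall X X' Y Y' Z Z'
      (f : mor X X') (g : mor Y Y') (h : mor Z Z'),
    assoc X' Y' Z' ∘ tensm (tensm f g) h =
    tensm f (tensm g h) ∘ assoc X Y Z;
  lunit_natural : forall X Y (f : mor X Y),
    lunit Y ∘ tensm (idm tunit) f = f ∘ lunit X;
  runit_natural : forall X Y (f : mor X Y),
    runit Y ∘ tensm f (idm tunit) = f ∘ runit X;
  braiding_natural : forall X X' Y Y' (f : mor X X') (g : mor Y Y'),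
    braiding X' Y' ∘ tensm f g = tensm g f ∘ braiding X Y;
  pentagon : forall W X Y Z,
    assoc W X (tens Y Z) ∘ assoc (tens W X) Y Z =
    tensm (idm W) (assoc X Y Z) ∘ assoc W (tens X Y) Z
      ∘ tensm (assoc W X Y) (idm Z);
  triangle : forall X Y,
    tensm (idm X) (lunit Y) ∘ assoc X tunit Y = tensm (runit X) (idm Y);
  hexagon : forall X Y Z,
    assoc Y Z X ∘ braiding X (tens Y Z) ∘ assoc X Y Z =
    tensm (idm Y) (braiding X Z) ∘ assoc Y X Z
      ∘ tensm (braiding X Y) (idm Z);
  braiding_sym : forall X Y, braiding Y X ∘ braiding X Y = idm (tens X Y)
}.

Arguments tunit {k s} : rename.
Arguments tens {k s} X Y : rename.
Arguments tensm {k s X X' Y Y'} f g : rename.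
Arguments assoc {k s} X Y Z : rename.
Arguments assocV {k s} X Y Z : rename.
Arguments lunit {k s} X : rename.
Arguments runit {k s} X : rename.
Arguments braiding {k s} X Y : rename.

Notation "X ⊗ Y" := (tens X Y) : cat_scope.
Notation "f ⊗' g" := (tensm f g) : cat_scope.

(* In a symmetric category left duals are also right duals. *)
Definition rigid (k : fieldType) (C : sym_monoidal_category k) : Prop :=
  forall X : C, exists (X' : C) (ev : mor (X' ⊗ X) tunit)
      (coev : mor tunit (X ⊗ X')),
    runit X ∘ (idm X ⊗' ev) ∘ assoc X X' X ∘ (coev ⊗' idm X) = lunit X /\
    lunit X' ∘ (ev ⊗' idm X') ∘ assocV X' X X' ∘ (idm X' ⊗' coev) = runit X'.

Record tensor_category (k : fieldType) := TensorCategory {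
  tc_cat :> sym_monoidal_category k;
  tc_abelian : abelian_category tc_cat;
  tc_finite_length : forall X : tc_cat, finite_length X;
  tc_rigid : rigid tc_cat;
  tc_end_one : bijective (fun a : k => a *: idm (tunit : tc_cat))
}.

Definition has_projective_objects (k : fieldType) (C : linear_category k) :
    Prop :=
  exists P : C, projective P /\ ~ is_zero P.

(** * Tensor powers and the action of the symmetric groups *)

(* Y_0 ⊗ (Y_1 ⊗ (... ⊗ (Y_(n-1) ⊗ 1))) *)
Fixpoint btens (k : fieldType) (C : sym_monoidal_category k) (n : nat) :
    ('I_n -> C) -> C :=
  match n return ('I_n -> C) -> C with
  | 0 => fun=> tunit
  | m.+1 => fun Y => Y ord0 ⊗ btens (fun i => Y (lift ord0 i))
  end.

Fixpoint btensm (k : fieldType) (C : sym_monoidal_category k) (n : nat) :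
    forall Y Z : 'I_n -> C, (forall i, mor (Y i) (Z i)) ->
      mor (btens Y) (btens Z) :=
  match n return forall Y Z : 'I_n -> C, (forall i, mor (Y i) (Z i)) ->
                   mor (btens Y) (btens Z) with
  | 0 => fun _ _ _ => idm tunit
  | m.+1 => fun _ _ f => f ord0 ⊗' btensm (fun i => f (lift ord0 i))
  end.

Definition tpow (k : fieldType) (C : sym_monoidal_category k) (X : C)
    (n : nat) : C := btens (fun _ : 'I_n => X).

Definition tpowm (k : fieldType) (C : sym_monoidal_category k) (X Y : C)
    (n : nat) (f : mor X Y) : mor (tpow X n) (tpow Y n) :=
  btensm (fun _ : 'I_n => f).

Fixpoint one_tpow (k : fieldType) (C : sym_monoidal_category k) (n : nat) :
    mor (tpow (tunit : C) n) tunit :=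
  match n return mor (tpow (tunit : C) n) tunit with
  | 0 => idm tunit
  | m.+1 => one_tpow C m ∘ lunit (tpow tunit m)
  end.

Definition swap_front (k : fieldType) (C : sym_monoidal_category k)
    (X Y W : C) : mor (X ⊗ (Y ⊗ W)) (Y ⊗ (X ⊗ W)) :=
  assoc Y X W ∘ (braiding X Y ⊗' idm W) ∘ assocV X Y W.

(* Moves the factor in position 0 of X^(n+1) to position i, keeping the order
   of the other factors. *)
Fixpoint move_front (k : fieldType) (C : sym_monoidal_category k) (X : C)
    (n i : nat) : mor (tpow X n.+1) (tpow X n.+1) :=
  match n, i return mor (tpow X n.+1) (tpow X n.+1) with
  | m.+1, j.+1 => (idm X ⊗' move_front X m j) ∘ swap_front X X (tpow X m)
  | _, _ => idm _
  end.

(* The braid action of a permutation s, moving the factor in position j to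
   position s j: the last n factors are permuted by the order-preserving
   relabelling of the restriction of s, then the first one is moved to
   position s 0.  Only bijective s are meaningful.  The product of 'S_n being
   (s * t) x = t (s x), this is a right action of the group 'S_n, that is, a
   left action for the usual composition of permutations; this matches the
   row-vector convention of mx_representation. *)
Fixpoint braid (k : fieldType) (C : sym_monoidal_category k) (X : C)
    (n : nat) : ('I_n -> 'I_n) -> mor (tpow X n) (tpow X n) :=
  match n return ('I_n -> 'I_n) -> mor (tpow X n) (tpow X n) with
  | 0 => fun=> idm _
  | m.+1 => fun s =>
      move_front X m (s ord0)
        ∘ (idm X ⊗' braid X
             (fun j => odflt j (unlift (s ord0) (s (lift ord0 j)))))
  end.

(** * Frobenius-exactness *)

Definition is_image (k : fieldType) (C : linear_category k) (I X Y : C)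
    (f : mor X Y) (m : mor I Y) : Prop :=
  mono m /\ exists2 e : mor X I, epi e & m ∘ e = f.

(* c is the intersection of the subobjects a and b of T. *)
Definition is_intersection (k : fieldType) (C : linear_category k)
    (A B D T : C) (a : mor A T) (b : mor B T) (c : mor D T) : Prop :=
  (exists u : mor D A, a ∘ u = c) /\ (exists v : mor D B, b ∘ v = c) /\
  forall (W : C) (x : mor W A) (y : mor W B), a ∘ x = b ∘ y ->
  exists! w : mor W D, c ∘ w = a ∘ x.

Definition cycle_minus_one (k : fieldType) (C : sym_monoidal_category k)
    (p : nat) (X : C) : mor (tpow X p) (tpow X p) :=
  braid X (@ordS p) - idm (tpow X p).

(* c : N -> X^p is Ker g ∩ Im g^j, for g := cycle_minus_one p X. *)
Definition is_ker_cap_im (k : fieldType) (C : sym_monoidal_category k)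
    (p j : nat) (X N : C) (c : mor N (tpow X p)) : Prop :=
  let g := cycle_minus_one p X in
  exists (K I : C) (a : mor K (tpow X p)) (b : mor I (tpow X p)),
    [/\ is_kernel g a, is_image (iter j (comp g) (idm _)) b
      & is_intersection a b c].

(* A choice of Fr_i(X), with its presentation as a subquotient of X^p. *)
Record frob (k : fieldType) (C : sym_monoidal_category k) (p i : nat)
    (X : C) := Frob {
  frob_ob :> C;
  frob_num : C;
  frob_inc : mor frob_num (tpow X p);
  frob_proj : mor frob_num frob_ob;
  frob_incP : is_ker_cap_im i.-1 frob_inc;
  frob_projP : exists (D : C) (d : mor D (tpow X p)) (j : mor D frob_num),
    [/\ is_ker_cap_im i d, frob_inc ∘ j = d & is_cokernel j frob_proj]
}.

(* phi is the morphism Fr_i(f). *)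
Definition is_frob_map (k : fieldType) (C : sym_monoidal_category k)
    (p i : nat) (X Y : C) (f : mor X Y) (FX : frob p i X) (FY : frob p i Y)
    (phi : mor FX FY) : Prop :=
  exists2 u : mor (frob_num FX) (frob_num FY),
    frob_inc FY ∘ u = tpowm p f ∘ frob_inc FX
    & phi ∘ frob_proj FX = frob_proj FY ∘ u.

Definition frobenius_exact (k : fieldType) (C : sym_monoidal_category k)
    (p : nat) : Prop :=
  forall i : nat, (0 < i < p)%N ->
  forall (X Y Z : C) (f : mor X Y) (h : mor Y Z), short_exact f h ->
  forall (FX : frob p i X) (FY : frob p i Y) (FZ : frob p i Z),
  exists (phi : mor FX FY) (psi : mor FY FZ),
    [/\ is_frob_map f phi, is_frob_map h psi & short_exact phi psi].

(** * Representations of symmetric groups and inductive systems *)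

Notation repS k n := (representation k [set: 'S_n]%G).

Definition is_rep_hom (k : fieldType) (n : nat) (V W : repS k n)
    (f : 'M[k]_(rdegree V, rdegree W)) : Prop :=
  forall s : 'S_n, V s *m f = f *m W s.

Definition rep_summand (k : fieldType) (n : nat) (V W : repS k n) : Prop :=
  exists (f : 'M[k]_(rdegree V, rdegree W)) (g : 'M[k]_(rdegree W, rdegree V)),
    [/\ is_rep_hom f, is_rep_hom g & f *m g = 1%:M].

Definition rep_projective (k : fieldType) (n : nat) (V : repS k n) : Prop :=
  forall (M N : repS k n) (h : 'M[k]_(rdegree M, rdegree N))
    (f : 'M[k]_(rdegree V, rdegree N)),
  is_rep_hom h -> row_full h -> is_rep_hom f ->
  exists2 f' : 'M[k]_(rdegree V, rdegree M), is_rep_hom f' & f' *m h = f.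

Lemma triv_mx_repr (k : fieldType) (n : nat) :
  mx_repr [set: 'S_n]%G (fun=> 1%:M : 'M[k]_1).
Proof. by split=> // s t _ _; rewrite mulmx1. Qed.

Definition triv_rep (k : fieldType) (n : nat) : repS k n :=
  Representation (MxRepresentation (triv_mx_repr k n)).

Definition tensor_rep (k : fieldType) (n : nat) (V W : repS k n) : repS k n :=
  Representation (prod_repr V W).

Lemma dual_mx_repr (k : fieldType) (n : nat) (V : repS k n) :
  mx_repr [set: 'S_n]%G (fun s => (V s^-1%g)^T).
Proof.
split=> [|s t _ _]; first by rewrite invg1 repr_mx1 trmx1.
by rewrite invMg repr_mxM ?inE // trmx_mul.
Qed.

Definition dual_rep (k : fieldType) (n : nat) (V : repS k n) : repS k n :=
  Representation (MxRepresentation (dual_mx_repr V)).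

Lemma res_mx_repr (k : fieldType) (n : nat) (V : repS k n.+1) :
  mx_repr [set: 'S_n]%G (fun s : 'S_n => V (lift_perm ord_max ord_max s)).
Proof.
split=> [|s t _ _]; first by rewrite lift_perm1 repr_mx1.
by rewrite -(lift_permM _ ord_max) repr_mxM ?inE.
Qed.

(* Restriction to S_n as the stabilizer of the last point. *)
Definition res_rep (k : fieldType) (n : nat) (V : repS k n.+1) : repS k n :=
  Representation (MxRepresentation (res_mx_repr V)).

Definition young_fun (m n : nat) (s : 'S_m) (t : 'S_n) (i : 'I_(m + n)) :
    'I_(m + n) :=
  match split i with
  | inl j => lshift n (s j)
  | inr j => rshift m (t j)
  end.

Lemma young_fun_inj (m n : nat) (s : 'S_m) (t : 'S_n) :
  injective (young_fun s t).
Proof.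
apply: (can_inj (g := young_fun s^-1%g t^-1%g)) => i; rewrite /young_fun.
case: (split_ordP i) => j ->; last by rewrite (unsplitK (inr _)) permK.
by rewrite (unsplitK (inl _)) permK.
Qed.

(* The inclusion of S_m x S_n in S_(m+n). *)
Definition young_perm (m n : nat) (s : 'S_m) (t : 'S_n) : 'S_(m + n) :=
  perm (@young_fun_inj m n s t).

Definition is_young_hom (k : fieldType) (m n : nat) (M : repS k m)
    (N : repS k n) (W : repS k (m + n))
    (f : 'M[k]_(rdegree M * rdegree N, rdegree W)) : Prop :=
  forall (s : 'S_m) (t : 'S_n),
    tprod (M s) (N t) *m f = f *m W (young_perm s t).

(* W is the representation induced from the external tensor product of M and
   N, characterized by the adjunction with restriction. *)
Definition is_induced (k : fieldType) (m n : nat) (M : repS k m)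
    (N : repS k n) (W : repS k (m + n)) : Prop :=
  exists2 i : 'M[k]_(rdegree M * rdegree N, rdegree W), is_young_hom i &
  forall (U : repS k (m + n)) (f : 'M[k]_(rdegree M * rdegree N, rdegree U)),
  is_young_hom f ->
  exists! h : 'M[k]_(rdegree W, rdegree U), is_rep_hom h /\ i *m h = f.

Record inductive_system (k : fieldType) (A : forall n, repS k n -> Prop) :
    Prop := InductiveSystem {
  ind_zero : forall n, (0 < n)%N -> A n grepr0;
  ind_sum : forall n (V W : repS k n), (0 < n)%N ->
    A n V -> A n W -> A n (dadd_grepr V W);
  ind_summand : forall n (V W : repS k n), (0 < n)%N ->
    rep_summand V W -> A n W -> A n V;
  ind_res : forall n (V : repS k n), (0 < n)%N ->
    (A n V <-> exists (r : nat) (W : 'I_r -> repS k n.+1),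
       (forall i, A n.+1 (W i)) /\
       rep_summand V (\big[dadd_grepr/grepr0]_(i < r) res_rep (W i)))
}.

Record closed_inductive_system (k : fieldType)
    (A : forall n, repS k n -> Prop) : Prop := ClosedInductiveSystem {
  closed_ind : inductive_system A;
  closed_triv : forall n, (0 < n)%N -> A n (triv_rep k n);
  closed_tensor : forall n (V W : repS k n), (0 < n)%N ->
    A n V -> A n W -> A n (tensor_rep V W);
  closed_dual : forall n (V : repS k n), (0 < n)%N ->
    A n V -> A n (dual_rep V);
  closed_induced : forall m n (M : repS k m) (N : repS k n)
      (W : repS k (m + n)), (0 < m)%N -> (0 < n)%N ->
    A m M -> A n N -> is_induced M N W -> A (m + n)%N W
}.

(* V is a direct summand of the direct sum of the Hom(P_i, X_i^n), i < r, with
   inclusion (f_i)_i and projection (g_i)_i. *)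
Definition BPr (k : fieldType) (C : sym_monoidal_category k) (n : nat)
    (V : repS k n) : Prop :=
  exists (r : nat) (P X : 'I_r -> C)
    (f : forall i, {linear 'rV[k]_(rdegree V) -> mor (P i) (tpow (X i) n)})
    (g : forall i, {linear mor (P i) (tpow (X i) n) -> 'rV[k]_(rdegree V)}),
  [/\ forall i, projective (P i) /\ projective (X i),
      forall i (s : 'S_n) v, f i (v *m V s) = braid (X i) s ∘ f i v,
      forall i (s : 'S_n) x, g i (braid (X i) s ∘ x) = g i x *m V s
    & forall v, \sum_(i < r) g i (f i v) = v].

(** * Equivariant sections *)

(* Hom(Q, q^p) followed by Hom(Q, 1^p) ≃ Hom(Q, 1) has a section which is
   equivariant for the trivial action of S_p on Hom(Q, 1). *)
Definition has_equivariant_section_unit (k : fieldType)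
    (C : sym_monoidal_category k) (p : nat) (Q : C) (q : mor Q tunit) : Prop :=
  exists sec : {linear mor Q (tunit : C) -> mor Q (tpow Q p)},
    (forall f, one_tpow C p ∘ tpowm p q ∘ sec f = f) /\
    (forall (s : 'S_p) f, sec f = braid Q s ∘ sec f).

(* An element of S_lambda is a family s of permutations s i of lambda i
   points. *)
Definition has_equivariant_section (k : fieldType)
    (C : sym_monoidal_category k) (P : C) (l : nat) (lambda : 'I_l -> nat)
    (Y Z : 'I_l -> C) (e : forall i, mor (Y i) (Z i)) : Prop :=
  exists sec : {linear mor P (btens (fun i => tpow (Z i) (lambda i)))
                    -> mor P (btens (fun i => tpow (Y i) (lambda i)))},
    (forall f, btensm (fun i => tpowm (lambda i) (e i)) ∘ sec f = f) /\
    (forall (s : forall i, 'S_(lambda i)) f,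
       sec (btensm (fun i => braid (Z i) (s i)) ∘ f) =
       btensm (fun i => braid (Y i) (s i)) ∘ sec f).

(* Main.v *)
(* Let q : Q -> 1 be the projective cover.  Everything is compared with the
   existence of S_n-invariant morphisms Q -> Q^n over q.  One for n = p gives
   one for every n, by averaging over cosets of S_n in S_(n+1) when p does not
   divide n+1, and of the stabilizer of m blocks of size p in S_(mp).  Given
   a : Q -> Q^n and a section s of Q ⊗ P -> P, the map x |-> (a ⊗ x) s makes
   Hom(P, X^n) a natural equivariant retract of Hom(P, (Q ⊗ X)^n); since
   Q ⊗ Y -> Q ⊗ Z splits for every epimorphism Y -> Z, this yields (6) and,
   together with norms of mixed words in the middle term, (1).

   Conversely, exactness of Fr_1 lifts q to a C_p-invariant morphism, which is
   then averaged over the cosets of C_p.  If B^p contains a non-projective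
   module, some x in Hom(P, X^p) spans a Jordan block of size i < p that is
   not contained in a larger one; a dual block w over the dual of X and the
   inverse Gram matrix of the two blocks give a C_p-invariant tensor whose
   contraction is i times the identity, so that i != 0 in k gives a
   C_p-invariant morphism Q -> Q^p over q.

   For (2), a morphism Q -> Q ⊗ Q over q makes Hom(Q, Z) x Hom(Z ⊗ Q, 1) ->
   Hom(Q, 1) = k a perfect pairing.  Projections onto summands of
   Hom(Q, X^n ⊗ R) are thus given by morphisms, which can be tensored and
   dualized. *)
Require Import Defs.
From HB Require Import structures.
From mathcomp Require Import all_boot all_fingroup all_algebra character.
From mathcomp Require Import mxrepresentation cyclic boolp zify.
(* ssrfun also exports comp and compA. *)
Import Defs.

Set Implicit Arguments.
Unset Strict Implicit.
Unset Printing Implicit Defensive.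

Import GRing.Theory.
Local Open Scope ring_scope.
Local Open Scope cat_scope.

(** The symmetric groups act through iterated braidings of bracketed tensor products, so each
    equivariance is an identity between structural morphisms. All of these come from one coherence
    theorem: factors carry labels, and two structural morphisms with the same labelled ends agree as
    soon as the labels are distinct.

    Exactness of [Fr_i] is not checked on kernels and images directly. There are enough projectives,
    and for [P] projective Hom(P, -) is exact, so Ker g ∩ Im g^j becomes a condition on elements of
    Hom(P, X^p); natural equivariant maps between such spaces then suffice.

    The obstacle to closedness is that Hom(P, -) is not monoidal: products of elements of Hom(P,
    X^n) and Hom(P', X'^n) need not fill Hom(P ⊗ P', (X ⊗ X')^n), and a mere linear projection onto
    a summand gives no projection for a product. An auxiliary factor [R], dual to [P], moves every
    source to the single object [Q], where Hom(Q, 1) is a line and linear maps can be represented by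
    morphisms.

    The order of S_n is not invertible in [k], so averages run only over cosets of subgroups of
    index prime to p. *)

Section LinearCategory.
Variables (k : fieldType) (C : linear_category k).
Implicit Types V W X Y Z : C.

Lemma compDl X Y Z (f : mor X Y) (g g' : mor Y Z) :
  (g + g') ∘ f = g ∘ f + g' ∘ f.
Proof. by have := comp_linearl f 1 g g'; rewrite !scale1r. Qed.
Lemma compDr X Y Z (g : mor Y Z) (f f' : mor X Y) :
  g ∘ (f + f') = g ∘ f + g ∘ f'.
Proof. by have := comp_linearr g 1 f f'; rewrite !scale1r. Qed.
Lemma comp0l X Y Z (f : mor X Y) : (0 : mor Y Z) ∘ f = 0.
Proof. by apply: (@addIr _ (0 ∘ f)); rewrite -compDl !add0r. Qed.
Lemma comp0r X Y Z (g : mor Y Z) : g ∘ (0 : mor X Y) = 0.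
Proof. by apply: (@addIr _ (g ∘ 0)); rewrite -compDr !add0r. Qed.
Lemma compZl X Y Z (f : mor X Y) a (g : mor Y Z) : (a *: g) ∘ f = a *: (g ∘ f).
Proof. by have := comp_linearl f a g 0; rewrite comp0l !addr0. Qed.
Lemma compZr X Y Z (g : mor Y Z) a (f : mor X Y) : g ∘ (a *: f) = a *: (g ∘ f).
Proof. by have := comp_linearr g a f 0; rewrite comp0r !addr0. Qed.
Lemma compNl X Y Z (f : mor X Y) (g : mor Y Z) : (- g) ∘ f = - (g ∘ f).
Proof. by rewrite -scaleN1r compZl scaleN1r. Qed.
Lemma compNr X Y Z (g : mor Y Z) (f : mor X Y) : g ∘ (- f) = - (g ∘ f).
Proof. by rewrite -scaleN1r compZr scaleN1r. Qed.
Lemma compBl X Y Z (f : mor X Y) (g g' : mor Y Z) :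
  (g - g') ∘ f = g ∘ f - g' ∘ f.
Proof. by rewrite compDl compNl. Qed.
Lemma compBr X Y Z (g : mor Y Z) (f f' : mor X Y) :
  g ∘ (f - f') = g ∘ f - g ∘ f'.
Proof. by rewrite compDr compNr. Qed.
Lemma comp_suml X Y Z (f : mor X Y) I r (P : pred I) (g : I -> mor Y Z) :
  (\sum_(i <- r | P i) g i) ∘ f = \sum_(i <- r | P i) (g i ∘ f).
Proof. by rewrite (big_morph (comp^~ f) (fun _ _ => compDl _ _ _) (comp0l _ _)). Qed.
Lemma comp_sumr X Y Z (g : mor Y Z) I r (P : pred I) (f : I -> mor X Y) :
  g ∘ (\sum_(i <- r | P i) f i) = \sum_(i <- r | P i) (g ∘ f i).
Proof. by rewrite (big_morph (comp g) (fun _ _ => compDr _ _ _) (comp0r _ _)). Qed.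

(** Composites are kept left-associated, so an inner pair [b ∘ a] is not a subterm; this rewrites it
    in place. *)
Lemma compE X Y Z W (h : mor Z W) (b : mor Y Z) (a : mor X Y) (c : mor X Z) :
  b ∘ a = c -> h ∘ b ∘ a = h ∘ c.
Proof. by move<-; rewrite compA. Qed.

Lemma compE3 V W X Y Z (h : mor Y Z) (c : mor X Y) (b : mor W X) (a : mor V W) d :
  c ∘ b ∘ a = d -> h ∘ c ∘ b ∘ a = h ∘ d.
Proof. by move<-; rewrite !compA. Qed.

Lemma iso_epi X Y (f : mor X Y) : is_iso f -> epi f.
Proof.
by move=> [g [_ fg]] Z u v E; rewrite -[u]comp_idr -[v]comp_idr -fg !compA E.
Qed.
Lemma iso_mono X Y (f : mor X Y) : is_iso f -> mono f.
Proof.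
by move=> [g [gf _]] Z u v E; rewrite -[u]comp_idl -[v]comp_idl -gf -!compA E.
Qed.
Lemma iso_comp X Y Z (g : mor Y Z) (f : mor X Y) :
  is_iso g -> is_iso f -> is_iso (g ∘ f).
Proof.
move=> [g' [g'g gg']] [f' [f'f ff']]; exists (f' ∘ g'); split.
  by rewrite -compA [g' ∘ _]compA g'g comp_idl.
by rewrite -compA [f ∘ _]compA ff' comp_idl.
Qed.
Lemma iso_id X : is_iso (idm X).
Proof. by exists (idm X); rewrite comp_idl. Qed.
Lemma mono_comp X Y Z (g : mor Y Z) (f : mor X Y) :
  mono g -> mono f -> mono (g ∘ f).
Proof. by move=> mg mf W u v; rewrite -!compA => /mg/mf. Qed.
Lemma epi_comp X Y Z (g : mor Y Z) (f : mor X Y) :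
  epi g -> epi f -> epi (g ∘ f).
Proof. by move=> eg ef W u v; rewrite !compA => /ef/eg. Qed.
Lemma mono_cancel X Y Z (g : mor Y Z) (f : mor X Y) : mono (g ∘ f) -> mono f.
Proof. by move=> m W u v E; apply: m; rewrite -!compA E. Qed.
Lemma epi_cancel X Y Z (g : mor Y Z) (f : mor X Y) : epi (g ∘ f) -> epi g.
Proof. by move=> m W u v E; apply: m; rewrite !compA E. Qed.
Lemma mono0 X Y (f : mor X Y) :
  (forall W (g : mor W X), f ∘ g = 0 -> g = 0) -> mono f.
Proof.
move=> H W g h E; apply/eqP; rewrite -subr_eq0; apply/eqP/H.
by rewrite compBr E subrr.
Qed.
Lemma epi0 X Y (f : mor X Y) :
  (forall W (g : mor Y W), g ∘ f = 0 -> g = 0) -> epi f.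
Proof.
move=> H W g h E; apply/eqP; rewrite -subr_eq0; apply/eqP/H.
by rewrite compBl E subrr.
Qed.
Lemma mono_eq0 X Y (f : mor X Y) W (g : mor W X) : mono f -> f ∘ g = 0 -> g = 0.
Proof. by move=> m E; apply: m; rewrite E comp0r. Qed.
Lemma epi_eq0 X Y (f : mor X Y) W (g : mor Y W) : epi f -> g ∘ f = 0 -> g = 0.
Proof. by move=> m E; apply: m; rewrite E comp0l. Qed.

End LinearCategory.

(** * Units, hexagons and the Yang-Baxter relation *)

Section Monoidal.
Variables (k : fieldType) (C : sym_monoidal_category k).
Implicit Types X Y Z W A B D : C.

Lemma tensmDl X X' Y Y' (f f' : mor X X') (g : mor Y Y') :
  (f + f') ⊗' g = f ⊗' g + f' ⊗' g.
Proof. by have := tensm_linearl 1 f f' g; rewrite !scale1r. Qed.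
Lemma tensmDr X X' Y Y' (f : mor X X') (g g' : mor Y Y') :
  f ⊗' (g + g') = f ⊗' g + f ⊗' g'.
Proof. by have := tensm_linearr 1 f g g'; rewrite !scale1r. Qed.
Lemma tensm0l X X' Y Y' (g : mor Y Y') : (0 : mor X X') ⊗' g = 0.
Proof. by apply: (@addIr _ (0 ⊗' g)); rewrite -tensmDl !add0r. Qed.
Lemma tensm0r X X' Y Y' (f : mor X X') : f ⊗' (0 : mor Y Y') = 0.
Proof. by apply: (@addIr _ (f ⊗' 0)); rewrite -tensmDr !add0r. Qed.
Lemma tensmZl X X' Y Y' a (f : mor X X') (g : mor Y Y') :
  (a *: f) ⊗' g = a *: (f ⊗' g).
Proof. by have := tensm_linearl a f 0 g; rewrite tensm0l !addr0. Qed.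
Lemma tensmZr X X' Y Y' a (f : mor X X') (g : mor Y Y') :
  f ⊗' (a *: g) = a *: (f ⊗' g).
Proof. by have := tensm_linearr a f g 0; rewrite tensm0r !addr0. Qed.
Lemma tensm_suml X X' Y Y' (g : mor Y Y') I r (P : pred I) (f : I -> mor X X') :
  (\sum_(i <- r | P i) f i) ⊗' g = \sum_(i <- r | P i) (f i ⊗' g).
Proof. by rewrite (big_morph (fun f => f ⊗' g) (fun _ _ => tensmDl _ _ _) (tensm0l _ _ _)). Qed.
Lemma tensm_sumr X X' Y Y' (f : mor X X') I r (P : pred I) (g : I -> mor Y Y') :
  f ⊗' (\sum_(i <- r | P i) g i) = \sum_(i <- r | P i) (f ⊗' g i).
Proof. by rewrite (big_morph (fun g => f ⊗' g) (fun _ _ => tensmDr _ _ _) (tensm0r _ _ _)). Qed.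

Lemma tensm_idcomp X Y Y' Y'' (g' : mor Y' Y'') (g : mor Y Y') :
  idm X ⊗' (g' ∘ g) = (idm X ⊗' g') ∘ (idm X ⊗' g).
Proof. by rewrite -tensm_comp comp_idl. Qed.
Lemma tensm_compid X Y Y' Y'' (g' : mor Y' Y'') (g : mor Y Y') :
  (g' ∘ g) ⊗' idm X = (g' ⊗' idm X) ∘ (g ⊗' idm X).
Proof. by rewrite -tensm_comp comp_idl. Qed.
Lemma tensm_lr X X' Y Y' (f : mor X X') (g : mor Y Y') :
  (f ⊗' idm Y') ∘ (idm X ⊗' g) = f ⊗' g.
Proof. by rewrite -tensm_comp comp_idl comp_idr. Qed.
Lemma tensm_rl X X' Y Y' (f : mor X X') (g : mor Y Y') :
  (idm X' ⊗' g) ∘ (f ⊗' idm Y) = f ⊗' g.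
Proof. by rewrite -tensm_comp comp_idl comp_idr. Qed.
Lemma tensm_swap X X' Y Y' (f : mor X X') (g : mor Y Y') :
  (f ⊗' idm Y') ∘ (idm X ⊗' g) = (idm X' ⊗' g) ∘ (f ⊗' idm Y).
Proof. by rewrite tensm_lr tensm_rl. Qed.

Lemma iso_tensm X X' Y Y' (f : mor X X') (g : mor Y Y') :
  is_iso f -> is_iso g -> is_iso (f ⊗' g).
Proof.
move=> [f' [f'f ff']] [g' [g'g gg']]; exists (f' ⊗' g').
by rewrite -!tensm_comp f'f ff' g'g gg' !tensm_id.
Qed.
Lemma iso_assoc X Y Z : is_iso (assoc X Y Z).
Proof. by exists (assocV X Y Z); rewrite assocK assocVK. Qed.
Lemma iso_assocV X Y Z : is_iso (assocV X Y Z).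
Proof. by exists (assoc X Y Z); rewrite assocK assocVK. Qed.
Lemma iso_braiding X Y : is_iso (braiding X Y).
Proof. by exists (braiding Y X); rewrite !braiding_sym. Qed.

Lemma assocV_natural X X' Y Y' Z Z' (f : mor X X') (g : mor Y Y') (h : mor Z Z') :
  assocV X' Y' Z' ∘ (f ⊗' (g ⊗' h)) = ((f ⊗' g) ⊗' h) ∘ assocV X Y Z.
Proof.
apply: (iso_mono (iso_assoc _ _ _)); rewrite compA assocVK comp_idl.
by rewrite compA assoc_natural -compA assocVK comp_idr.
Qed.

(** Tensoring with the unit is faithful, [lunit] being a natural isomorphism. *)
Lemma tunit_tens_inj X Y (f g : mor X Y) :
  idm (tunit : C) ⊗' f = idm tunit ⊗' g -> f = g.
Proof.
move=> E; apply: (iso_epi (lunit_iso X)).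
by rewrite -!lunit_natural E.
Qed.
Lemma tens_tunit_inj X Y (f g : mor X Y) :
  f ⊗' idm (tunit : C) = g ⊗' idm tunit -> f = g.
Proof.
move=> E; apply: (iso_epi (runit_iso X)).
by rewrite -!runit_natural E.
Qed.

(** Kelly's argument: it is enough to compare after tensoring with the unit, where the pentagon and
    the triangles apply. *)
Lemma lunit_assoc X Y : lunit (X ⊗ Y) ∘ assoc tunit X Y = lunit X ⊗' idm Y.
Proof.
apply: tunit_tens_inj; rewrite tensm_idcomp.
have e1 : is_iso (assoc tunit (tunit ⊗ X) Y ∘ (assoc tunit tunit X ⊗' idm Y)).
  by apply: iso_comp; [|apply: iso_tensm; [|apply: iso_id]]; apply: iso_assoc.
apply: (iso_epi e1); rewrite -compA [(idm tunit ⊗' assoc tunit X Y) ∘ _]compA.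
rewrite -pentagon !compA triangle -tensm_id -assoc_natural -triangle.
by rewrite tensm_compid !compA -assoc_natural.
Qed.

(** Compatibility of the braiding with units is not among the axioms. It follows from the hexagon at
    [X], 1, 1 by cancelling an invertible braiding. *)
Lemma lunit_braiding X : lunit X ∘ braiding X tunit = runit X.
Proof.
apply: tens_tunit_inj; apply: (iso_mono (iso_braiding _ _)).
rewrite tensm_compid compA.
have := congr1 (comp (lunit _)) (hexagon X tunit tunit).
rewrite !compA lunit_assoc lunit_natural -(compA (braiding _ _)) lunit_assoc.
by move=> <-; rewrite -braiding_natural -compA triangle.
Qed.

(* [swap_front], locked so that rewriting does not unfold it. *)
Fact sw_key : unit. Proof. by []. Qed.
Definition sw X Y W : mor (X ⊗ (Y ⊗ W)) (Y ⊗ (X ⊗ W)) :=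
  locked_with sw_key (swap_front X Y W).

Lemma sw_front X Y W : swap_front X Y W = sw X Y W.
Proof. by rewrite /sw unlock. Qed.
Lemma swE X Y W :
  sw X Y W = assoc Y X W ∘ (braiding X Y ⊗' idm W) ∘ assocV X Y W.
Proof. by rewrite -sw_front. Qed.

Lemma swap_natural X X' Y Y' W W' (f : mor X X') (g : mor Y Y') (h : mor W W') :
  sw X' Y' W' ∘ (f ⊗' (g ⊗' h)) = (g ⊗' (f ⊗' h)) ∘ sw X Y W.
Proof.
rewrite !swE -compA assocV_natural !compA -assoc_natural; congr comp.
by rewrite -!compA -!tensm_comp braiding_natural comp_idl comp_idr.
Qed.

Lemma swapK X Y W : sw Y X W ∘ sw X Y W = idm _.
Proof.
rewrite !swE !compA (compE _ (assocK _ _ _)) comp_idr.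
by rewrite (compE _ (esym (tensm_compid _ _ _))) braiding_sym tensm_id comp_idr assocVK.
Qed.

Lemma iso_swap X Y W : is_iso (sw X Y W).
Proof. by exists (sw Y X W); rewrite !swapK. Qed.

Lemma pentagonV A X Z W :
  assoc (A ⊗ X) Z W ∘ (assocV A X Z ⊗' idm W) ∘ assocV A (X ⊗ Z) W =
  assocV A X (Z ⊗ W) ∘ (idm A ⊗' assoc X Z W).
Proof.
have e1 : is_iso (assoc A (X ⊗ Z) W ∘ (assoc A X Z ⊗' idm W)).
  by apply: iso_comp; [|apply: iso_tensm; [|apply: iso_id]]; apply: iso_assoc.
apply: (iso_epi e1); apply: (iso_mono (iso_assoc A X (Z ⊗ W))).
rewrite !compA assocVK comp_idl -pentagon (compE _ (assocK _ _ _)) comp_idr.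
by rewrite (compE _ (esym (tensm_compid _ _ _))) assocK tensm_id comp_idr.
Qed.

(** The hexagon for [sw]: passing [Y ⊗ Z] is passing [Y] and then [Z]. The trailing factor [W] keeps
    objects right-nested. *)
Lemma swap_hexagon X Y Z W :
  assoc Y Z (X ⊗ W) ∘ sw X (Y ⊗ Z) W =
  (idm Y ⊗' sw X Z W) ∘ sw X Y (Z ⊗ W)
    ∘ (idm X ⊗' assoc Y Z W).
Proof.
rewrite {1}swE !compA pentagon.
rewrite [_ ∘ (assoc Y Z X ⊗' idm W) ∘ _](compE _ (esym (tensm_compid _ _ _))).
have -> : assoc Y Z X ∘ braiding X (Y ⊗ Z) =
  (idm Y ⊗' braiding X Z) ∘ assoc Y X Z ∘ (braiding X Y ⊗' idm Z) ∘ assocV X Y Z.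
  by rewrite -hexagon -[RHS]compA assocVK comp_idr.
rewrite !tensm_compid !compA (compE _ (assoc_natural _ _ _)) !compA.
rewrite -[_ ∘ (assoc Y X Z ⊗' idm W)]compA.
have -> : assoc Y (X ⊗ Z) W ∘ (assoc Y X Z ⊗' idm W) =
  (idm Y ⊗' assocV X Z W) ∘ assoc Y X (Z ⊗ W) ∘ assoc (Y ⊗ X) Z W.
  rewrite -[RHS]compA pentagon !compA (esym (tensm_idcomp _ _ _)) assocK tensm_id.
  by rewrite comp_idl.
rewrite !compA (compE _ (assoc_natural _ _ _)) tensm_id !compA.
rewrite -[_ ∘ (assocV X Y Z ⊗' _)]compA -[_ ∘ assocV X (Y ⊗ Z) W]compA pentagonV.
by rewrite !swE !tensm_idcomp !compA.
Qed.

Lemma swap_hexagonl X Y Z W :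
  (idm Z ⊗' assoc X Y W) ∘ sw (X ⊗ Y) Z W =
  sw X Z (Y ⊗ W) ∘ (idm X ⊗' sw Y Z W) ∘ assoc X Y (Z ⊗ W).
Proof.
apply: (iso_epi (iso_swap Z (X ⊗ Y) W)).
rewrite -compA swapK comp_idr (compE _ (swap_hexagon Z X Y W)) !compA.
rewrite (compE _ (esym (tensm_idcomp _ _ _))) swapK tensm_id comp_idr.
by rewrite swapK comp_idl.
Qed.

Lemma swap_unit X W :
  lunit (X ⊗ W) ∘ sw X tunit W = idm X ⊗' lunit W.
Proof.
rewrite swE !compA lunit_assoc (esym (tensm_compid _ _ _)) lunit_braiding.
by rewrite -triangle -compA assocVK comp_idr.
Qed.

Lemma swap_unitl X W :
  (idm X ⊗' lunit W) ∘ sw tunit X W = lunit (X ⊗ W).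
Proof. by rewrite -swap_unit -compA swapK comp_idr. Qed.

(** Naturality of [sw] for the braiding of [B] and [D]. It serves when a letter is moved to the
    front past two letters that are themselves exchanged. *)
Lemma yang_baxter A B D W :
  (idm D ⊗' sw A B W) ∘ sw A D (B ⊗ W)
     ∘ (idm A ⊗' sw B D W) =
  sw B D (A ⊗ W) ∘ (idm B ⊗' sw A D W)
     ∘ sw A B (D ⊗ W).
Proof.
rewrite {1}[sw B D W]swE !tensm_idcomp !compA.
rewrite -[_ ∘ (idm A ⊗' assoc D B W)]swap_hexagon.
rewrite -[_ ∘ (idm A ⊗' (braiding B D ⊗' idm W))]compA swap_natural tensm_id.
rewrite [sw B D (A ⊗ W)]swE !compA -!(compA (assoc D B _ ∘ (braiding B D ⊗' _))).
congr (_ ∘ _); apply: (iso_mono (iso_assoc B D _)); rewrite !compA assocVK comp_idl.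
rewrite swap_hexagon (compE _ (esym (tensm_idcomp _ _ _))) assocVK tensm_id.
by rewrite comp_idr.
Qed.

End Monoidal.

(** * Coherence for symmetric monoidal categories *)

Section Words.
Variables (k : fieldType) (C : sym_monoidal_category k).
Variables (L : eqType) (env : L -> C).
Implicit Types (w : seq L) (a b : L).

Fixpoint ltens w : C := if w is a :: w' then env a ⊗ ltens w' else tunit.

(** Between right-nested words no associators or unitors remain, so structural morphisms are
    generated by exchanges of adjacent letters. *)
Inductive word : forall w w', mor (ltens w) (ltens w') -> Prop :=
| word_id w : @word w w (idm _)
| word_comp w w' w'' (g : mor (ltens w') (ltens w'')) f :
    word g -> @word w w' f -> word (g ∘ f)
| word_cons a w w' f : @word w w' f -> @word (a :: w) (a :: w') (idm (env a) ⊗' f)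
| word_swap a b w :
    @word [:: a, b & w] [:: b, a & w] (sw (env a) (env b) (ltens w)).

Lemma word_inv w w' f : @word w w' f ->
  exists2 h, @word w' w h & h ∘ f = idm _ /\ f ∘ h = idm _.
Proof.
elim=> {w w' f} [w|w w' w'' g f _ [g' wg' [gK gK']] _ [f' wf' [fK fK']]
  |a w w' f _ [f' wf' [fK fK']]|a b w].
- by exists (idm _); [apply: word_id|rewrite comp_idl].
- exists (f' ∘ g'); first exact: word_comp.
  rewrite !compA (compE _ gK) comp_idr fK; split=> //.
  by rewrite (compE _ fK') comp_idr.
- by exists (idm _ ⊗' f'); [apply: word_cons|rewrite -!tensm_idcomp fK fK' !tensm_id].
- by exists (sw _ _ _); [apply: word_swap|rewrite !swapK].
Qed.

(* A way of moving one of the letters [a] to the front of [w]. *)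
Record extr a w := Extr { erest : seq L; emor : mor (ltens w) (env a ⊗ ltens erest) }.

Definition env_cast b a (E : b = a) : mor (env b) (env a) :=
  match E in _ = c return mor (env b) (env c) with erefl => idm _ end.

Definition extr_here b a w (E : b = a) : extr a (b :: w) :=
  @Extr a (b :: w) w (env_cast E ⊗' idm _).
Definition extr_there b a w (x : extr a w) : extr a (b :: w) :=
  @Extr a (b :: w) (b :: erest x)
    (sw (env b) (env a) (ltens (erest x)) ∘ (idm (env b) ⊗' emor x)).

Fixpoint extrs a w : extr a w -> Prop :=
  if w is b :: w' return extr a w -> Prop then fun x =>
    (exists E : b = a, x = extr_here w' E) \/
    (exists2 y, extrs y & x = extr_there b y)
  else fun=> False.

(** A letter taken out after [f] can be taken out before it, and what remains of [f] is again a
    word. This peels one letter off a word morphism. *)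
Lemma extrs_word w w' f : @word w w' f ->
  forall a (x' : extr a w'), extrs x' ->
  exists (x : extr a w) f', [/\ extrs x, @word (erest x) (erest x') f'
    & emor x' ∘ f = (idm _ ⊗' f') ∘ emor x].
Proof.
elim=> {w w' f} [w|w w' w'' g f _ IHg _ IHf|b w w' f wf IH|b c w] a x'.
- by move=> ax; exists x', (idm _); split; [|apply: word_id|rewrite tensm_id comp_idl comp_idr].
- move=> /IHg[y [g' [ay wg' Eg]]]; have [x [f' [ax wf' Ef]]] := IHf _ _ ay.
  exists x, (g' ∘ f'); split=> //; first exact: word_comp.
  by rewrite compA Eg -compA Ef compA tensm_idcomp.
- case=> [[E ->]|[y /IH[x [f' [ax wf' Ef]]] ->]].
    exists (extr_here w E), f; split=> //=; first by left; exists E.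
    by rewrite -!tensm_comp !comp_idl !comp_idr.
  exists (extr_there b x), (idm _ ⊗' f'); split=> /=; [by right; exists x|exact: word_cons|].
  by rewrite !compA -swap_natural -!compA -!tensm_idcomp Ef.
- case=> [[E ->]|[y [[E ->]|[z az ->]] ->]] /=.
  + exists (extr_there b (extr_here w E)), (idm _); split; last 1 first.
    * by case: _ / E; rewrite /= !tensm_id !comp_idr !comp_idl.
    * by right; exists (extr_here w E); [left; exists E|].
    * exact: word_id.
  + exists (extr_here (c :: w) E), (idm _); split; last 1 first.
    * by case: _ / E; rewrite /= !tensm_id !comp_idr swapK.
    * by left; exists E.
    * exact: word_id.
  + exists (extr_there b (extr_there c z)), (sw _ _ _); split=> /=; last 1 first.
    * rewrite !tensm_idcomp !compA yang_baxter.
      by rewrite -[in RHS]compA [in RHS]swap_natural !compA.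
    * by right; exists (extr_there c z) => //; right; exists z.
    * exact: word_swap.
Qed.

Lemma extrs_mem a w (x : extr a w) : extrs x -> perm_eq w (a :: erest x).
Proof.
elim: w x => [|b w IH] //= x [[E ->]|[y /IH py ->]] /=; first by rewrite E.
rewrite -(perm_cons b) in py; apply: (perm_trans py).
by apply/seq.permP=> p /=; rewrite addnCA.
Qed.

(** A letter that occurs once can be taken out in one way; proofs of equality of letters are unique
    because [L] has decidable equality. *)
Lemma extrs_uniq a w (x y : extr a w) : uniq w -> extrs x -> extrs y -> x = y.
Proof.
elim: w x y => [|b w IH] //= x y /andP[bw uw].
case=> [[E ->]|[x' ax ->]] [[E' ->]|[y' ay ->]].
- by rewrite (eq_irrelevance E E').
- by case/negP: bw; rewrite (perm_mem (extrs_mem ay)) inE; apply/orP; left; apply/eqP.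
- by case/negP: bw; rewrite (perm_mem (extrs_mem ax)) inE; apply/orP; left; apply/eqP.
- by rewrite (IH x' y').
Qed.

(** A dependent match, so that the statement on the empty word can be proved by induction on [word],
    whose indices must be variables. *)
Definition trivial_word w w' : mor (ltens w) (ltens w') -> Prop :=
  match w, w' return mor (ltens w) (ltens w') -> Prop with
  | [::], [::] => fun f => f = idm _
  | _ :: _, _ :: _ => fun=> True
  | _, _ => fun=> False
  end.

Lemma word_nil w w' f : @word w w' f -> trivial_word f.
Proof.
elim=> {w w' f} [[|a w]|w w' w'' g f _ Hg _ Hf|a w w' f _ _|a b w] //=.
case: w w' w'' g f Hg Hf => [|? ?] [|? ?] [|? ?] //= g f -> ->.
by rewrite comp_idl.
Qed.

(** The coherence theorem for words. Following the first letter of the target back through [f] and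
    [g] factors both through the same extraction, and the rests agree by induction. *)
Lemma word_uniq w' w f g : uniq w -> @word w w' f -> @word w w' g -> f = g.
Proof.
elim: w' w f g => [|a w' IH] w f g uw wf wg.
  case: w f g uw wf wg => [|b w] f g _ /word_nil/= Hf /word_nil/= Hg //.
  by rewrite Hf Hg.
have x0 : extrs (extr_here w' (erefl a)) by left; exists (erefl a).
have [x [f' [ax wf' /= Ef]]] := extrs_word wf x0.
have [y [g' [ay wg' /= Eg]]] := extrs_word wg x0.
move: Ef Eg; rewrite tensm_id !comp_idl => -> ->.
have E := extrs_uniq uw ax ay; case: _ / E g' wg' {ay} => g' wg'.
rewrite (IH _ f' g') //.
by move: uw; rewrite (perm_uniq (extrs_mem ax)) => /andP[].
Qed.

(** Indexed by the object it denotes, so that coherence is stated for morphisms of [C] without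
    transport, while equal objects may carry different labels. *)
Inductive bracketing : C -> Type :=
| Leaf a : bracketing (env a)
| Unit : bracketing tunit
| Node X Y : bracketing X -> bracketing Y -> bracketing (X ⊗ Y).

(* With the accumulator [acc] the associativity and unit laws hold by
   conversion. *)
Fixpoint flat X (t : bracketing X) (acc : seq L) : seq L :=
  match t with
  | Leaf a => a :: acc
  | Unit => acc
  | Node _ _ t u => flat t (flat u acc)
  end.

Fixpoint nrm X (t : bracketing X) (acc : seq L) :
    mor (X ⊗ ltens acc) (ltens (flat t acc)) :=
  match t in bracketing X return mor (X ⊗ ltens acc) (ltens (flat t acc)) with
  | Leaf a => idm _
  | Unit => lunit _
  | Node _ _ t u => nrm t (flat u acc) ∘ (idm _ ⊗' nrm u acc) ∘ assoc _ _ _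
  end.

Lemma nrm_iso X (t : bracketing X) acc : is_iso (nrm t acc).
Proof.
elim: t acc => [a|| {}X Y t IHt u IHu] acc /=; first exact: iso_id.
  exact: lunit_iso.
apply: iso_comp; last exact: iso_assoc.
by apply: iso_comp; [exact: IHt|apply: iso_tensm; [exact: iso_id|exact: IHu]].
Qed.

Lemma nrm_word X (t : bracketing X) acc acc' g : @word acc acc' g ->
  exists2 h, @word (flat t acc) (flat t acc') h &
    nrm t acc' ∘ (idm X ⊗' g) = h ∘ nrm t acc.
Proof.
elim: t acc acc' g => [a|| {}X Y t IHt u IHu] acc acc' g wg /=.
- by exists (idm _ ⊗' g); [exact: word_cons|rewrite comp_idl comp_idr].
- by exists g => //; rewrite lunit_natural.
have [h /IHt[h' wh' E'] E] := IHu _ _ _ wg.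
exists h' => //; rewrite !compA -E' -(compA _ (_ ⊗' h)) -tensm_idcomp -E.
rewrite tensm_idcomp !compA -compA -[RHS]compA; congr (_ ∘ _).
by rewrite -assoc_natural tensm_id.
Qed.

(** Quantifying over [acc] makes the notion stable under tensor products: the left factor is
    flattened in front of the flattened right factor. *)
Definition coherent X Y (t : bracketing X) (t' : bracketing Y) (f : mor X Y) : Prop :=
  forall acc, exists2 g, @word (flat t acc) (flat t' acc) g &
    nrm t' acc ∘ (f ⊗' idm _) = g ∘ nrm t acc.

Lemma coherent_uniq X Y (t : bracketing X) (t' : bracketing Y) f g :
  uniq (flat t [::]) -> coherent t t' f -> coherent t t' g -> f = g.
Proof.
move=> ut /(_ [::])[h wh Eh] /(_ [::])[h' wh' Eh'].
apply: tens_tunit_inj; apply: (iso_mono (nrm_iso t' [::])).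
by rewrite Eh Eh' (word_uniq ut wh wh').
Qed.

Lemma coh_id X (t : bracketing X) : coherent t t (idm X).
Proof.
move=> acc; exists (idm _); first exact: word_id.
by rewrite tensm_id comp_idl comp_idr.
Qed.

Lemma coh_comp X Y Z (t : bracketing X) (u : bracketing Y) (v : bracketing Z) g f :
  coherent u v g -> coherent t u f -> coherent t v (g ∘ f).
Proof.
move=> cg cf acc; have [g' wg Eg] := cg acc; have [f' wf Ef] := cf acc.
exists (g' ∘ f'); first exact: word_comp.
by rewrite tensm_compid compA Eg -compA Ef compA.
Qed.

Lemma coh_inv X Y (t : bracketing X) (u : bracketing Y) f g :
  f ∘ g = idm _ -> coherent t u f -> coherent u t g.
Proof.
move=> fg cf acc; have [f' /word_inv[h wh [hK _]] Ef] := cf acc; exists h => //.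
have -> : nrm u acc = f' ∘ nrm t acc ∘ (g ⊗' idm _).
  by rewrite -Ef -compA -tensm_compid fg tensm_id comp_idr.
by rewrite !compA hK comp_idl.
Qed.

Lemma coh_tensm X X' Y Y' (t : bracketing X) (t' : bracketing X') (u : bracketing Y)
    (u' : bracketing Y') f g :
  coherent t t' f -> coherent u u' g -> coherent (Node t u) (Node t' u') (f ⊗' g).
Proof.
move=> cf cg acc /=; have [g' wg Eg] := cg acc.
have [f' wf Ef] := cf (flat u' acc); have [h wh Eh] := nrm_word t wg.
exists (f' ∘ h); first exact: word_comp.
rewrite -compA assoc_natural !compA; congr (_ ∘ _).
rewrite -compA -tensm_comp comp_idl Eg -[RHS]compA -[RHS]compA.
rewrite [h ∘ _]compA -Eh -(tensm_lr f) !compA Ef -!compA; do 2! congr (_ ∘ _).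
by rewrite -tensm_idcomp.
Qed.

Lemma coh_assoc X Y Z (t : bracketing X) (u : bracketing Y) (v : bracketing Z) :
  coherent (Node (Node t u) v) (Node t (Node u v)) (assoc X Y Z).
Proof.
move=> acc /=; exists (idm _); first exact: word_id.
rewrite comp_idl !tensm_idcomp -!compA; do 2! congr (_ ∘ _).
rewrite [(_ ⊗' assoc _ _ _) ∘ _]compA -pentagon !compA.
by rewrite -assoc_natural tensm_id.
Qed.

Lemma coh_assocV X Y Z (t : bracketing X) (u : bracketing Y) (v : bracketing Z) :
  coherent (Node t (Node u v)) (Node (Node t u) v) (assocV X Y Z).
Proof. exact: coh_inv (assocVK _ _ _) (coh_assoc t u v). Qed.

Lemma coh_lunit X (t : bracketing X) : coherent (Node Unit t) t (lunit X).
Proof.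
move=> acc /=; exists (idm _); first exact: word_id.
by rewrite comp_idl lunit_natural -compA lunit_assoc.
Qed.

Lemma coh_runit X (t : bracketing X) : coherent (Node t Unit) t (runit X).
Proof.
move=> acc /=; exists (idm _); first exact: word_id.
by rewrite comp_idl -compA triangle.
Qed.

(** A single letter is moved across a bracketing by induction on the latter; [nrm_sw] then moves a
    whole bracketing, one letter at a time. *)
Lemma nrm_sw_leaf a Y (u : bracketing Y) acc :
  exists2 g, @word (a :: flat u acc) (flat u (a :: acc)) g &
    nrm u (a :: acc) ∘ sw (env a) Y (ltens acc) = g ∘ (idm (env a) ⊗' nrm u acc).
Proof.
elim: u acc => [b|| {}Y Z u IHu v IHv] acc /=.
- exists (sw _ _ _); first exact: word_swap.
  by rewrite tensm_id comp_idl comp_idr.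
- exists (idm _); first exact: word_id.
  by rewrite swap_unit comp_idl.
have [g wg Eg] := IHu (flat v acc); have [g' wg' Eg'] := IHv acc.
have [h wh Eh] := nrm_word u wg'.
exists (h ∘ g); first exact: word_comp.
rewrite -compA swap_hexagon !compA.
rewrite -[_ ∘ (idm Y ⊗' sw _ _ _)]compA -tensm_idcomp Eg' tensm_idcomp.
rewrite compA Eh -!compA [(idm Y ⊗' _) ∘ _]compA -swap_natural -!compA.
rewrite [nrm u (a :: _) ∘ _]compA Eg -!compA; do 2! congr (_ ∘ _).
by rewrite -!tensm_idcomp.
Qed.

Lemma nrm_sw X Y (t : bracketing X) (u : bracketing Y) acc :
  exists2 g, @word (flat t (flat u acc)) (flat u (flat t acc)) g &
    nrm u (flat t acc) ∘ (idm Y ⊗' nrm t acc) ∘ sw X Y (ltens acc) =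
    g ∘ nrm t (flat u acc) ∘ (idm X ⊗' nrm u acc).
Proof.
elim: t acc => [a|| {}X X' t IHt t' IHt'] acc /=.
- rewrite !tensm_id; have [g wg Eg] := nrm_sw_leaf a u acc.
  by exists g => //; rewrite !comp_idr.
- exists (idm _); first exact: word_id.
  by rewrite comp_idl -compA swap_unitl -lunit_natural.
have [g wg Eg] := IHt (flat t' acc); have [g' wg' Eg'] := IHt' acc.
have [h wh Eh] := nrm_word t wg'.
exists (g ∘ h); first exact: word_comp.
rewrite !tensm_idcomp -!compA swap_hexagonl !compA.
rewrite -(compA _ _ (sw X Y _)) -swap_natural !compA Eg -!compA.
rewrite [h ∘ _]compA -Eh -!compA; do 2! congr (_ ∘ _).
rewrite -tensm_id assoc_natural !compA; congr (_ ∘ _).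
by rewrite -!tensm_idcomp Eg'.
Qed.

Lemma coh_sw X Y Z (t : bracketing X) (u : bracketing Y) (v : bracketing Z) :
  coherent (Node t (Node u v)) (Node u (Node t v)) (sw X Y Z).
Proof.
move=> acc; have [g wg Eg] := nrm_sw t u (flat v acc); exists g => //=.
rewrite !tensm_idcomp -!compA.
have sw_assoc : assoc Y (X ⊗ Z) (ltens acc) ∘ (sw X Y Z ⊗' idm _) =
    (idm _ ⊗' assocV _ _ _) ∘ sw X Y (Z ⊗ ltens acc) ∘ (idm X ⊗' assoc _ _ _)
      ∘ assoc _ _ _.
  rewrite swE !tensm_compid !compA.
  have -> : assoc Y (X ⊗ Z) (ltens acc) ∘ (assoc Y X Z ⊗' idm _) =
    (idm Y ⊗' assocV X Z _) ∘ assoc Y X _ ∘ assoc (Y ⊗ X) Z _.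
    rewrite -[RHS]compA pentagon !compA (esym (tensm_idcomp _ _ _)) assocK tensm_id.
    by rewrite comp_idl.
  rewrite -[_ ∘ ((_ ⊗' _) ⊗' _)]compA assoc_natural tensm_id !compA.
  rewrite [in RHS]swE !compA; do 2! rewrite -[RHS]compA; rewrite -[LHS]compA.
  congr (_ ∘ _); apply: (iso_mono (iso_assoc _ _ _)).
  rewrite !compA assocVK comp_idl pentagon -!compA -tensm_compid assocVK tensm_id.
  by rewrite comp_idr.
rewrite sw_assoc !compA -(compA _ _ (idm Y ⊗' assocV _ _ _)) -tensm_idcomp.
rewrite assocVK tensm_id comp_idr -(compA _ _ (sw _ _ _)).
rewrite -swap_natural !compA Eg -!compA.
by do 2! congr (_ ∘ _).
Qed.

Lemma coh_braiding X Y (t : bracketing X) (u : bracketing Y) :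
  coherent (Node t u) (Node u t) (braiding X Y).
Proof.
move=> acc; have [g wg Eg] := nrm_sw t u acc; exists g => //=.
rewrite !compA -Eg -!compA; do 2! congr (_ ∘ _).
by rewrite swE -!compA assocK comp_idr.
Qed.

Fixpoint bnode n : forall Y : 'I_n -> C, (forall i, bracketing (Y i)) -> bracketing (btens Y) :=
  match n return forall Y : 'I_n -> C, (forall i, bracketing (Y i)) -> bracketing (btens Y) with
  | 0 => fun _ _ => Unit
  | m.+1 => fun Y T => Node (T ord0) (bnode (fun i => T (lift ord0 i)))
  end.

Lemma coh_btensm n (Y Z : 'I_n -> C) (T : forall i, bracketing (Y i))
    (U : forall i, bracketing (Z i)) (f : forall i, mor (Y i) (Z i)) :
  (forall i, coherent (T i) (U i) (f i)) ->
  coherent (bnode T) (bnode U) (btensm f).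
Proof.
elim: n Y Z T U f => [|n IH] Y Z T U f Tf /=; first exact: coh_id.
by apply: coh_tensm => //; apply: IH.
Qed.

End Words.

Arguments Leaf {k C L env} a.
Arguments Unit {k C L env}.
#[global] Hint Resolve coh_id coh_assoc coh_assocV coh_lunit coh_runit coh_sw
  coh_braiding coh_tensm : coherent_db.

Lemma funext_ord n T (f g : 'I_n.+1 -> T) :
  f ord0 = g ord0 -> (forall j, f (lift ord0 j) = g (lift ord0 j)) -> f = g.
Proof. by move=> E0 E; apply: funext => j; case: (unliftP ord0 j) => [j' ->|->]. Qed.

(** * The braid action as a structural morphism *)

Section Braid.
Variables (k : fieldType) (C : sym_monoidal_category k).
Variables (L : eqType) (env : L -> C) (X : C).
Implicit Types n : nat.
Local Notation bracketing := (bracketing env).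

Definition xnode n (T : 'I_n -> bracketing X) : bracketing (tpow X n) :=
  bnode (Y := fun=> X) T.

Lemma xnodeS n (T : 'I_n.+1 -> bracketing X) :
  xnode T = Node (T ord0) (xnode (fun i => T (lift ord0 i))).
Proof. by []. Qed.

(** [T] labels the target. The source labelling [T'] has the label of position [i] in front and the
    others in order. *)
Lemma coh_move_front n (i : 'I_n.+1) (T T' : 'I_n.+1 -> bracketing X) :
  T' ord0 = T i -> (forall j, T' (lift ord0 j) = T (lift i j)) ->
  coherent (xnode T') (xnode T) (move_front X n i).
Proof.
elim: n i T T' => [|n IH] i T T' E0 E.
  have -> : T' = T by apply: funext_ord => [|[]//]; rewrite E0 ord1.
  by rewrite ord1; apply: coh_id.
case: (unliftP ord0 i) E0 E => [j|] -> E0 E; last first.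
  have -> : T' = T by apply: funext_ord.
  exact: coh_id.
rewrite lift0 [move_front _ _ _]/= sw_front.
(* [U] is [T'] without its second entry: the labels that remain once [swap_front] has brought that
   entry to the front. *)
pose U x := if unlift ord0 x is Some y then T' (lift ord0 (lift ord0 y)) else T' ord0.
have U0 : U ord0 = T' ord0 by rewrite /U unlift_none.
have US y : U (lift ord0 y) = T' (lift ord0 (lift ord0 y)) by rewrite /U liftK.
apply: (@coh_comp _ _ _ _ _ _ _ _ (Node (T ord0) (xnode U))).
  change (coherent (Node (T ord0) (xnode U))
    (Node (T ord0) (xnode (fun i => T (lift ord0 i)))) (idm X ⊗' move_front X n j)).
  apply: coh_tensm; first exact: coh_id.
  apply: IH => [|x]; first by rewrite U0.
  by rewrite US E; congr T; apply: val_inj; rewrite /= !bumpS.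
have -> : T ord0 = T' (lift ord0 ord0) by rewrite E; congr T; apply: val_inj.
have E1 : (fun y => U (lift ord0 y)) = (fun y => T' (lift ord0 (lift ord0 y))).
  exact: funext.
have -> : xnode U = Node (T' ord0) (xnode (fun y => T' (lift ord0 (lift ord0 y)))).
  by rewrite xnodeS U0 E1.
exact: coh_sw.
Qed.

(** Position [j] is sent to position [s j], so it must carry the label [T (s j)]. *)
Lemma coh_braid n (s : 'I_n -> 'I_n) (T : 'I_n -> bracketing X) :
  injective s -> coherent (xnode (T \o s)) (xnode T) (braid X s).
Proof.
elim: n s T => [|n IH] s T inj_s; first exact: coh_id.
rewrite [braid _ _]/=; set u := fun j => _.
have uE j : lift (s ord0) (u j) = s (lift ord0 j).
  rewrite /u; case: unliftP => [y ->//|/inj_s/eqP].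
  by rewrite eq_sym (negPf (neq_lift _ _)).
pose U x := if unlift ord0 x is Some y then T (lift (s ord0) y) else T (s ord0).
have U0 : U ord0 = T (s ord0) by rewrite /U unlift_none.
have US y : U (lift ord0 y) = T (lift (s ord0) y) by rewrite /U liftK.
apply: (@coh_comp _ _ _ _ _ _ _ _ (xnode U)).
  exact: coh_move_front.
have -> : xnode (T \o s) = Node (U ord0) (xnode ((fun y => U (lift ord0 y)) \o u)).
  rewrite xnodeS U0; congr (Node _ (xnode _)); apply: funext => y /=.
  by rewrite US uE.
apply: coh_tensm; first exact: coh_id.
apply: IH => i j /(congr1 (lift (s ord0))); rewrite !uE => /inj_s.
exact: lift_inj.
Qed.

End Braid.

Ltac solve_coherent := repeat first
  [ eapply coh_id | eapply coh_assoc | eapply coh_assocV | eapply coh_sw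
  | eapply coh_braiding | eapply coh_lunit | eapply coh_runit
  | eassumption | eapply coh_tensm | eapply coh_comp ].

(** * Tensor powers *)

Section Labels.
Variables (k : fieldType) (C : sym_monoidal_category k).
Variables (L : eqType) (env : L -> C).
Local Notation bracketing := (bracketing env).

Definition labels X (t : bracketing X) : seq L := flat t [::].

Lemma flat_labels X (t : bracketing X) acc : flat t acc = labels t ++ acc.
Proof.
rewrite /labels; elim: t acc => [a|| {}X Y t IHt u IHu] acc //=.
by rewrite IHt IHu [in RHS]IHt catA.
Qed.

Lemma labels_node X Y (t : bracketing X) (u : bracketing Y) :
  labels (Node t u) = labels t ++ labels u.
Proof. by rewrite /labels /= flat_labels. Qed.

Lemma mem_labels_bnode n (Y : 'I_n -> C) (T : forall i, bracketing (Y i)) a :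
  a \in labels (bnode T) -> exists i, a \in labels (T i).
Proof.
elim: n Y T => [|n IH] Y T //=.
rewrite labels_node mem_cat => /orP[aT|/IH[i aT]]; first by exists ord0.
by exists (lift ord0 i).
Qed.

Lemma uniq_labels_node X Y (t : bracketing X) (u : bracketing Y) :
  uniq (labels t) -> uniq (labels u) ->
  (forall a, a \in labels t -> a \in labels u -> False) ->
  uniq (labels (Node t u)).
Proof.
move=> ut uu tu; rewrite labels_node cat_uniq ut uu andbT.
by apply/hasPn => a au; apply/negP => /tu; apply.
Qed.

Lemma uniq_labels_bnode n (Y : 'I_n -> C) (T : forall i, bracketing (Y i)) :
  (forall i, uniq (labels (T i))) ->
  (forall i j a, a \in labels (T i) -> a \in labels (T j) -> i = j) ->
  uniq (labels (bnode T)).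
Proof.
elim: n Y T => [|n IH] Y T //= uT dT.
apply: uniq_labels_node => // [|a aT /mem_labels_bnode[i /(dT _ _ _ aT)] //].
apply: IH => // i j a ai aj.
exact: (lift_inj (dT _ _ _ ai aj)).
Qed.

Lemma uniq_labels_xnode X n (T : 'I_n -> bracketing X) :
  (forall i, uniq (labels (T i))) ->
  (forall i j a, a \in labels (T i) -> a \in labels (T j) -> i = j) ->
  uniq (labels (xnode T)).
Proof. exact: uniq_labels_bnode. Qed.

Lemma mem_labels_xnode X n (T : 'I_n -> bracketing X) a :
  a \in labels (xnode T) -> exists i, a \in labels (T i).
Proof. exact: mem_labels_bnode. Qed.

End Labels.

Section TensorPowers.
Variables (k : fieldType) (C : sym_monoidal_category k).
Implicit Types (X Y Z W : C) (n : nat).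

Lemma btensm_comp n (X Y Z : 'I_n -> C) (g : forall i, mor (Y i) (Z i))
    (f : forall i, mor (X i) (Y i)) :
  btensm (fun i => g i ∘ f i) = btensm g ∘ btensm f.
Proof.
elim: n X Y Z g f => [|n IH] X Y Z g f /=; first by rewrite comp_idl.
by rewrite (IH _ _ _ (fun i => g (lift ord0 i)) (fun i => f (lift ord0 i))) tensm_comp.
Qed.

Lemma btensm_id n (X : 'I_n -> C) : btensm (fun i => idm (X i)) = idm _.
Proof. by elim: n X => [|n IH] X //=; rewrite IH tensm_id. Qed.

Lemma eq_btensm n (X Y : 'I_n -> C) (f g : forall i, mor (X i) (Y i)) :
  (forall i, f i = g i) -> btensm f = btensm g.
Proof. by elim: n X Y f g => [|n IH] X Y f g E //=; rewrite E (IH _ _ _ _ (fun i => E _)). Qed.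

Lemma btensm_eq0 n (X Y : 'I_n -> C) (f : forall i, mor (X i) (Y i)) i :
  f i = 0 -> btensm f = 0.
Proof.
elim: n X Y f i => [|n IH] X Y f i fi; first by case: i fi.
case: (unliftP ord0 i) fi => [j|] -> fi /=; last by rewrite fi tensm0l.
by rewrite (IH _ _ _ j fi) tensm0r.
Qed.

Lemma btensm_epi n (X Y : 'I_n -> C) (f : forall i, mor (X i) (Y i))
    (s : forall i, mor (Y i) (X i)) :
  (forall i, f i ∘ s i = idm _) -> btensm f ∘ btensm s = idm _.
Proof. by move=> fs; rewrite -btensm_comp (eq_btensm fs) btensm_id. Qed.

Lemma tpowm_comp X Y Z n (g : mor Y Z) (f : mor X Y) :
  tpowm n (g ∘ f) = tpowm n g ∘ tpowm n f.
Proof. exact: btensm_comp. Qed.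

Lemma tpowm_id X n : tpowm n (idm X) = idm _.
Proof. exact: btensm_id. Qed.

Definition mid4 X Y Z W : mor ((X ⊗ Y) ⊗ (Z ⊗ W)) ((X ⊗ Z) ⊗ (Y ⊗ W)) :=
  locked_with sw_key
    (assocV X Z (Y ⊗ W) ∘ (idm X ⊗' sw Y Z W) ∘ assoc X Y (Z ⊗ W)).

Lemma mid4E X Y Z W : mid4 X Y Z W =
  assocV X Z (Y ⊗ W) ∘ (idm X ⊗' sw Y Z W) ∘ assoc X Y (Z ⊗ W).
Proof. by rewrite /mid4 unlock. Qed.

Lemma mid4_natural X X' Y Y' Z Z' W W' (f : mor X X') (g : mor Y Y')
    (h : mor Z Z') (l : mor W W') :
  mid4 X' Y' Z' W' ∘ ((f ⊗' g) ⊗' (h ⊗' l)) =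
  ((f ⊗' h) ⊗' (g ⊗' l)) ∘ mid4 X Y Z W.
Proof.
rewrite !mid4E -compA assoc_natural !compA.
rewrite -[_ ∘ (f ⊗' _)]compA -tensm_comp swap_natural comp_idl -[f]comp_idr.
by rewrite tensm_comp !compA assocV_natural comp_idr.
Qed.

Lemma mid4K X Y Z W : mid4 X Z Y W ∘ mid4 X Y Z W = idm _.
Proof.
rewrite !mid4E !compA (compE _ (assocVK _ _ _)) comp_idr.
by rewrite (compE _ (esym (tensm_idcomp _ _ _))) swapK tensm_id comp_idr assocK.
Qed.

Lemma coh_mid4 (L : eqType) (env : L -> C) X Y Z W (x : bracketing env X) (y : bracketing env Y)
    (z : bracketing env Z) (w : bracketing env W) :
  coherent (Node (Node x y) (Node z w)) (Node (Node x z) (Node y w)) (mid4 X Y Z W).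
Proof. by rewrite mid4E; solve_coherent. Qed.

Fixpoint bzip n : forall X Y : 'I_n -> C,
    mor (btens X ⊗ btens Y) (btens (fun i => X i ⊗ Y i)) :=
  match n return forall X Y : 'I_n -> C,
    mor (btens X ⊗ btens Y) (btens (fun i => X i ⊗ Y i)) with
  | 0 => fun _ _ => lunit tunit
  | m.+1 => fun (X Y : 'I_m.+1 -> C) => (idm _ ⊗' bzip _ _) ∘ mid4 _ _ _ _
  end.

Lemma bzip_natural n (X X' Y Y' : 'I_n -> C) (f : forall i, mor (X i) (X' i))
    (g : forall i, mor (Y i) (Y' i)) :
  bzip X' Y' ∘ (btensm f ⊗' btensm g) = btensm (fun i => f i ⊗' g i) ∘ bzip X Y.
Proof.
elim: n X X' Y Y' f g => [|n IH] X X' Y Y' f g /=.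
  by rewrite tensm_id comp_idr comp_idl.
by rewrite -compA mid4_natural !compA -!tensm_comp IH comp_idl comp_idr.
Qed.

Lemma bzip_iso n (X Y : 'I_n -> C) : is_iso (bzip X Y).
Proof.
elim: n X Y => [|n IH] X Y /=; first exact: lunit_iso.
apply: iso_comp; first by apply: iso_tensm => //; apply: iso_id.
by exists (mid4 _ _ _ _); rewrite !mid4K.
Qed.

Lemma coh_bzip (L : eqType) (env : L -> C) n (X Y : 'I_n -> C)
    (T : forall i, bracketing env (X i)) (U : forall i, bracketing env (Y i)) :
  coherent (Node (bnode T) (bnode U)) (bnode (fun i => Node (T i) (U i))) (bzip X Y).
Proof.
elim: n X Y T U => [|n IH] X Y T U /=; first exact: coh_lunit.
by apply: coh_comp; [apply: coh_tensm; [apply: coh_id|apply: IH]|apply: coh_mid4].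
Qed.

(** Nothing is computed: with each factor labelled by its final position, both sides are coherent
    between the same bracketings with distinct labels. *)
Lemma braid_comp X n (s t : 'I_n -> 'I_n) : injective s -> injective t ->
  braid X (t \o s) = braid X t ∘ braid X s.
Proof.
move=> is_ it; pose T (i : 'I_n) : bracketing (fun _ : 'I_n => X) X := Leaf i.
apply: (@coherent_uniq _ _ _ _ _ _ (xnode (T \o (t \o s))) (xnode T)).
- apply: uniq_labels_xnode => // i j a; rewrite !inE => /eqP -> /eqP.
  by move/it/is_.
- by apply: coh_braid; apply: inj_comp.
- apply: coh_comp; first exact: coh_braid.
  exact: (coh_braid (T \o t)).
Qed.

Lemma braid_id X n : braid X (id : 'I_n -> 'I_n) = idm _.
Proof.
pose T (i : 'I_n) : bracketing (fun _ : 'I_n => X) X := Leaf i.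
apply: (@coherent_uniq _ _ _ _ _ _ (xnode T) (xnode T)).
- by apply: uniq_labels_xnode => // i j a; rewrite !inE => /eqP -> /eqP.
- exact: (coh_braid T (s := id)).
- exact: coh_id.
Qed.

Lemma braidM X n (s t : 'S_n) : braid X (s * t)%g = braid X t ∘ braid X s.
Proof.
rewrite -braid_comp; try exact: perm_inj.
by congr braid; apply: funext => i /=; rewrite permM.
Qed.

Lemma braid1 X n : braid X (1%g : 'S_n) = idm _.
Proof. by rewrite -braid_id; congr braid; apply: funext => i; rewrite perm1. Qed.

Lemma braidKV X n (s : 'S_n) : braid X s ∘ braid X (s^-1)%g = idm _.
Proof. by rewrite -braidM mulVg braid1. Qed.
Lemma braidK X n (s : 'S_n) : braid X (s^-1)%g ∘ braid X s = idm _.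
Proof. by rewrite -braidM mulgV braid1. Qed.

Lemma move_front_natural X Y n (i : 'I_n.+1) (f f' : 'I_n.+1 -> mor X Y) :
  f' ord0 = f i -> (forall j, f' (lift ord0 j) = f (lift i j)) ->
  move_front Y n i ∘ btensm f' = btensm f ∘ move_front X n i.
Proof.
elim: n i f f' => [|n IH] i f f' E0 E.
  have -> : f' = f by apply: funext_ord => [|[]//]; rewrite E0 ord1.
  by rewrite /= comp_idl comp_idr.
case: (unliftP ord0 i) E0 E => [j|] -> E0 E; last first.
  have -> : f' = f by apply: funext_ord.
  by rewrite /= comp_idl comp_idr.
rewrite lift0 /= !sw_front -compA swap_natural !compA -!tensm_comp.
rewrite comp_idl comp_idr E; congr (_ ⊗' _ ∘ _); first by congr f; apply: val_inj.
pose U x := if unlift ord0 x is Some y then f' (lift ord0 (lift ord0 y)) else f' ord0.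
have U0 : U ord0 = f' ord0 by rewrite /U unlift_none.
have US y : U (lift ord0 y) = f' (lift ord0 (lift ord0 y)) by rewrite /U liftK.
have <- := IH j (fun x => f (lift ord0 x)) U.
- rewrite /= U0; congr (_ ∘ (_ ⊗' _)).
  exact: eq_btensm.
- by rewrite U0.
- by move=> x; rewrite US E; congr f; apply: val_inj; rewrite /= !bumpS.
Qed.

(** The morphism at slot [i] before the braiding is the one at slot [s i] after it. Varying families
    are needed to permute mixed words. *)
Lemma braid_natural_family X Y n (s : 'I_n -> 'I_n) (f : 'I_n -> mor X Y) :
  injective s ->
  braid Y s ∘ btensm (fun i => f (s i)) = btensm f ∘ braid X s.
Proof.
elim: n s f => [|n IH] s f inj_s; first by rewrite /= comp_idl.
pose u j := odflt j (unlift (s ord0) (s (lift ord0 j))).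
have bE Z : braid Z s = move_front Z n (s ord0) ∘ (idm Z ⊗' braid Z u) by [].
have uE j : lift (s ord0) (u j) = s (lift ord0 j).
  rewrite /u; case: unliftP => [y ->//|/inj_s/eqP].
  by rewrite eq_sym (negPf (neq_lift _ _)).
have iu : injective u.
  by move=> i j /(congr1 (lift (s ord0))); rewrite !uE => /inj_s; apply: lift_inj.
pose U x := if unlift ord0 x is Some y then f (lift (s ord0) y) else f (s ord0).
have U0 : U ord0 = f (s ord0) by rewrite /U unlift_none.
have US y : U (lift ord0 y) = f (lift (s ord0) y) by rewrite /U liftK.
rewrite !bE compA -(@move_front_natural _ _ _ _ f U) //= -!compA; congr (_ ∘ _).
rewrite -!tensm_comp comp_idl comp_idr U0; congr (_ ⊗' _).
rewrite -IH //; congr (_ ∘ _); apply: eq_btensm => j.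
by rewrite US uE.
Qed.

Lemma braid_tpowm X Y n (s : 'S_n) (f : mor X Y) :
  braid Y s ∘ tpowm n f = tpowm n f ∘ braid X s.
Proof. exact: (braid_natural_family (fun=> f) (@perm_inj _ s)). Qed.

Definition tzip X Y n : mor (tpow X n ⊗ tpow Y n) (tpow (X ⊗ Y) n) :=
  locked_with sw_key (bzip (fun=> X) (fun=> Y)).

Lemma tzipE X Y n : tzip X Y n = bzip (fun=> X) (fun=> Y).
Proof. by rewrite /tzip unlock. Qed.

Lemma tzip_iso X Y n : is_iso (tzip X Y n).
Proof. by rewrite tzipE; apply: bzip_iso. Qed.

Lemma tzip_natural X X' Y Y' n (f : mor X X') (g : mor Y Y') :
  tzip X' Y' n ∘ (tpowm n f ⊗' tpowm n g) = tpowm n (f ⊗' g) ∘ tzip X Y n.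
Proof. by rewrite !tzipE; apply: bzip_natural. Qed.

Lemma tzip_braid X Y n (s : 'S_n) :
  tzip X Y n ∘ (braid X s ⊗' braid Y s) = braid (X ⊗ Y) s ∘ tzip X Y n.
Proof.
pose env (a : 'I_n + 'I_n) := if a is inl _ then X else Y.
pose T (i : 'I_n) : bracketing env X := Leaf (inl i : 'I_n + 'I_n).
pose U (i : 'I_n) : bracketing env Y := Leaf (inr i : 'I_n + 'I_n).
apply: (@coherent_uniq _ _ _ _ _ _ (Node (xnode (T \o s)) (xnode (U \o s)))
  (xnode (fun i => Node (T i) (U i)))).
- apply: uniq_labels_node.
  + by apply: uniq_labels_xnode => // i j a; rewrite !inE => /eqP -> /eqP[/perm_inj].
  + by apply: uniq_labels_xnode => // i j a; rewrite !inE => /eqP -> /eqP[/perm_inj].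
  + by move=> a /mem_labels_xnode[i] /[swap] /mem_labels_xnode[j]; rewrite !inE => /eqP -> /eqP.
- rewrite tzipE; apply: coh_comp; first exact: coh_bzip.
  by apply: coh_tensm; apply: coh_braid; apply: perm_inj.
- apply: coh_comp; first exact/coh_braid/perm_inj.
  by rewrite tzipE; apply: coh_bzip.
Qed.

Lemma coh_one_tpow (L : eqType) (env : L -> C) n :
  coherent (xnode (fun _ : 'I_n => Unit : bracketing env tunit)) Unit (one_tpow C n).
Proof.
elim: n => [|n IH] /=; first exact: coh_id.
by apply: coh_comp; [apply: IH|apply: coh_lunit].
Qed.

Lemma one_tpow_iso n : is_iso (one_tpow C n).
Proof.
elim: n => [|n IH] /=; first exact: iso_id.
by apply: iso_comp => //; apply: lunit_iso.
Qed.

(** Bracketings of units carry no labels at all, so distinctness is automatic. *)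
Lemma one_tpow_braid n (s : 'S_n) : one_tpow C n ∘ braid tunit s = one_tpow C n.
Proof.
pose T (i : 'I_n) : bracketing (fun _ : unit => tunit : C) tunit := Unit.
apply: (@coherent_uniq _ _ _ _ _ _ (xnode T) Unit).
- by apply: uniq_labels_xnode.
- apply: coh_comp; first exact: coh_one_tpow.
  exact: (coh_braid T (@perm_inj _ s)).
- exact: coh_one_tpow.
Qed.

Lemma braid_tunit n (s : 'S_n) : braid (tunit : C) s = idm _.
Proof. by apply: (iso_mono (one_tpow_iso n)); rewrite one_tpow_braid comp_idr. Qed.

Fixpoint tcat X m n : mor (tpow X m ⊗ tpow X n) (tpow X (m + n)) :=
  match m return mor (tpow X m ⊗ tpow X n) (tpow X (m + n)) with
  | 0 => lunit _
  | m'.+1 => (idm X ⊗' tcat X m' n) ∘ assoc _ _ _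
  end.

Definition catfun T m n (f : 'I_m -> T) (g : 'I_n -> T) (i : 'I_(m + n)) : T :=
  match split i with inl j => f j | inr j => g j end.

Lemma tcat_iso X m n : is_iso (tcat X m n).
Proof.
elim: m => [|m IH] /=; first exact: lunit_iso.
by apply: iso_comp; [apply: iso_tensm => //; apply: iso_id|apply: iso_assoc].
Qed.

Lemma catfun_lshift T m n (f : 'I_m -> T) (g : 'I_n -> T) i :
  catfun f g (lshift n i) = f i.
Proof. by rewrite /catfun (unsplitK (inl i)). Qed.
Lemma catfun_rshift T m n (f : 'I_m -> T) (g : 'I_n -> T) i :
  catfun f g (rshift m i) = g i.
Proof. by rewrite /catfun (unsplitK (inr i)). Qed.

Lemma catfun0 T n (f : 'I_0 -> T) (g : 'I_n -> T) : catfun f g = g.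
Proof.
apply: funext => i; rewrite -[RHS](catfun_rshift f g).
by congr catfun; apply: val_inj.
Qed.

Lemma catfun_first T m n (f : 'I_m.+1 -> T) (g : 'I_n -> T) :
  catfun f g (ord0 : 'I_(m + n).+1) = f ord0.
Proof. by rewrite -(catfun_lshift f g ord0); congr catfun; apply: val_inj. Qed.

Lemma catfun_lift T m n (f : 'I_m.+1 -> T) (g : 'I_n -> T) i :
  catfun f g (lift (ord0 : 'I_(m + n).+1) i) = catfun (fun j => f (lift ord0 j)) g i.
Proof.
case: (split_ordP i) => j ->; rewrite ?catfun_lshift ?catfun_rshift.
  by rewrite -(catfun_lshift f g); congr catfun; apply: val_inj.
by rewrite -(catfun_rshift f g); congr catfun; apply: val_inj.
Qed.

Lemma coh_tcat (L : eqType) (env : L -> C) X m n (T : 'I_m -> bracketing env X) (U : 'I_n -> bracketing env X) :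
  coherent (Node (xnode T) (xnode U)) (xnode (catfun T U)) (tcat X m n).
Proof.
elim: m T => [|m IH] T /=; first by rewrite catfun0; apply: coh_lunit.
have -> : xnode (catfun T U) =
    Node (T ord0) (xnode (catfun (fun i => T (lift ord0 i)) U)).
  rewrite -(catfun_first T U); congr (Node _ (bnode _)).
  by apply: functional_extensionality_dep => i; rewrite catfun_lift.
by apply: coh_comp; [apply: coh_tensm; [apply: coh_id|apply: IH]|apply: coh_assoc].
Qed.

Lemma tcat_braid X m n (s : 'S_m) (t : 'S_n) :
  tcat X m n ∘ (braid X s ⊗' braid X t) = braid X (young_perm s t) ∘ tcat X m n.
Proof.
pose T (i : 'I_m) : bracketing (fun _ : 'I_(m + n) => X) X := Leaf (lshift n i).
pose U (i : 'I_n) : bracketing (fun _ : 'I_(m + n) => X) X := Leaf (rshift m i).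
apply: (@coherent_uniq _ _ _ _ _ _ (Node (xnode (T \o s)) (xnode (U \o t)))
  (xnode (catfun T U))).
- apply: uniq_labels_node.
  + by apply: uniq_labels_xnode => // i j a; rewrite !inE => /eqP -> /eqP/lshift_inj/perm_inj.
  + by apply: uniq_labels_xnode => // i j a; rewrite !inE => /eqP -> /eqP/rshift_inj/perm_inj.
  + move=> a /mem_labels_xnode[i] /[swap] /mem_labels_xnode[j]; rewrite !inE => /eqP -> /eqP/esym/eqP.
    by rewrite eq_lrshift.
- apply: coh_comp; first exact: coh_tcat.
  by apply: coh_tensm; apply: coh_braid; apply: perm_inj.
- apply: coh_comp; first exact/coh_braid/perm_inj.
  have -> : catfun T U \o young_perm s t = catfun (T \o s) (U \o t).
    apply: funext => i /=; rewrite permE /young_fun.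
    by case: (split_ordP i) => j ->; rewrite ?catfun_lshift ?catfun_rshift
      ?(unsplitK (inl _)) ?(unsplitK (inr _)) ?catfun_lshift ?catfun_rshift.
  exact: coh_tcat.
Qed.

Lemma tcat_btensm X Y m n (f : 'I_m -> mor X Y) (g : 'I_n -> mor X Y) :
  tcat Y m n ∘ (btensm f ⊗' btensm g) = btensm (catfun f g) ∘ tcat X m n.
Proof.
elim: m f => [|m IH] f /=; first by rewrite catfun0 lunit_natural.
rewrite -compA assoc_natural !compA -!tensm_comp comp_idl IH; congr (_ ∘ _).
rewrite catfun_first comp_idr; congr (_ ⊗' (_ ∘ _)).
by apply: eq_btensm => i; rewrite catfun_lift.
Qed.

End TensorPowers.

(** * Flattening iterated tensor powers *)

Section Flatten.
Variables (k : fieldType) (C : sym_monoidal_category k).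
Implicit Types (X Y : C) (m n p : nat).

Fixpoint tflat X m p : mor (tpow (tpow X p) m) (tpow X (m * p)) :=
  match m return mor (tpow (tpow X p) m) (tpow X (m * p)) with
  | 0 => idm _
  | m'.+1 => tcat X p (m' * p) ∘ (idm _ ⊗' tflat X m' p)
  end.

(** The recursion mirrors [tflat], so that a position becomes a pair (block, place) without division
    with remainder. *)
Fixpoint unflat m p : 'I_(m * p) -> 'I_m * 'I_p :=
  match m return 'I_(m * p) -> 'I_m * 'I_p with
  | 0 => fun i => match notF (ltn_ord i) with end
  | m'.+1 => catfun (fun j => (ord0, j))
      (fun r : 'I_(m' * p) => (lift ord0 (unflat r).1, (unflat r).2))
  end.

Lemma unflat_inj m p : injective (@unflat m p).
Proof.
elim: m => [|m IH] i j; first by case: i.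
rewrite /=; case: (split_ordP (i : 'I_(p + m * p))) => i' ->;
  case: (split_ordP (j : 'I_(p + m * p))) => j' ->;
  rewrite ?catfun_lshift ?catfun_rshift; last first.
- move=> E; congr rshift; apply: IH; move: E.
  by case: (unflat i') => a b; case: (unflat j') => a' b' [E ->]; congr pair; apply: val_inj.
- by move=> /(congr1 (fun x => val x.1)).
- by move=> /(congr1 (fun x => val x.1)).
- by move=> /(congr1 snd) /= ->.
Qed.

Lemma unflat_bij m p : bijective (@unflat m p).
Proof. by apply: (inj_card_bij (@unflat_inj m p)); rewrite card_prod !card_ord. Qed.

Lemma coh_tflat (L : eqType) (env : L -> C) X m p (T : 'I_m -> 'I_p -> bracketing env X) :
  coherent (xnode (fun i => xnode (T i)))
    (xnode (fun x => T (unflat x).1 (unflat x).2)) (tflat X m p).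
Proof.
elim: m T => [|m IH] T /=; first exact: coh_id.
apply: coh_comp; last by apply: coh_tensm; [apply: coh_id|apply: IH].
have -> : (fun x => T (unflat x).1 (unflat x).2) =
   catfun (T ord0) (fun x : 'I_(m * p) => T (lift ord0 (unflat x).1) (unflat x).2).
  apply: funext => x /=; case: (split_ordP (x : 'I_(p + m * p))) => j ->.
    by rewrite !catfun_lshift.
  by rewrite !catfun_rshift.
exact: coh_tcat.
Qed.

Lemma tflat_tpowm X Y m p (f : mor X Y) :
  tflat Y m p ∘ tpowm m (tpowm p f) = tpowm (m * p) f ∘ tflat X m p.
Proof.
elim: m => [|m IH] //.
change (tcat Y p (m * p) ∘ (idm _ ⊗' tflat Y m p) ∘ (tpowm p f ⊗' tpowm m (tpowm p f))
  = tpowm (p + m * p) f ∘ (tcat X p (m * p) ∘ (idm _ ⊗' tflat X m p))).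
rewrite -compA -tensm_comp comp_idl IH compA.
have -> : tpowm (p + m * p) f = btensm (catfun (fun=> f) (fun _ : 'I_(m * p) => f)).
  by apply: eq_btensm => i; rewrite /catfun; case: split.
by rewrite -tcat_btensm -compA -tensm_comp comp_idr.
Qed.

Lemma tflat_one m p :
  one_tpow C (m * p) ∘ tflat tunit m p = one_tpow C m ∘ tpowm m (one_tpow C p).
Proof.
pose U : bracketing (fun _ : unit => tunit : C) tunit := Unit.
apply: (@coherent_uniq _ _ _ _ _ _ (xnode (fun _ : 'I_m => xnode (fun _ : 'I_p => U))) Unit).
- by apply: uniq_labels_xnode => [i|i j a /mem_labels_xnode[]//]; apply: uniq_labels_xnode.
- apply: coh_comp; first exact: coh_one_tpow.
  exact: (coh_tflat (fun _ _ => U)).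
- apply: coh_comp; first exact: coh_one_tpow.
  by apply: coh_btensm => i; apply: coh_one_tpow.
Qed.

Lemma braid_tflat X m p (s : 'S_m) (t : 'I_m -> 'S_p) (u : 'S_(m * p)) :
  (forall x, unflat (u x) = (s (unflat x).1, t (unflat x).1 (unflat x).2)) ->
  braid X u ∘ tflat X m p =
  tflat X m p ∘ braid (tpow X p) s ∘ btensm (fun i => braid X (t i)).
Proof.
move=> uE; pose T i j : bracketing (fun _ : 'I_m * 'I_p => X) X := Leaf (i, j).
apply: (@coherent_uniq _ _ _ _ _ _ (xnode (fun i => xnode (fun j => T (s i) (t i j))))
  (xnode (fun x => T (unflat x).1 (unflat x).2))).
- apply: uniq_labels_xnode => [i|i j a /mem_labels_xnode[i']].
    by apply: uniq_labels_xnode => // x y a; rewrite !inE => /eqP -> /eqP[/perm_inj].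
  rewrite inE => /eqP -> /mem_labels_xnode[j']; rewrite inE => /eqP[/perm_inj//].
- apply: coh_comp; first exact/coh_braid/perm_inj.
  have := coh_tflat (fun i j => T (s i) (t i j)).
  congr coherent; congr xnode; apply: funext => x /=.
  by rewrite uE.
- apply: coh_comp; first (apply: coh_comp; first exact: coh_tflat).
    exact: (coh_braid (fun i => xnode (T i)) (@perm_inj _ s)).
  by apply: coh_btensm => i; apply: (coh_braid (T (s i)) (@perm_inj _ (t i))).
Qed.

End Flatten.

(** * Duality *)

Section Duality.
Variables (k : fieldType) (C : sym_monoidal_category k).
Implicit Types (A B D X Y Z : C) (n : nat).

Definition env4 A B X Y (i : nat) : C :=
  match i with 0 => A | 1 => B | 2 => X | _ => Y end.

Definition dual_pair X D (ev : mor (D ⊗ X) tunit) (coev : mor tunit (X ⊗ D)) : Prop :=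
  runit X ∘ (idm X ⊗' ev) ∘ assoc X D X ∘ (coev ⊗' idm X) = lunit X /\
  lunit D ∘ (ev ⊗' idm D) ∘ assocV D X D ∘ (idm D ⊗' coev) = runit D.

Lemma runit_assoc X Y : (idm X ⊗' runit Y) ∘ assoc X Y tunit = runit (X ⊗ Y).
Proof.
apply: (@coherent_uniq _ _ _ (env4 X Y X Y) _ _
  (Node (Node (Leaf 0) (Leaf 1)) Unit) (Node (Leaf 0) (Leaf 1))) => //;
  solve_coherent.
Qed.

(** Each new zigzag becomes an old one after naturality has moved [ev] and [coev]; the remaining
    identity is purely structural. *)
Lemma dual_pair_sym X D ev coev : @dual_pair X D ev coev ->
  @dual_pair D X (ev ∘ braiding X D) (braiding X D ∘ coev).
Proof.
case=> zig zag; split.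
- apply: (iso_epi (iso_braiding D tunit)); rewrite lunit_braiding -[RHS]zag.
  rewrite !tensm_idcomp !tensm_compid -lunit_braiding !compA.
  rewrite (compE _ (esym (braiding_natural _ _))) !compA.
  rewrite (compE _ (braiding_natural (idm D) ev)) !compA; congr (_ ∘ _).
  rewrite -!compA; do 2! congr (_ ∘ _); rewrite !compA.
  apply: (@coherent_uniq _ _ _ (env4 D X D D) _ _
    (Node (Leaf 0) (Node (Leaf 1) (Leaf 2))) (Node (Node (Leaf 0) (Leaf 1)) (Leaf 2))) => //;
    solve_coherent.
- apply: (iso_epi (iso_braiding tunit X)).
  have -> : runit X ∘ braiding tunit X = lunit X.
    by rewrite -lunit_braiding -compA braiding_sym comp_idr.
  rewrite -[RHS]zig !tensm_idcomp !tensm_compid !compA.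
  have -> : lunit X ∘ (ev ⊗' idm X) = runit X ∘ (idm X ⊗' ev) ∘ braiding (D ⊗ X) X.
    by rewrite -lunit_braiding (compE _ (braiding_natural (idm X) ev)) !compA
      (compE _ (braiding_sym _ _)) comp_idr.
  rewrite (compE _ (esym (braiding_natural _ _))) !compA; congr (_ ∘ _).
  rewrite -!compA; do 2! congr (_ ∘ _); rewrite !compA.
  apply: (@coherent_uniq _ _ _ (env4 X D X X) _ _
    (Node (Node (Leaf 0) (Leaf 1)) (Leaf 2)) (Node (Leaf 0) (Node (Leaf 1) (Leaf 2)))) => //;
    solve_coherent.
Qed.

End Duality.

Section Adjunction.
Variables (k : fieldType) (C : sym_monoidal_category k).
Implicit Types (A B D X Y Z W : C) (n : nat).

(** Half of the adjunction between [- ⊗ X] and [- ⊗ D]; that it is bijective and natural gives every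
    exactness property of the tensor product. *)
Definition transpose X D (ev : mor (D ⊗ X) tunit) A B (a : mor A (B ⊗ D)) :
    mor (A ⊗ X) B :=
  locked_with sw_key (runit B ∘ (idm B ⊗' ev) ∘ assoc B D X ∘ (a ⊗' idm X)).

Lemma transposeE X D (ev : mor (D ⊗ X) tunit) A B (a : mor A (B ⊗ D)) :
  transpose ev a = runit B ∘ (idm B ⊗' ev) ∘ assoc B D X ∘ (a ⊗' idm X).
Proof. by rewrite /transpose unlock. Qed.

Lemma transpose_compl X D (ev : mor (D ⊗ X) tunit) A A' B (a : mor A (B ⊗ D))
    (h : mor A' A) :
  transpose ev (a ∘ h) = transpose ev a ∘ (h ⊗' idm X).
Proof. by rewrite !transposeE tensm_compid compA. Qed.

Lemma transpose_compr X D (ev : mor (D ⊗ X) tunit) A B B' (a : mor A (B ⊗ D))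
    (h : mor B B') :
  transpose ev ((h ⊗' idm D) ∘ a) = h ∘ transpose ev a.
Proof.
rewrite !transposeE tensm_compid !compA; congr (_ ∘ _).
rewrite -[LHS]compA assoc_natural tensm_id !compA; congr (_ ∘ _).
by rewrite -runit_natural (compE _ (tensm_lr _ _)) -[LHS]compA -tensm_comp comp_idl comp_idr.
Qed.

Lemma transpose_linear X D (ev : mor (D ⊗ X) tunit) A B c (a b : mor A (B ⊗ D)) :
  transpose ev (c *: a + b) = c *: transpose ev a + transpose ev b.
Proof. by rewrite !transposeE tensmDl tensmZl compDr compZr. Qed.

Section Dual.
Variables (X D : C) (ev : mor (D ⊗ X) tunit) (coev : mor tunit (X ⊗ D)).
Hypothesis dXD : dual_pair ev coev.

Lemma transpose_surj A B (f : mor (A ⊗ X) B) : exists a, transpose ev a = f.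
Proof.
have [r [rK Kr]] := runit_iso A; have [zig _] := dXD.
(* The usual mate of [f], through the unit [coev] of the adjunction. *)
exists ((f ⊗' idm D) ∘ (assocV A X D ∘ (idm A ⊗' coev) ∘ r)).
rewrite transpose_compr -[RHS]comp_idr; congr (_ ∘ _).
rewrite transposeE !tensm_compid !compA.
have E : assoc (A ⊗ X) D X ∘ (assocV A X D ⊗' idm X) =
   assocV A X (D ⊗ X) ∘ (idm A ⊗' assoc X D X) ∘ assoc A (X ⊗ D) X.
  by rewrite -pentagonV -[RHS]compA assocK comp_idr.
rewrite (compE _ E) !compA {E}.
have E : (idm (A ⊗ X) ⊗' ev) ∘ assocV A X (D ⊗ X) =
   assocV A X tunit ∘ (idm A ⊗' (idm X ⊗' ev)).
  by rewrite assocV_natural tensm_id.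
rewrite (compE _ E) (compE _ (assoc_natural _ _ _)) !compA {E}.
rewrite -runit_assoc (compE _ (assocVK _ _ _)) comp_idr.
rewrite -!tensm_idcomp zig triangle -tensm_comp Kr comp_idl.
exact: tensm_id.
Qed.

Lemma transpose_inj A B (a b : mor A (B ⊗ D)) :
  transpose ev a = transpose ev b -> a = b.
Proof.
have [r [rK Kr]] := runit_iso A; have [_ zag] := dXD.
have H (c : mor A (B ⊗ D)) : (transpose ev c ⊗' idm D) ∘ (assocV A X D ∘ (idm A ⊗' coev) ∘ r) = c.
  rewrite transposeE !tensm_compid !compA.
  rewrite (compE _ (esym (assocV_natural _ _ _))) !compA tensm_id.
  rewrite (compE _ (tensm_swap _ _)) !compA.
  have E : (assoc B D X ⊗' idm D) ∘ assocV (B ⊗ D) X D =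
     assocV B (D ⊗ X) D ∘ (idm B ⊗' assocV D X D) ∘ assoc B D (X ⊗ D).
    apply: (iso_mono (iso_assoc _ _ _)); rewrite !compA assocVK comp_idl.
    apply: (iso_epi (iso_assoc _ _ _)); rewrite (compE _ (assocK _ _ _)) comp_idr.
    by rewrite (compE _ (pentagon _ _ _ _)) !compA -tensm_idcomp assocK tensm_id comp_idl.
  rewrite (compE _ E) !compA (compE _ (esym (assocV_natural _ _ _))) !compA {E}.
  have E : (runit B ⊗' idm D) ∘ assocV B tunit D = idm B ⊗' lunit D.
    by rewrite -triangle -compA assocVK comp_idr.
  rewrite E -[in idm (B ⊗ D) ⊗' coev]tensm_id (compE _ (assoc_natural _ _ _)) !compA.
  rewrite -!tensm_idcomp zag runit_assoc runit_natural.
  by rewrite -compA Kr comp_idr.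
by move=> E; rewrite -[a]H E H.
Qed.

(** A left adjoint preserves epimorphisms; the next lemma is the dual fact for the right adjoint. *)
Lemma tens_epi Y Z (e : mor Y Z) : epi e -> epi (e ⊗' idm X).
Proof.
move=> ee; apply: epi0 => W u Eu; have [a Ea] := transpose_surj u.
suff a0 : a = 0 by rewrite -Ea a0 transposeE tensm0l comp0r.
apply: (epi_eq0 ee); apply: transpose_inj.
by rewrite transpose_compl Ea Eu transposeE tensm0l comp0r.
Qed.

Lemma tens_dual_mono Y Z (m : mor Y Z) : mono m -> mono (m ⊗' idm D).
Proof.
move=> mm; apply: mono0 => W a Ea; apply: transpose_inj.
have T0 B : transpose ev (0 : mor W (B ⊗ D)) = 0.
  by rewrite transposeE tensm0l comp0r.
by rewrite T0; apply: (mono_eq0 mm); rewrite -transpose_compr Ea T0.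
Qed.

(** [D'] represents the functor sending [A] to Hom(A ⊗ T, 1). Without a coevaluation in the
    definition, induction over tensor powers stays short. *)
Definition perfect_pairing T D' (e : mor (D' ⊗ T) tunit) : Prop :=
  (forall A (f : mor (A ⊗ T) tunit), exists a, e ∘ (a ⊗' idm T) = f) /\
  (forall A (a b : mor A D'), e ∘ (a ⊗' idm T) = e ∘ (b ⊗' idm T) -> a = b).

Lemma runit_tunit : runit tunit = lunit tunit :> mor ((tunit : C) ⊗ tunit) tunit.
Proof.
pose U : bracketing (fun _ : unit => tunit : C) tunit := Unit.
apply: (@coherent_uniq _ _ _ _ _ _ (Node U U) U) => //; solve_coherent.
Qed.

Lemma transpose_tunit A (a : mor A (tunit ⊗ D)) :
  transpose ev a = ev ∘ ((lunit D ∘ a) ⊗' idm X).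
Proof.
rewrite transposeE runit_tunit lunit_natural tensm_compid -lunit_assoc.
by rewrite !compA.
Qed.

Lemma dual_perfect : perfect_pairing ev.
Proof.
have [l [lK Kl]] := lunit_iso D.
split=> [A f|A a b].
  by have [a <-] := transpose_surj f; exists (lunit D ∘ a); rewrite transpose_tunit.
have aE c : c = lunit D ∘ (l ∘ c) :> mor A D by rewrite compA Kl comp_idl.
rewrite (aE a) (aE b) -!transpose_tunit => /transpose_inj E.
by rewrite E.
Qed.

Definition tpow_pairing n : mor (tpow D n ⊗ tpow X n) tunit :=
  one_tpow C n ∘ tpowm n ev ∘ tzip D X n.

Lemma tpow_pairing_braid n (s : 'S_n) :
  tpow_pairing n ∘ (braid D s ⊗' braid X s) = tpow_pairing n.
Proof.
rewrite /tpow_pairing -compA tzip_braid !compA; congr (_ ∘ _).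
by rewrite -compA -braid_tpowm compA one_tpow_braid.
Qed.

Lemma tpow_pairing_perfect n : perfect_pairing (tpow_pairing n).
Proof.
elim: n => [|n [IHs IHi]].
  have -> : tpow_pairing 0 = lunit tunit.
    by rewrite /tpow_pairing tzipE /= !comp_idl.
  have E A (a : mor A tunit) : lunit tunit ∘ (a ⊗' idm tunit) = a ∘ runit A.
    by rewrite -runit_tunit runit_natural.
  split=> [A f|A a b].
    have [r [rK Kr]] := runit_iso A.
    by exists (f ∘ r); rewrite E -compA rK comp_idr.
  by rewrite !E => /(iso_epi (runit_iso A)).
have EE : tpow_pairing n.+1 =
   lunit tunit ∘ (ev ⊗' tpow_pairing n) ∘ mid4 D (tpow D n) X (tpow X n).
  rewrite /tpow_pairing !tzipE /=.
  have E (o : mor (tpow (tunit : C) n) tunit) W (t : mor W (tpow (tunit : C) n)) z :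
      ev ⊗' (o ∘ t ∘ z) =
      (idm tunit ⊗' o) ∘ (ev ⊗' t) ∘ (idm (D ⊗ X) ⊗' z) :> mor (_ ⊗ (tpow D n ⊗ tpow X n)) _.
    by rewrite -!tensm_comp !comp_idl comp_idr.
  by rewrite E !compA lunit_natural.
set T := tpow X n; set Dn := tpow D n.
have cE : (assoc Dn D X ⊗' idm T) ∘ ((braiding D Dn ⊗' idm X) ⊗' idm T) ∘ assocV _ X T =
    assocV Dn (D ⊗ X) T ∘ sw (D ⊗ X) Dn T ∘ mid4 D Dn X T.
  apply: (@coherent_uniq _ _ _ (env4 D Dn X T) _ _
    (Node (Node (Leaf 0) (Leaf 1)) (Node (Leaf 2) (Leaf 3)))
    (Node (Node (Leaf 1) (Node (Leaf 0) (Leaf 2))) (Leaf 3))) => //; rewrite ?mid4E; solve_coherent.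
have cU : (runit Dn ⊗' idm T) ∘ assocV Dn tunit T ∘ sw tunit Dn T = lunit (Dn ⊗ T).
  apply: (@coherent_uniq _ _ _ (env4 Dn T Dn Dn) _ _
    (Node Unit (Node (Leaf 0) (Leaf 1))) (Node (Leaf 0) (Leaf 1))) => //; solve_coherent.
(* Pairing with X^(n+1) is transposing along the first factor and then pairing with X^n; both
   operations are bijective. *)
have key A (a : mor A (D ⊗ Dn)) :
   tpow_pairing n.+1 ∘ (a ⊗' idm _) =
   tpow_pairing n ∘ (transpose ev (braiding D Dn ∘ a) ⊗' idm T) ∘ assocV A X T.
  rewrite transposeE !tensm_compid !compA (compE _ (esym (assocV_natural _ _ _))) !compA.
  rewrite tensm_id; congr (_ ∘ _).
  rewrite (compE3 _ cE) !compA (compE _ (esym (assocV_natural _ _ _))) !compA.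
  rewrite (compE _ (esym (swap_natural _ _ _))) !compA (compE3 _ cU).
  by rewrite EE -lunit_natural tensm_id (compE _ (tensm_rl _ _)).
split=> [A f|A a b].
  have [b Eb] := IHs _ (f ∘ assoc A X T).
  have [c Ec] := transpose_surj b; exists (braiding _ _ ∘ c).
  by rewrite key compA braiding_sym comp_idl Ec Eb -compA assocVK comp_idr.
rewrite !key => /(iso_epi (iso_assocV _ _ _))/IHi/transpose_inj.
exact: (iso_mono (iso_braiding _ _)).
Qed.

End Dual.

End Adjunction.

(** * Abelian categories *)

Section Abelian.
Variables (k : fieldType) (C : linear_category k).
Hypothesis abC : abelian_category C.
Implicit Types (A B D T W X Y Z S P : C).

Lemma zero_mor_to X Z (f : mor X Z) : is_zero Z -> f = 0.
Proof. by rewrite /is_zero => z; rewrite -[f]comp_idl z comp0l. Qed.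
Lemma zero_mor_from X Z (f : mor Z X) : is_zero Z -> f = 0.
Proof. by rewrite /is_zero => z; rewrite -[f]comp_idr z comp0r. Qed.

Lemma kernel_mono K X Y (f : mor X Y) (i : mor K X) : is_kernel f i -> mono i.
Proof.
move=> [fi U] W g h E.
have [u [_ uU]] : exists! u, i ∘ u = i ∘ h by apply: U; rewrite compA fi comp0l.
by rewrite -(uU g) // -(uU h).
Qed.

Lemma cokernel_epi Q X Y (f : mor X Y) (q : mor Y Q) : is_cokernel f q -> epi q.
Proof.
move=> [qf U] W g h E.
have [u [_ uU]] : exists! u, u ∘ q = h ∘ q by apply: U; rewrite -compA qf comp0r.
by rewrite -(uU g) // -(uU h).
Qed.

Lemma kernel_factor K X Y (f : mor X Y) (i : mor K X) W (h : mor W X) :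
  is_kernel f i -> f ∘ h = 0 -> exists u, i ∘ u = h.
Proof. by move=> [_ U] /U[u [E _]]; exists u. Qed.

Lemma cokernel_factor Q X Y (f : mor X Y) (q : mor Y Q) W (h : mor Y W) :
  is_cokernel f q -> h ∘ f = 0 -> exists u, u ∘ q = h.
Proof. by move=> [_ U] /U[u [E _]]; exists u. Qed.

Lemma is_kernelP K X Y (f : mor X Y) (i : mor K X) : mono i -> f ∘ i = 0 ->
  (forall W (h : mor W X), f ∘ h = 0 -> exists u, i ∘ u = h) -> is_kernel f i.
Proof.
move=> mi fi U; split=> // W h /U[u E]; exists u; split=> // v Ev.
by apply: mi; rewrite E.
Qed.

Lemma is_cokernelP Q X Y (f : mor X Y) (q : mor Y Q) : epi q -> q ∘ f = 0 ->
  (forall W (h : mor Y W), h ∘ f = 0 -> exists u, u ∘ q = h) -> is_cokernel f q.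
Proof.
move=> mi fi U; split=> // W h /U[u E]; exists u; split=> // v Ev.
by apply: mi; rewrite E.
Qed.

Lemma mono_epi_iso X Y (f : mor X Y) : mono f -> epi f -> is_iso f.
Proof.
move=> mf ef; have [Z [g kg]] := abelian_mono abC mf.
have g0 : g = 0 by apply: (epi_eq0 ef); case: kg.
have [u fu] : exists u, f ∘ u = idm Y.
  by apply: (kernel_factor kg); rewrite g0 comp0l.
by exists u; split=> //; apply: mf; rewrite compA fu comp_idl comp_idr.
Qed.

(** The image is the kernel of the cokernel. If [u] kills [e], then [J], the kernel of [u], still
    receives [e]; the morphism whose kernel is [J -> Y] factors through [c], so it kills [m] and [J]
    is all of [I]. *)
Lemma image_exists X Y (f : mor X Y) :
  exists I (m : mor I Y) (e : mor X I), [/\ mono m, epi e & m ∘ e = f].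
Proof.
have [Q [c kc]] := abelian_cokernel abC f.
have [I [m km]] := abelian_kernel abC c.
have mm := kernel_mono km.
have [e Ee] := kernel_factor km kc.1.
exists I, m, e; split=> //; apply: epi0 => W u ue.
have [J [j kj]] := abelian_kernel abC u.
have [e' Ee'] := kernel_factor kj ue.
have [Z [g kg]] := abelian_mono abC (mono_comp mm (kernel_mono kj)).
have [g' Eg'] : exists g', g' ∘ c = g.
  by apply: (cokernel_factor kc); rewrite -Ee -Ee' [m ∘ _]compA compA kg.1 comp0l.
have [w Ew] : exists w, m ∘ j ∘ w = m.
  by apply: (kernel_factor kg); rewrite -Eg' -compA km.1 comp0r.
have jw : j ∘ w = idm _ by apply: mm; rewrite compA Ew comp_idr.
by rewrite -[u]comp_idr -jw compA kj.1 comp0l.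
Qed.

Lemma epi_cokernel K X Y (f : mor X Y) (i : mor K X) :
  epi f -> is_kernel f i -> is_cokernel i f.
Proof.
move=> ef ki; apply: is_cokernelP => //; first exact: ki.1.
move=> W h hi; have [V [g kg]] := abelian_epi abC ef.
have [g' Eg] := kernel_factor ki kg.1.
by apply: (cokernel_factor kg); rewrite -Eg compA hi comp0l.
Qed.

Lemma mono_kernel Q X Y (f : mor X Y) (q : mor Y Q) :
  mono f -> is_cokernel f q -> is_kernel q f.
Proof.
move=> ef ki; apply: is_kernelP => //; first exact: ki.1.
move=> W h hi; have [V [g kg]] := abelian_mono abC ef.
have [g' Eg] := cokernel_factor ki kg.1.
by apply: (kernel_factor kg); rewrite -Eg -compA hi comp0r.
Qed.

Lemma epi_short_exact X Y (f : mor X Y) : epi f ->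
  exists K (i : mor K X), short_exact i f.
Proof.
move=> ef; have [K [i ki]] := abelian_kernel abC f.
by exists K, i; split=> //; apply: epi_cokernel.
Qed.

Lemma mono_short_exact X Y (f : mor X Y) : mono f ->
  exists Q (q : mor Y Q), short_exact f q.
Proof.
move=> ef; have [K [i ki]] := abelian_cokernel abC f.
by exists K, i; split=> //; apply: mono_kernel.
Qed.

Lemma nonzero_epi_simple X S (f : mor X S) : simple_object S -> f <> 0 -> epi f.
Proof.
move=> [_ sS] f0; have [I [m [e [mm ee E]]]] := image_exists f.
case: (sS _ _ mm) => [zI|iso_m]; first by case: f0; rewrite -E (zero_mor_to e zI) comp0r.
by rewrite -E; apply: epi_comp => //; apply: iso_epi.
Qed.

(** Exactness of Hom(P, -) in the middle, for an [f] that need not be mono: pass to its image. *)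
Lemma projective_factor P X Y Q (f : mor X Y) (c : mor Y Q) (x : mor P Y) :
  projective P -> is_cokernel f c -> c ∘ x = 0 -> exists x', f ∘ x' = x.
Proof.
move=> pP kc cx; have [I [m [e [mm ee E]]]] := image_exists f.
have cm : is_cokernel m c.
  apply: is_cokernelP; first exact: cokernel_epi kc.
    by apply: (epi_eq0 ee); rewrite -compA E; case: kc.
  by move=> W h hm; apply: (cokernel_factor kc); rewrite -E compA hm comp0l.
have [y Ey] := kernel_factor (mono_kernel mm cm) cx.
have [x' Ex] := pP _ _ e y ee; exists x'.
by rewrite -E -compA Ex.
Qed.

Lemma retract_projective P X (r : mor P X) (i : mor X P) :
  projective P -> r ∘ i = idm X -> projective X.
Proof.
move=> pP ri Y Z e f ee; have [h E] := pP _ _ e (f ∘ r) ee.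
by exists (h ∘ i); rewrite compA E -compA ri comp_idr.
Qed.

Lemma iso_projective X Y (f : mor X Y) : is_iso f -> projective X -> projective Y.
Proof. by move=> [g [_ fg]] pX; apply: (retract_projective pX fg). Qed.

Lemma intersection_exists A B T (a : mor A T) (b : mor B T) : mono a -> mono b ->
  exists D (c : mor D T), mono c /\ is_intersection a b c.
Proof.
move=> ma mb; have [Q [q kq]] := abelian_cokernel abC b.
have [D [d kd]] := abelian_kernel abC (q ∘ a).
have md := kernel_mono kd; have kb := mono_kernel mb kq.
exists D, (a ∘ d); split; [exact: mono_comp|split; [by exists d|split]].
  by apply: (kernel_factor kb); rewrite compA kd.1.
move=> W x y E; have [w Ew] : exists w, d ∘ w = x.
  by apply: (kernel_factor kd); rewrite -compA E compA kb.1 comp0l.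
exists w; split; first by rewrite -compA Ew.
by move=> w' E'; apply: md; apply: ma; rewrite Ew !compA.
Qed.

(** Existence of a composition series with [n] steps, as a relation: no uniqueness of the length is
    claimed, which spares the Jordan-Hölder theorem. *)
Inductive has_length : C -> nat -> Prop :=
| has_length0 X : is_zero X -> has_length X 0
| has_lengthS X Y S (f : mor X Y) (g : mor Y S) n : short_exact f g ->
    has_length X n -> simple_object S -> has_length Y n.+1.

Lemma finite_has_length X : finite_length X -> exists n, has_length X n.
Proof.
elim=> [Y zY|W Y S f g fg _ [n ln] sS]; first by exists 0%N; apply: has_length0.
by exists n.+1; apply: has_lengthS fg ln sS.
Qed.

Lemma zero_iso X Y (f : mor X Y) : is_zero X -> is_zero Y -> is_iso f.
Proof. by move=> zX zY; exists 0; rewrite comp0l comp0r zX zY. Qed.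

Lemma sub_length X n : has_length X n -> forall Y (i : mor Y X), mono i ->
  exists2 m, has_length Y m & (m <= n)%N /\ (m = n -> is_iso i).
Proof.
elim=> {X n} [X zX|X' X S f g n fg _ IH sS] Y i mi.
  have zY : is_zero Y by apply: mi; rewrite (zero_mor_to i zX) !comp0l.
  by exists 0%N; [apply: has_length0|split=> // _; apply: zero_iso].
have [kf kg] := fg; have mf := kernel_mono kf.
have [gi0|gi0] := pselect (g ∘ i = 0).
  have [u Eu] := kernel_factor kf gi0.
  have mu : mono u by apply: (@mono_cancel _ _ _ _ _ f); rewrite Eu.
  have [m lm [le_mn _]] := IH _ _ mu; exists m => //; split; first exact: leq_trans le_mn _.
  by move=> E; move: le_mn; rewrite E ltnn.
have egi := nonzero_epi_simple sS gi0.
have [K [j kj]] := abelian_kernel abC (g ∘ i).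
have [u Eu] : exists u, f ∘ u = i ∘ j by apply: (kernel_factor kf); rewrite compA kj.1.
have mu : mono u.
  by apply: (@mono_cancel _ _ _ _ _ f); rewrite Eu; apply: mono_comp => //; apply: kernel_mono kj.
have [m lm [le_mn iso_u]] := IH _ _ mu.
exists m.+1; first by apply: (has_lengthS _ lm sS); split; [exact: kj|exact: epi_cokernel].
(* If the lengths agree, the subobject contains all of [X'] and maps onto [S], so it is
   everything. *)
split=> // -[/iso_u[v [vu uv]]]; apply: mono_epi_iso => //.
apply: epi0 => W w wi.
have wf : w ∘ f = 0 by rewrite -[f]comp_idr -uv !compA -(compA w) Eu !compA wi !comp0l.
have [w' Ew] := cokernel_factor kg wf.
have w'0 : w' = 0 by apply: (epi_eq0 egi); rewrite compA Ew.
by rewrite -Ew w'0 comp0l.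
Qed.

(** Either [f] is invertible, or the same object [X] has a strictly smaller length and the induction
    applies to it. *)
Lemma mono_endo_iso X n (f : mor X X) : has_length X n -> mono f -> is_iso f.
Proof.
elim/ltn_ind: n => n IH lX mf; have [m lm [le_mn H]] := sub_length lX mf.
by move: le_mn; rewrite leq_eqVlt => /predU1P[/H//|/IH]; apply.
Qed.

End Abelian.

(** * Exactness of the tensor product and simplicity of the unit *)

Section TensorCategory.
Variables (k : fieldType) (C : tensor_category k).
Implicit Types (A B D P Q S T U V W X Y Z : C).

Let abC := tc_abelian C.

Lemma rigidP X : exists D (ev : mor (D ⊗ X) tunit) coev, @dual_pair _ C X D ev coev.
Proof. exact: (@tc_rigid k C X). Qed.

Lemma tensr_epi X Y Z (e : mor Y Z) : epi e -> epi (e ⊗' idm X).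
Proof. by have [D [ev [coev d]]] := rigidP X; apply: tens_epi d _ _ _. Qed.
Lemma tensr_mono X Y Z (e : mor Y Z) : mono e -> mono (e ⊗' idm X).
Proof.
have [D [ev [coev d]]] := rigidP X.
exact: tens_dual_mono (dual_pair_sym d) _ _ _.
Qed.
Lemma tensl_epi X Y Z (e : mor Y Z) : epi e -> epi (idm X ⊗' e).
Proof.
move=> ee; apply: (@epi_cancel _ _ _ _ _ (idm X ⊗' e) (braiding Y X)).
rewrite -braiding_natural; apply: epi_comp; last exact: tensr_epi.
exact/iso_epi/iso_braiding.
Qed.
Lemma tensl_mono X Y Z (e : mor Y Z) : mono e -> mono (idm X ⊗' e).
Proof.
move=> ee; apply: (@mono_cancel _ _ _ _ _ (braiding X Z)).
rewrite braiding_natural; apply: mono_comp; first exact: tensr_mono.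
exact/iso_mono/iso_braiding.
Qed.
Lemma tens_epi2 X Y X' Y' (e : mor X X') (e' : mor Y Y') :
  epi e -> epi e' -> epi (e ⊗' e').
Proof. by move=> ee ee'; rewrite -tensm_lr; apply: epi_comp; [apply: tensr_epi|apply: tensl_epi]. Qed.

Lemma btensm_is_epi n (X Y : 'I_n -> C) (f : forall i, mor (X i) (Y i)) :
  (forall i, epi (f i)) -> epi (btensm f).
Proof.
elim: n X Y f => [|n IH] X Y f ef /=; first exact/iso_epi/iso_id.
by apply: tens_epi2; [apply: ef|apply: IH].
Qed.

Lemma tensr_cokernel A X Y Z (f : mor X Y) (q : mor Y Z) :
  is_cokernel f q -> is_cokernel (f ⊗' idm A) (q ⊗' idm A).
Proof.
move=> kq; apply: is_cokernelP; first exact/tensr_epi/cokernel_epi/kq.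
  by rewrite -tensm_compid kq.1 tensm0l.
have [D [ev [coev d]]] := rigidP A.
move=> W h hf; have [a Ea] := transpose_surj d h.
have [b Eb] : exists b, b ∘ q = a.
  apply: (cokernel_factor kq); apply: (transpose_inj d).
  by rewrite transpose_compl Ea hf transposeE tensm0l comp0r.
by exists (transpose ev b); rewrite -transpose_compl Eb.
Qed.

(** [- ⊗ X] is left adjoint to [- ⊗ D], which preserves epimorphisms. *)
Lemma projective_tensr P X : projective P -> projective (P ⊗ X).
Proof.
move=> pP Y Z e f ee; have [D [ev [coev d]]] := rigidP X.
have [a Ea] := transpose_surj d f.
have [h Eh] := pP _ _ _ a (@tensr_epi D _ _ _ ee).
by exists (transpose ev h); rewrite -transpose_compr Eh.
Qed.

Lemma projective_tensl P X : projective P -> projective (X ⊗ P).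
Proof. by move=> /(@projective_tensr _ X); apply/iso_projective/iso_braiding. Qed.

Lemma dual_projective P D ev coev :
  @dual_pair _ C P D ev coev -> projective P -> projective D.
Proof.
move=> [_ zag] pP; have [r [rK Kr]] := runit_iso D.
apply: (@retract_projective _ _ (D ⊗ (P ⊗ D)) _
  (lunit D ∘ (ev ⊗' idm D) ∘ assocV D P D) ((idm D ⊗' coev) ∘ r)).
  exact/projective_tensl/projective_tensr.
by rewrite compA zag.
Qed.

Lemma zero_tensl X Y : is_zero X -> is_zero (X ⊗ Y).
Proof. by rewrite /is_zero -tensm_id => ->; rewrite tensm0l. Qed.
Lemma zero_tensr X Y : is_zero Y -> is_zero (X ⊗ Y).
Proof. by rewrite /is_zero -tensm_id => ->; rewrite tensm0r. Qed.
Lemma zero_retract X Y (r : mor Y X) (i : mor X Y) : r ∘ i = idm X -> is_zero Y -> is_zero X.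
Proof. by move=> ri zY; rewrite /is_zero -ri (zero_mor_from r zY) comp0l. Qed.
Lemma zero_is_iso X Y (f : mor X Y) : is_iso f -> is_zero Y -> is_zero X.
Proof. by move=> [g [gf _]]; apply: zero_retract gf. Qed.

Lemma tunit_nonzero : ~ is_zero (tunit : C).
Proof.
move=> z; have /bij_inj H := tc_end_one C.
have := H 0 1; rewrite z !scaler0 => /(_ erefl)/eqP.
by rewrite eq_sym oner_eq0.
Qed.

Lemma tunit_endo (f : mor (tunit : C) tunit) : exists c, f = c *: idm tunit.
Proof. by have [g _ K] := tc_end_one C; exists (g f); rewrite K. Qed.

(* [U ⊗ V = 0] for [V = 1 / U], so that [D ⊗ U = D] for the dual [D] of [U];
   this gives a retraction of [U -> 1]. *)
Lemma tunit_simple : simple_object (tunit : C).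
Proof.
split; first exact: tunit_nonzero.
move=> U i mi; have [V [c [ki kc]]] := mono_short_exact abC mi.
have zUV : is_zero (U ⊗ V).
  (* Followed by the mono [i ⊗ V], this becomes [c ∘ i] up to unitors, because the two unitors of 1
     ⊗ 1 coincide. *)
  have c0 : idm U ⊗' c = 0.
    apply: (mono_eq0 (@tensr_mono V _ _ _ mi)); rewrite tensm_swap.
    apply: (iso_mono (lunit_iso V)); rewrite comp0r compA lunit_natural.
    by rewrite -runit_tunit -compA runit_natural compA ki.1 comp0l.
  apply: (@tensl_epi U _ _ c); first exact: cokernel_epi kc.
  by rewrite c0 !comp0r.
have [D [ev [coev [zig zag]]]] := rigidP U.
(* [D] is a retract of D ⊗ U ⊗ D, so [V ⊗ D] is a retract of an object containing the factor
   [U ⊗ V]. *)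
have zVD : is_zero (V ⊗ D).
  have [r [rK Kr]] := runit_iso D.
  apply: (@zero_retract _ (V ⊗ (D ⊗ (U ⊗ D)))
    (idm V ⊗' (lunit D ∘ (ev ⊗' idm D) ∘ assocV D U D)) (idm V ⊗' ((idm D ⊗' coev) ∘ r))).
    by rewrite -tensm_idcomp compA zag Kr tensm_id.
  apply: (@zero_is_iso _ (D ⊗ ((U ⊗ V) ⊗ D)) ((idm D ⊗' (((braiding V U ⊗' idm D)) ∘ assocV V U D)) ∘ sw V D (U ⊗ D))).
    apply: iso_comp; last exact: iso_swap.
    apply: iso_tensm; first exact: iso_id.
    apply: iso_comp; last exact: iso_assocV.
    by apply: iso_tensm; [exact: iso_braiding|exact: iso_id].
  by apply: zero_tensr; apply: zero_tensl.
(* The cokernel of [i ⊗ D] is [V ⊗ D], which is zero. So [ev] factors through a morphism [e] from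
   [D] to 1, whose transpose is the retraction [r] below. *)
have [w' [w'w ww']] : is_iso (lunit D ∘ (i ⊗' idm D) ∘ braiding D U).
  apply: iso_comp; last exact: iso_braiding.
  apply: iso_comp; first exact: lunit_iso.
  apply: (mono_epi_iso abC); first exact: tensr_mono.
  apply: epi0 => W g gi; have [u <-] := cokernel_factor (tensr_cokernel D kc) gi.
  by rewrite (zero_mor_from u zVD) comp0l.
have [e Ee] : exists e : mor D tunit, ev ∘ w' = e by exists (ev ∘ w').
pose r := runit U ∘ (idm U ⊗' e) ∘ coev.
have ri : r ∘ i = idm U.
  apply: (iso_epi (lunit_iso U)); rewrite comp_idl -[RHS]zig.
  have -> : ev = e ∘ runit D ∘ (idm D ⊗' i).
    transitivity (e ∘ (lunit D ∘ (i ⊗' idm D) ∘ braiding D U)).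
      by rewrite -Ee -compA w'w comp_idr.
    by rewrite -lunit_braiding !compA (compE _ (braiding_natural _ _)) !compA.
  rewrite !tensm_idcomp !compA (compE _ (esym (assoc_natural _ _ _))) tensm_id !compA.
  rewrite (compE _ (esym (tensm_swap _ _))) !compA.
  rewrite (compE _ (runit_assoc _ _)) (compE _ (runit_natural _)) !compA.
  by rewrite /r runit_tunit -(compA _ (lunit tunit)) lunit_natural !compA.
(* [i ∘ r] is a scalar [a] with [a *: i = i], so [a] is 1 unless [i] vanishes. *)
have [a Ea] := tunit_endo (i ∘ r).
have [i0|i0] := pselect (i = 0).
  by left; rewrite /is_zero -ri i0 comp0r.
have a1 : a = 1.
  have : (a - 1) *: i = 0.
    by rewrite scalerBl scale1r -[a *: i]comp_idl compZr -compZl -Ea -compA ri comp_idr subrr.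
  have [/eqP|ne] := eqVneq (a - 1) 0; first by rewrite subr_eq0 => /eqP.
  by move=> /(congr1 ( *:%R (a - 1)^-1)); rewrite scalerA mulVf // scale1r scaler0.
by right; exists r; split=> //; rewrite Ea a1 scale1r.
Qed.

End TensorCategory.

(** * Projective covers *)

Section Projectives.
Variables (k : fieldType) (C : tensor_category k).
Hypothesis hC : has_projective_objects C.
Implicit Types (A B D I J P Q S T U V W X Y Z : C).

Let abC := tc_abelian C.

Lemma perfect_eq0l X D ev coev A (a : mor A D) :
  @dual_pair _ C X D ev coev -> ev ∘ (a ⊗' idm X) = 0 -> a = 0.
Proof.
move=> /dual_perfect[_ H] E; apply: (H A); by rewrite E tensm0l comp0r.
Qed.

Lemma perfect_eq0r X D ev coev A (b : mor A X) :
  @dual_pair _ C X D ev coev -> ev ∘ (idm D ⊗' b) = 0 -> b = 0.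
Proof.
move=> /dual_pair_sym d E; apply: (perfect_eq0l d).
by rewrite -compA braiding_natural compA E comp0l.
Qed.

(** The evaluation of a nonzero projective is nonzero, hence onto the simple unit, and its source is
    projective. *)
Lemma unit_projective : exists P (e : mor P tunit), projective P /\ epi e.
Proof.
have [P [pP nzP]] := hC; have [D [ev [coev d]]] := rigidP P.
exists (D ⊗ P), ev; split; first exact: projective_tensl.
apply: (nonzero_epi_simple abC); first exact: tunit_simple.
move=> ev0; apply: nzP; apply: (perfect_eq0r d).
by rewrite ev0 comp0l.
Qed.

Lemma enough_projectives X : exists P (e : mor P X), projective P /\ epi e.
Proof.
have [P [e [pP ee]]] := unit_projective.
exists (X ⊗ P), (runit X ∘ (idm X ⊗' e)); split; first exact: projective_tensl.
by apply: epi_comp; [exact/iso_epi/runit_iso|exact: tensl_epi].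
Qed.

(** The transpose of [f] on the dual is mono, hence invertible by finite length; then [f] is
    mono. *)
Lemma epi_endo_mono X (f : mor X X) : epi f -> mono f.
Proof.
move=> ef; have [D [ev [coev d]]] := rigidP X.
have [g Eg] := (dual_perfect d).1 _ (ev ∘ (idm D ⊗' f)).
have mg : mono g.
  apply: mono0 => A a ga; apply: (perfect_eq0l d).
  apply: (@epi_eq0 _ _ _ _ (idm A ⊗' f)); first exact: tensl_epi.
  rewrite -compA tensm_swap compA -Eg -compA -tensm_compid ga.
  by rewrite tensm0l comp0r.
have [n ln] := finite_has_length (tc_finite_length D).
have ig := mono_endo_iso abC ln mg.
apply: mono0 => A b fb; apply: (perfect_eq0r d).
apply: (@epi_eq0 _ _ _ _ (g ⊗' idm A)); first exact/tensr_epi/iso_epi.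
by rewrite -compA -tensm_swap compA Eg -compA -tensm_idcomp fb tensm0r comp0r.
Qed.

(** [I] is a subobject of [W] of least possible length on which [r] is still epi; minimality gives
    the covering property. *)
Lemma projective_cover_exists : exists Q (q : mor Q tunit), projective_cover q.
Proof.
have [W [r [pW er]]] := unit_projective.
pose good n := exists I (m : mor I W), [/\ mono m, epi (r ∘ m) & has_length I n].
have [n0 ln0] := finite_has_length (tc_finite_length W).
have ex_good : exists n, `[<good n>].
  exists n0; apply/asboolP; exists W, (idm W); split=> //; first exact/iso_mono/iso_id.
  by rewrite comp_idr.
case: (ex_minnP ex_good) => n /asboolP[I [m [mm erm lI]]] min_n.
have minI J (j : mor J I) : mono j -> epi (r ∘ m ∘ j) -> is_iso j.
  move=> mj ej; have [n' lJ [le_n'n H]] := sub_length abC lI mj.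
  apply: H; apply/eqP; rewrite eqn_leq le_n'n min_n //; apply/asboolP.
  by exists J, (m ∘ j); split=> //; [exact: mono_comp|rewrite compA].
have minE Y (h : mor Y I) : epi (r ∘ m ∘ h) -> epi h.
  move=> eh; have [J [j [e [mj ee E]]]] := image_exists abC h.
  rewrite -E; apply: epi_comp => //; apply/iso_epi/minI => //.
  by apply: (@epi_cancel _ _ _ _ _ _ e); rewrite -compA E.
(* Lifting [r] to [I] makes [f ∘ m] an epi endomorphism of [I], hence invertible, and [I] a retract
   of [W]. *)
have [f Ef] := pW _ _ (r ∘ m) r erm.
have efm : epi (f ∘ m) by apply: minE; rewrite compA Ef.
have [g [gK _]] := mono_epi_iso abC (epi_endo_mono efm) efm.
exists I, (r ∘ m); split=> //.
by apply: (retract_projective pW (r := g ∘ f)); rewrite -gK compA.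
Qed.

Section Cover.
Variables (Q : C) (q : mor Q tunit).
Hypothesis cq : projective_cover q.

Lemma cover_nonzero : q <> 0.
Proof.
have [_ eq _] := cq => q0; apply: (@tunit_nonzero _ C).
by apply: eq; rewrite q0 !comp0r.
Qed.

(** If [q] were nonzero on the kernel of [e], it would be epi there since 1 is simple; the kernel
    would then be all of [Q] and [e] zero. *)
Lemma cover_factor E (e : mor Q E) : epi e -> e <> 0 -> exists u, u ∘ e = q.
Proof.
move=> ee e0; have [K [j [kj kc]]] := epi_short_exact abC ee.
have [_ _ cov] := cq; apply: (cokernel_factor kc).
apply: contrapT => qj; apply: e0; apply: (@epi_eq0 _ _ _ _ j); last exact: kj.1.
by apply: cov; apply: (nonzero_epi_simple abC) => //; apply: tunit_simple.
Qed.

Lemma cover_scalar (f : mor Q tunit) : exists c, f = c *: q.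
Proof.
have [->|f0] := pselect (f = 0); first by exists 0; rewrite scale0r.
have [u Eu] := cover_factor (nonzero_epi_simple abC (tunit_simple C) f0) f0.
have [c Ec] := tunit_endo u; exists c^-1.
have Eq : q = c *: f by rewrite -Eu Ec compZl comp_idl.
have c0 : c != 0 by apply/eqP => c0; apply: cover_nonzero; rewrite Eq c0 scale0r.
by rewrite Eq scalerA mulVf // scale1r.
Qed.

Lemma scale_cover_inj (a b : k) : a *: q = b *: q -> a = b.
Proof.
move=> /eqP; rewrite -subr_eq0 -scalerBl scaler_eq0 subr_eq0 => /orP[/eqP//|/eqP q0].
by case: cover_nonzero.
Qed.

Definition cover_coef (f : mor Q tunit) : k := projT1 (cid (cover_scalar f)).

Lemma cover_coefE f : f = cover_coef f *: q.
Proof. by rewrite /cover_coef; case: cid. Qed.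

Lemma cover_coefP f c : f = c *: q -> cover_coef f = c.
Proof. by move=> E; apply: scale_cover_inj; rewrite -cover_coefE. Qed.

Lemma cover_coef_linear c f g :
  cover_coef (c *: f + g) = c * cover_coef f + cover_coef g.
Proof.
by apply: cover_coefP; rewrite scalerDl -scalerA -!cover_coefE.
Qed.

End Cover.

End Projectives.

(** * Averaging over cosets *)

Section Averaging.
Variables (gT : finGroupType) (H : {group gT}).

Lemma repr_rcosets_eq (M : Type) (F : gT -> M) (A : {set gT}) a :
  (forall h s, h \in H -> F (h * s)%g = F s) ->
  A \in rcosets H [set: gT]%g -> a \in A -> F (repr A) = F a.
Proof.
move=> FH /rcosetsP[b _ ->] /rcosetP[h hH ->]; rewrite FH //.
by have /rcosetP[h' h'H ->] := mem_repr_rcoset H b; rewrite FH.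
Qed.

(** [repr] does not commute with translation, but [F] is constant on cosets, so translating only
    permutes the terms. *)
Lemma sum_rcosets_mulr (M : nmodType) (F : gT -> M) t :
  (forall h s, h \in H -> F (h * s)%g = F s) ->
  \sum_(A in rcosets H [set: gT]%g) F (repr A * t)%g =
  \sum_(A in rcosets H [set: gT]%g) F (repr A).
Proof.
move=> FH; have rK u : cancel (fun A : {set gT} => A :* u)%g (fun A => A :* u^-1)%g.
  by move=> A /=; rewrite -rcosetM mulgV rcoset1.
have mem u (A : {set gT}) : A \in rcosets H [set: gT]%g -> (A :* u)%g \in rcosets H [set: gT]%g.
  by move=> /rcosetsP[a _ ->]; apply/rcosetsP; exists (a * u)%g; rewrite ?inE ?rcosetM.
rewrite [RHS](reindex (fun A : {set gT} => A :* t)%g); last first.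
  exists (fun A => A :* t^-1)%g => A _; first exact: rK.
  by have := rK t^-1%g A; rewrite invgK.
apply: eq_big => [A|A AH].
  apply/idP/idP => [/mem//|/(mem t^-1%g)]; by rewrite rK.
apply/esym/repr_rcosets_eq => //; first exact: mem.
rewrite mem_rcoset mulgK; have /rcosetsP[a _ ->] := AH.
exact: mem_repr_rcoset.
Qed.

End Averaging.

Section Splitting.
Variables (k : fieldType) (C : tensor_category k).
Variables (Q : C) (q : mor Q tunit).

Definition tpow_counit n : mor (tpow Q n) tunit := one_tpow C n ∘ tpowm n q.

(* Equivalently, Hom(Q, q^n) has an S_n-equivariant section. *)
Definition invariant_lift n : Prop := exists2 a : mor Q (tpow Q n),
  tpow_counit n ∘ a = q & forall s : 'S_n, braid Q s ∘ a = a.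

Lemma tpow_counit_braid n (s : 'S_n) : tpow_counit n ∘ braid Q s = tpow_counit n.
Proof. by rewrite /tpow_counit -compA -braid_tpowm compA one_tpow_braid. Qed.

(** The transfer from [H] to S_n. Each translate still lies over [q], so the sum lies over the index
    times [q]. *)
Lemma invariant_lift_index n (H : {group 'S_n}) (a : mor Q (tpow Q n)) :
  tpow_counit n ∘ a = q -> (forall s, s \in H -> braid Q s ∘ a = a) ->
  (#|[set: 'S_n] : H|%g)%:R != 0 :> k -> invariant_lift n.
Proof.
move=> Ea Ha nz; exists (((#|[set: 'S_n] : H|%g)%:R^-1 : k) *:
  \sum_(A in rcosets H [set: 'S_n]%g) braid Q (repr A) ∘ a).
  rewrite compZr comp_sumr (eq_bigr (fun=> q)) => [|A _].
    by rewrite sumr_const -scaler_nat scalerA mulVf // scale1r.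
  by rewrite compA tpow_counit_braid.
move=> s; rewrite compZr comp_sumr; congr (_ *: _).
rewrite -(@sum_rcosets_mulr _ H _ (fun t => braid Q t ∘ a) s) => [|h t hH].
  by apply: eq_bigr => A _; rewrite compA -braidM.
by rewrite braidM -compA Ha.
Qed.

Lemma tpow_counitS n :
  tpow_counit n.+1 = lunit tunit ∘ (q ⊗' tpow_counit n).
Proof.
by rewrite /tpow_counit /= -lunit_natural -compA -tensm_comp comp_idl.
Qed.

Hypotheses (pQ : projective Q) (eq : epi q).

Lemma counit_tens_epi : epi (lunit tunit ∘ (q ⊗' q)).
Proof. by apply: epi_comp; [exact/iso_epi/lunit_iso|exact: tens_epi2]. Qed.

Lemma comult_exists : exists t : mor Q (Q ⊗ Q), lunit tunit ∘ (q ⊗' q) ∘ t = q.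
Proof. exact: pQ counit_tens_epi. Qed.

Lemma invariant_lift0 : invariant_lift 0.
Proof.
exists q; first by rewrite /tpow_counit /= !comp_idl.
by move=> s; rewrite /= comp_idl.
Qed.

Lemma braid_lift0 n (s : 'S_n) : braid Q (lift_perm ord0 ord0 s) = idm Q ⊗' braid Q s.
Proof.
rewrite /= lift_perm_id.
have -> : move_front Q n (ord0 : 'I_n.+1) = idm _ by case: n s.
rewrite comp_idl; congr (_ ⊗' braid Q _); apply: funext => j.
by rewrite lift_perm_lift liftK.
Qed.

Lemma invariant_liftS n : (n.+1)%:R != 0 :> k -> invariant_lift n -> invariant_lift n.+1.
Proof.
move=> nz [a Ea Ha]; have [t Et] := comult_exists.
have gH : group_set [set lift_perm ord0 ord0 s | s : 'S_n].
  apply/group_setP; split; first by apply/imsetP; exists 1%g; rewrite ?inE ?lift_perm1.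
  move=> _ _ /imsetP[u _ ->] /imsetP[v _ ->]; apply/imsetP.
  by exists (u * v)%g; rewrite ?inE ?(lift_permM _ ord0).
have liftI : injective (@lift_perm n ord0 ord0).
  move=> u v E; apply/permP => j; apply: (@lift_inj _ ord0).
  by rewrite -!(lift_perm_lift ord0 ord0) E.
apply: (@invariant_lift_index _ (Group gH) ((idm Q ⊗' a) ∘ t)).
- by rewrite tpow_counitS !compA (compE _ (esym (tensm_comp _ _ _ _))) comp_idr Ea.
- by move=> _ /imsetP[s _ ->]; rewrite braid_lift0 compA -tensm_idcomp Ha.
have -> : #|[set: 'S_n.+1] : Group gH|%g = n.+1 => //.
have cS l : #|[set: 'S_l]| = l`!%N by rewrite -card_Sn cardsT.
have := Lagrange (subsetT (Group gH)); rewrite cS /= card_imset // card_Sn factS.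
by rewrite mulnC => /eqP; rewrite eqn_pmul2r ?fact_gt0 // => /eqP.
Qed.

(** In Legendre's formula the term for mp at p^(i+1) equals the term for m at p^i. Hence the wreath
    product of order m! (p!)^m has index prime to p in S_(mp). *)
Lemma logn_fact_mul p m : prime p -> logn p (m * p)`! = (m + logn p m`!)%N.
Proof.
move=> pp; rewrite !logn_fact //.
have [->|m0] := posnP m; first by rewrite mul0n !big_nil.
have lt1m : (0 < m * p)%N by rewrite muln_gt0 m0 prime_gt0.
have le_mp : (m <= m * p)%N by rewrite leq_pmulr // prime_gt0.
rewrite big_ltn // expn1 mulnK ?prime_gt0 //; congr addn.
rewrite big_add1 /=.
transitivity (\sum_(1 <= i < (m * p).+1) m %/ p ^ i)%N.
  rewrite [RHS]big_nat_recr //= [X in (_ + X)%N]divn_small ?addn0; last first.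
    exact: leq_ltn_trans le_mp (ltn_expl _ (prime_gt1 pp)).
  by apply: eq_bigr => i _; rewrite expnSr divnMr ?prime_gt0.
rewrite (@big_cat_nat _ _ _ m.+1) //= [X in (_ + X)%N]big_nat_cond [X in (_ + X)%N]big1 ?addn0 // => i.
rewrite andbT => /andP[lt_mi _]; rewrite divn_small //.
exact: ltn_trans lt_mi (ltn_expl _ (prime_gt1 pp)).
Qed.

Lemma wreath_group m p : (0 < p)%N -> exists2 H : {group 'S_(m * p)},
  #|H| = (m`! * p`! ^ m)%N &
  forall u, u \in H -> exists (s : 'S_m) (t : 'I_m -> 'S_p),
    forall x, unflat (u x) = (s (unflat x).1, t (unflat x).1 (unflat x).2).
Proof.
move=> p0; have [g gK Kg] := @unflat_bij m p.
pose f (st : 'S_m * {ffun 'I_m -> 'S_p}) x :=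
  g (st.1 (unflat x).1, st.2 (unflat x).1 (unflat x).2).
have fI st : injective (f st).
  move=> x y /(congr1 (@unflat m p)); rewrite !Kg => -[/perm_inj E1].
  rewrite E1 => /perm_inj E2; apply: (@unflat_inj m p); move: E1 E2.
  by case: (unflat x) => ? ?; case: (unflat y) => ? ? /= -> ->.
pose w st := perm (fI st).
have wE st x : unflat (w st x) =
    (st.1 (unflat x).1, st.2 (unflat x).1 (unflat x).2).
  by rewrite permE /f Kg.
have wP (u : 'S_(m * p)) (st : 'S_m * {ffun 'I_m -> 'S_p}) : (forall x, unflat (u x) =
    (st.1 (unflat x).1, st.2 (unflat x).1 (unflat x).2)) -> u = w st.
  by move=> uE; apply/permP => x; apply: (@unflat_inj m p); rewrite uE wE.
have gH : group_set [set w st | st in predT].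
  apply/group_setP; split.
    apply/imsetP; exists (1%g, [ffun=> 1%g]) => //; apply: wP => x /=.
    by rewrite ffunE !perm1; case: (unflat x).
  move=> _ _ /imsetP[[s t] _ ->] /imsetP[[s' t'] _ ->]; apply/imsetP.
  exists ((s * s')%g, [ffun i => t i * t' (s i)]%g) => //; apply: wP => x /=.
  by rewrite permM !wE /= ffunE !permM.
exists (Group gH); last first.
  by move=> _ /imsetP[st _ ->]; exists st.1, st.2 => x; rewrite wE.
rewrite /= card_imset; last first.
  move=> [s t] [s' t'] E.
  have H i j : (s i, t i j) = (s' i, t' i j).
    have := congr1 (fun u : 'S_(m * p) => unflat (u (g (i, j)))) E.
    by rewrite /= !wE /= !Kg.
  congr pair; first by apply/permP => i; case: (H i (Ordinal p0)).
  by apply/ffunP => i; apply/permP => j; case: (H i j).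
transitivity #|{: 'S_m * {ffun 'I_m -> 'S_p}}|; first exact: eq_card.
by rewrite card_prod card_ffun !card_Sn card_ord.
Qed.

(** The lift applies [b] and then [a] in each factor: [a] is invariant inside blocks and [b] under
    permutations of blocks. *)
Lemma invariant_lift_mul m p : prime p -> p \in [pchar k] ->
  invariant_lift p -> invariant_lift m -> invariant_lift (m * p).
Proof.
move=> pp chp [a Ea Ha] [b Eb Hb]; have [H cH uH] := @wreath_group m p (prime_gt0 pp).
apply: (@invariant_lift_index _ H (tflat Q m p ∘ tpowm m a ∘ b)).
- rewrite /tpow_counit !compA (compE _ (esym (tflat_tpowm m p q))) !compA tflat_one.
  rewrite (compE _ (esym (tpowm_comp m _ _))) (compE _ (esym (tpowm_comp m _ _))).
  by rewrite ?compA -/(tpow_counit p) Ea.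
- move=> u /uH[s [t uE]]; rewrite !compA (braid_tflat _ uE) -!compA; congr (_ ∘ _).
  have -> : btensm (fun i => braid Q (t i)) ∘ (tpowm m a ∘ b) = tpowm m a ∘ b.
    by rewrite compA -btensm_comp (eq_btensm (g := fun=> a)) // => i; apply: Ha.
  by rewrite compA braid_tpowm -compA Hb.
have i0 : (0 < #|[set: 'S_(m * p)] : H|%g)%N by rewrite indexg_gt0.
rewrite -(dvdn_pcharf chp); apply/negP => dv.
have := Lagrange (subsetT H); rewrite cH.
have -> : #|[set: 'S_(m * p)]| = (m * p)`!%N by rewrite -card_Sn cardsT.
have lp : logn p p`! = 1%N by have := logn_fact_mul 1 pp; rewrite mul1n logn1.
move=> /(congr1 (logn p)); rewrite !lognM ?muln_gt0 ?expn_gt0 ?fact_gt0 //.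
rewrite logn_fact_mul // lognX lp muln1 [(m + _)%N]addnC => /eqP.
rewrite -[X in _ == X]addn0 eqn_add2l => /eqP l0.
by have := pfactor_dvdn 1 pp i0; rewrite expn1 dv l0.
Qed.

Lemma invariant_lift_all p : p \in [pchar k] -> invariant_lift p ->
  forall n, invariant_lift n.
Proof.
move=> chp Hp n; have pp := pcharf_prime chp.
elim/ltn_ind: n => -[|n] IH; first exact: invariant_lift0.
have [/dvdnP[m E]|np] := boolP (p %| n.+1)%N; last first.
  by apply: invariant_liftS; [rewrite -(dvdn_pcharf chp)|apply: IH].
rewrite E; apply: invariant_lift_mul => //; apply: IH; rewrite E.
have m0 : (0 < m)%N by case: m E.
by rewrite -[X in (X < _)%N]muln1 ltn_pmul2l // prime_gt1.
Qed.

End Splitting.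

Definition linear_of (k : fieldType) (U V : lmodType k) (f : U -> V)
    (lf : linear f) : {linear U -> V} :=
  HB.pack f (GRing.isSemilinear.Build _ _ _ _ f (GRing.semilinear_linear lf)).

(** * Equivariant sections *)

Section NaturalRetraction.
Variables (k : fieldType) (C : tensor_category k).
Variables (Q : C) (q : mor Q tunit).
Hypotheses (pQ : projective Q) (eq : epi q).
Implicit Types (P X Y Z : C).

Definition counit_tens X : mor (Q ⊗ X) X := lunit X ∘ (q ⊗' idm X).

Lemma counit_tens_natural X Y (f : mor X Y) :
  counit_tens Y ∘ (idm Q ⊗' f) = f ∘ counit_tens X.
Proof.
by rewrite /counit_tens -compA tensm_swap !compA lunit_natural.
Qed.

Lemma counit_tens_is_epi X : epi (counit_tens X).
Proof. by apply: epi_comp; [exact/iso_epi/lunit_iso|exact: tensr_epi]. Qed.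

Lemma lunit_tzip X n :
  tpowm n (lunit X) ∘ tzip tunit X n = lunit (tpow X n) ∘ (one_tpow C n ⊗' idm _).
Proof.
pose U : bracketing (fun _ : 'I_n => X) tunit := Unit.
pose T (i : 'I_n) : bracketing (fun _ : 'I_n => X) X := Leaf i.
apply: (@coherent_uniq _ _ _ _ _ _ (Node (xnode (fun _ : 'I_n => U)) (xnode T)) (xnode T)).
- apply: uniq_labels_node => [||a /mem_labels_xnode[]//].
    exact: uniq_labels_xnode.
  by apply: uniq_labels_xnode => // i j a; rewrite !inE => /eqP -> /eqP.
- rewrite tzipE; apply: coh_comp; last exact: coh_bzip.
  by apply: coh_btensm => i; apply: coh_lunit.
- apply: coh_comp; first exact: coh_lunit.
  by apply: coh_tensm; [exact: coh_one_tpow|exact: coh_id].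
Qed.

Lemma lunit_bzip l (X : 'I_l -> C) :
  btensm (fun i => lunit (X i)) ∘ bzip (fun=> tunit) X =
  lunit (btens X) ∘ (one_tpow C l ⊗' idm _).
Proof.
pose env (i : 'I_l) := X i.
pose U : bracketing env tunit := Unit.
pose T (i : 'I_l) : bracketing env (X i) := Leaf i.
apply: (@coherent_uniq _ _ _ _ _ _ (Node (xnode (fun _ : 'I_l => U)) (bnode T)) (bnode T)).
- apply: uniq_labels_node => [||a /mem_labels_xnode[]//].
    exact: uniq_labels_xnode.
  by apply: uniq_labels_bnode => // i j a; rewrite !inE => /eqP -> /eqP.
- apply: coh_comp; last exact: coh_bzip.
  by apply: coh_btensm => i; apply: coh_lunit.
- apply: coh_comp; first exact: coh_lunit.
  by apply: coh_tensm; [exact: coh_one_tpow|exact: coh_id].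
Qed.

Lemma counit_tens_tzip X n :
  tpowm n (counit_tens X) ∘ tzip Q X n =
  lunit (tpow X n) ∘ (tpow_counit q n ⊗' idm _).
Proof.
rewrite /counit_tens tpowm_comp -compA -tzip_natural compA lunit_tzip.
by rewrite -compA -tensm_comp tpowm_id comp_idl.
Qed.

(* [Hom(P, X^n)] is a natural retract of [Hom(P, (Q ⊗ X)^n)], through
   [blow_up] and [tpowm n (counit_tens X)]. *)
Definition blow_up n (a : mor Q (tpow Q n)) P (s : mor P (Q ⊗ P)) X
    (x : mor P (tpow X n)) : mor P (tpow (Q ⊗ X) n) :=
  locked_with sw_key (tzip Q X n ∘ (a ⊗' x) ∘ s).

Lemma blow_upE n (a : mor Q (tpow Q n)) P (s : mor P (Q ⊗ P)) X x :
  blow_up a s x = tzip Q X n ∘ (a ⊗' x) ∘ s.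
Proof. by rewrite /blow_up unlock. Qed.

Section BlowUp.
Variables (n : nat) (a : mor Q (tpow Q n)).
Hypothesis Ea : tpow_counit q n ∘ a = q.
Hypothesis Ha : forall s : 'S_n, braid Q s ∘ a = a.
Variables (P : C) (s : mor P (Q ⊗ P)).
Hypothesis Es : counit_tens P ∘ s = idm P.

Lemma blow_upK X (x : mor P (tpow X n)) :
  tpowm n (counit_tens X) ∘ blow_up a s x = x.
Proof.
rewrite blow_upE !compA counit_tens_tzip -(compA (lunit _)) -tensm_comp Ea comp_idl.
by rewrite -[q ⊗' x]tensm_rl compA lunit_natural -!compA [lunit _ ∘ _]compA Es comp_idr.
Qed.

Lemma blow_up_natural X Y (f : mor X Y) (x : mor P (tpow X n)) :
  blow_up a s (tpowm n f ∘ x) = tpowm n (idm Q ⊗' f) ∘ blow_up a s x.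
Proof.
rewrite !blow_upE !compA -tzip_natural tpowm_id.
by rewrite (compE _ (esym (tensm_comp _ _ _ _))) comp_idl.
Qed.

Lemma blow_up_braid X (t : 'S_n) (x : mor P (tpow X n)) :
  blow_up a s (braid X t ∘ x) = braid (Q ⊗ X) t ∘ blow_up a s x.
Proof.
rewrite !blow_upE !compA -tzip_braid.
by rewrite (compE _ (esym (tensm_comp _ _ _ _))) Ha.
Qed.

Lemma blow_up_linear X c (x y : mor P (tpow X n)) :
  blow_up a s (c *: x + y) = c *: blow_up a s x + blow_up a s y.
Proof.
by rewrite !blow_upE tensmDr tensmZr compDr compZr compDl compZl.
Qed.

End BlowUp.

Lemma comult_tens_exists P : projective P -> exists s, counit_tens P ∘ s = idm P.
Proof. by move=> pP; apply: pP; apply: counit_tens_is_epi. Qed.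

Lemma equivariant_section_exists P l (lambda : 'I_l -> nat) (Y Z : 'I_l -> C)
    (e : forall i, mor (Y i) (Z i)) :
  (forall n, invariant_lift q n) -> projective P -> (forall i, epi (e i)) ->
  has_equivariant_section P lambda e.
Proof.
move=> lift_q pP epi_e.
have [a [Ea Ha]] : exists a : forall n, mor Q (tpow Q n),
    (forall n, tpow_counit q n ∘ a n = q) /\
    forall n (s : 'S_n), braid Q s ∘ a n = a n.
  have a n := cid2 (lift_q n).
  by exists (fun n => s2val (a n)); split=> n; case: (a n).
have epi_ql : epi (tpow_counit q l).
  by apply: epi_comp; [exact/iso_epi/one_tpow_iso|apply: btensm_is_epi].
have [s Es] : exists s, lunit P ∘ (tpow_counit q l ⊗' idm P) ∘ s = idm P.
  apply: pP; apply: epi_comp; first exact/iso_epi/lunit_iso.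
  exact: tensr_epi.
have [t Et] : exists t : forall i, mor (Q ⊗ Z i) (Q ⊗ Y i),
    forall i, (idm Q ⊗' e i) ∘ t i = idm _.
  have t i : {t : mor (Q ⊗ Z i) (Q ⊗ Y i) | (idm Q ⊗' e i) ∘ t = idm _}.
    by apply: cid; apply: (projective_tensr (X := Z i) pQ); apply: tensl_epi.
  by exists (fun i => projT1 (t i)) => i; case: (t i).
(* The blow-up for several blocks: [s] provides one copy of [Q] per block, and [a (lambda i)]
   spreads it over the factors of that block. *)
pose J (X : 'I_l -> C) (x : mor P (btens (fun i => tpow (X i) (lambda i)))) :
    mor P (btens (fun i => tpow (Q ⊗ X i) (lambda i))) :=
  btensm (fun i => tzip Q (X i) (lambda i)) ∘ bzip _ _ ∘
  (btensm (fun i => a (lambda i)) ⊗' x) ∘ s.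
pose K (X : 'I_l -> C) := btensm (fun i => tpowm (lambda i) (counit_tens (X i))).
have KJ (X : 'I_l -> C) x : K X ∘ J X x = x.
  rewrite /K /J !compA -btensm_comp.
  rewrite (eq_btensm (fun i => counit_tens_tzip (X i) (lambda i))) btensm_comp.
  rewrite (compE _ (esym (bzip_natural _ _))) !compA lunit_bzip.
  rewrite (compE _ (esym (tensm_comp _ _ _ _))) btensm_id comp_idl -btensm_comp.
  rewrite (eq_btensm (g := fun=> q)) // (compE _ (esym (tensm_comp _ _ _ _))) comp_idl.
  rewrite -[(_ ∘ _) ⊗' x]tensm_rl compA lunit_natural -!compA.
  by rewrite [lunit P ∘ _]compA Es comp_idr.
have Jbraid (X : 'I_l -> C) (u : forall i, 'S_(lambda i)) x :
    J X (btensm (fun i => braid (X i) (u i)) ∘ x) =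
    btensm (fun i => braid (Q ⊗ X i) (u i)) ∘ J X x.
  rewrite /J !compA -btensm_comp -(eq_btensm (fun i => tzip_braid Q (X i) (u i))).
  rewrite btensm_comp (compE _ (esym (bzip_natural _ _))) !compA.
  rewrite (compE _ (esym (tensm_comp _ _ _ _))) -btensm_comp.
  by rewrite (eq_btensm (fun i => Ha (lambda i) (u i))).
have lJ (X : 'I_l -> C) : linear (J X).
  by move=> c x y; rewrite /J tensmDr tensmZr compDr compZr compDl compZl.
clearbody J.
(* After blowing up, each epimorphism is tensored with [Q] and has the section [t i]; [K] then
   returns to the original powers. *)
pose sec x := K Y ∘ (btensm (fun i => tpowm (lambda i) (t i)) ∘ J Z x).
have lsec : linear sec.
  by move=> c x y; rewrite /sec lJ !compDr !compZr.
exists (linear_of lsec); split=> [f|u f] /=; rewrite /sec.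
  rewrite !compA; have -> : btensm (fun i => tpowm (lambda i) (e i)) ∘ K Y =
     K Z ∘ btensm (fun i => tpowm (lambda i) (idm Q ⊗' e i)).
    rewrite /K -!btensm_comp; apply: eq_btensm => i.
    by rewrite -!tpowm_comp counit_tens_natural.
  have E : btensm (fun i => tpowm (lambda i) (idm Q ⊗' e i)) ∘
      btensm (fun i => tpowm (lambda i) (t i)) = idm _.
    by apply: btensm_epi => i; rewrite -tpowm_comp Et tpowm_id.
  by rewrite (compE _ E) comp_idr KJ.
rewrite Jbraid !compA; congr (_ ∘ _); rewrite /K -!btensm_comp.
by apply: eq_btensm => i; rewrite -compA -braid_tpowm !compA -braid_tpowm.
Qed.

End NaturalRetraction.

Lemma section_invariant_lift (k : fieldType) (C : tensor_category k) (n : nat)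
    (Q : C) (q : mor Q tunit) :
  has_equivariant_section Q (fun _ : 'I_1 => n) (fun _ : 'I_1 => q) ->
  invariant_lift q n.
Proof.
move=> [sec [secK sec_braid]].
(* [btens] of a single block still ends with a factor 1, hence the [runit]. *)
have [o [oK Ko]] : is_iso (one_tpow C n ∘ runit (tpow (tunit : C) n)).
  by apply: iso_comp; [exact: one_tpow_iso|exact: runit_iso].
exists (runit (tpow Q n) ∘ sec (o ∘ q)).
  rewrite /tpow_counit !compA -(compA (one_tpow C n)) -runit_natural compA.
  by rewrite -(compA _ (tpowm n q ⊗' _)) [_ ∘ sec _]secK compA Ko comp_idl.
move=> s; rewrite compA -runit_natural -compA; congr (_ ∘ _).
have /= <- := sec_braid (fun=> s) (o ∘ q); congr (sec _).
by rewrite braid_tunit tensm_id comp_idl.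
Qed.

(** * The cyclic group *)

Section Cyclic.
Variables (k : fieldType) (C : linear_category k) (T : C) (s : mor T T).

Definition opow n (f : mor T T) : mor T T :=
  locked_with sw_key (iter n (comp f) (idm T)).

Lemma opowE n f : opow n f = iter n (comp f) (idm T).
Proof. by rewrite /opow unlock. Qed.
Lemma opow0 f : opow 0 f = idm T. Proof. by rewrite opowE. Qed.
Lemma opowS n f : opow n.+1 f = f ∘ opow n f. Proof. by rewrite !opowE. Qed.
Lemma opow1 f : opow 1 f = f. Proof. by rewrite opowS opow0 comp_idr. Qed.

Lemma opow_comm n f h : f ∘ h = h ∘ f -> opow n f ∘ h = h ∘ opow n f.
Proof.
move=> E; elim: n => [|n IH]; first by rewrite opow0 comp_idl comp_idr.
by rewrite opowS -compA IH !compA E.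
Qed.

Lemma opowSr n f : opow n.+1 f = opow n f ∘ f.
Proof. by rewrite opowS opow_comm. Qed.

Lemma opow_add m n f : opow (m + n) f = opow m f ∘ opow n f.
Proof. by elim: m => [|m IH]; rewrite ?opow0 ?comp_idl // addSn !opowS IH compA. Qed.

Variable p : nat.
Hypotheses (chp : p \in [pchar k]) (sp : opow p s = idm T).

Definition norm : mor T T := \sum_(i < p) opow i s.

(* With h_j = \sum_i 'C(i, j) s^i one has h_0 = norm and, as p divides
   'C(p, j), s h_j = - (s - 1) h_(j+1) for j + 1 < p. *)
Lemma norm_opow j : (j < p)%N ->
  exists2 w, norm = opow j (s - idm T) ∘ w & w ∘ s = s ∘ w.
Proof.
have p0 : (0 < p)%N by apply/prime_gt0/pcharf_prime/chp.
pose h j := \sum_(i < p) ('C(i, j)%:R : k) *: opow i s.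
have hs i : h i ∘ s = s ∘ h i.
  rewrite /h comp_suml comp_sumr; apply: eq_bigr => l _.
  by rewrite compZl compZr opow_comm.
have gs : (s - idm T) ∘ s = s ∘ (s - idm T) by rewrite compBl compBr comp_idl comp_idr.
pose s' := opow p.-1 s.
have s's : s' ∘ s = idm T by rewrite -opowSr prednK.
have ss' : s ∘ s' = idm T by rewrite -opowS prednK.
have s'g : s' ∘ (s - idm T) = (s - idm T) ∘ s' by apply: opow_comm; rewrite gs.
have step i : (i.+1 < p)%N -> h i = - ((s - idm T) ∘ (s' ∘ h i.+1)).
  move=> lt_ip.
  suff E : s ∘ h i = - ((s - idm T) ∘ h i.+1).
    transitivity (s' ∘ (s ∘ h i)); first by rewrite compA s's comp_idl.
    by rewrite E compNr !compA s'g.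
  rewrite compBl comp_idl opprB.
  have -> : s ∘ h i = \sum_(l < p) ('C(l, i)%:R : k) *: opow l.+1 s.
    by rewrite comp_sumr; apply: eq_bigr => l _; rewrite compZr opowS.
  have -> : s ∘ h i.+1 = \sum_(l < p) ('C(l, i.+1)%:R : k) *: opow l.+1 s.
    by rewrite comp_sumr; apply: eq_bigr => l _; rewrite compZr opowS.
  apply: (canRL (addrK _)); rewrite -big_split /=.
  under eq_bigr => l _ do rewrite -scalerDl -natrD addnC -binS.
  have -> : h i.+1 = \sum_(0 <= l < p) ('C(l, i.+1)%:R : k) *: opow l s by rewrite big_mkord.
  have -> : \sum_(0 <= l < p) ('C(l, i.+1)%:R : k) *: opow l s =
      \sum_(0 <= l < p.+1) ('C(l, i.+1)%:R : k) *: opow l s.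
    rewrite [RHS]big_nat_recr //= (_ : 'C(p, i.+1)%:R = 0) ?scale0r ?addr0 //.
    by apply/eqP; rewrite -(dvdn_pcharf chp) prime_dvd_bin // (pcharf_prime chp).
  by rewrite big_nat_recl //= bin0n scale0r add0r big_mkord.
have -> : norm = h 0%N by apply: eq_bigr => i _; rewrite bin0 scale1r.
elim: j => [|j IH] lt_jp; first by exists (h 0%N); rewrite // opow0 comp_idl.
suff [u [uE us ug]] : exists u, [/\ h 0%N = opow j.+1 (s - idm T) ∘ (u ∘ h j.+1),
    u ∘ s = s ∘ u & u ∘ (s - idm T) = (s - idm T) ∘ u].
  by exists (u ∘ h j.+1) => //; rewrite -compA hs !compA us.
elim: j lt_jp {IH} => [|j IH] lt_jp.
  exists (- s'); split; rewrite ?compNl ?compNr ?s's ?ss' //.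
    by rewrite opow1 step // compNl compNr.
  by rewrite s'g.
have [u [uE us ug]] := IH (ltnW lt_jp); exists (- (u ∘ s')); split.
- rewrite uE step // !compNl !compNr (opowSr j.+1) -!compA; by rewrite [u ∘ _]compA ug !compA.
- by rewrite compNl compNr -compA s's compA -us -compA ss'.
- rewrite compNl compNr -compA s'g; congr (- _).
  by rewrite !compA ug.
Qed.

End Cyclic.

Definition cycle_perm p : 'S_p := perm (@ordS_inj p).

Lemma cycle_permE p i : cycle_perm p i = ordS i. Proof. by rewrite permE. Qed.

Lemma val_cycle_permX p j (i : 'I_p) : (cycle_perm p ^+ j)%g i = ((i + j) %% p)%N :> nat.
Proof.
elim: j => [|j IH]; first by rewrite expg0 perm1 addn0 modn_small.
by rewrite expgSr permM cycle_permE /= IH -[in LHS]addn1 modnDml addn1 addnS.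
Qed.

Lemma cycle_permX p : (cycle_perm p ^+ p)%g = 1%g.
Proof.
by apply/permP => i; apply: val_inj; rewrite /= val_cycle_permX perm1 modnDr modn_small.
Qed.

(** * The functors Fr_i, tested on projective objects *)

Section Frobenius.
Variables (k : fieldType) (C : tensor_category k) (p : nat).
Hypothesis hC : has_projective_objects C.
Implicit Types (A B D I K N P S T U V W X Y Z : C).

Let abC := tc_abelian C.

Local Notation cyc X := (braid X (cycle_perm p)).
Local Notation g X := (cycle_minus_one p X).

Lemma cycle_minus_oneE X : g X = cyc X - idm _.
Proof. by rewrite /cycle_minus_one; congr (braid X _ - _); apply: funext => i; rewrite cycle_permE. Qed.

Lemma opow_braid X n (s : 'S_n) j : opow j (braid X s) = braid X (s ^+ j)%g.
Proof.
elim: j => [|j IH]; first by rewrite opow0 expg0 braid1.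
by rewrite opowS IH -braidM expgSr.
Qed.

Lemma tpowm_cycle_minus_one X Y (f : mor X Y) : g Y ∘ tpowm p f = tpowm p f ∘ g X.
Proof. by rewrite !cycle_minus_oneE compBl compBr comp_idl comp_idr braid_tpowm. Qed.

Lemma tpowm_opow X Y (f : mor X Y) j : opow j (g Y) ∘ tpowm p f = tpowm p f ∘ opow j (g X).
Proof.
elim: j => [|j IH]; first by rewrite !opow0 comp_idl comp_idr.
by rewrite !opowS -compA IH !compA tpowm_cycle_minus_one.
Qed.

Lemma equivariant_opow X Y P (F : mor P (tpow X p) -> mor P (tpow Y p)) :
  linear F -> (forall x, F (cyc X ∘ x) = cyc Y ∘ F x) ->
  forall j x, F (opow j (g X) ∘ x) = opow j (g Y) ∘ F x.
Proof.
move=> lF cF; have gF x : F (g X ∘ x) = g Y ∘ F x.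
  rewrite !cycle_minus_oneE !compBl !comp_idl -cF addrC -scaleN1r lF.
  by rewrite scaleN1r addrC.
elim=> [|j IH] x; first by rewrite !opow0 !comp_idl.
by rewrite !opowS -!compA gF IH.
Qed.

Lemma kci_mono j X N (c : mor N (tpow X p)) : is_ker_cap_im j c -> mono c.
Proof.
move=> [K [I [a [b [ka _ [[u Eu] [[v Ev] U]]]]]]] W x y E.
have [w [_ wU]] : exists! w, c ∘ w = a ∘ (u ∘ x).
  by apply: (U _ _ (v ∘ x)); rewrite !compA Eu Ev.
by rewrite -(wU x) ?(wU y) // ?compA ?Eu.
Qed.

Lemma kci_exists j X : exists N (c : mor N (tpow X p)), is_ker_cap_im j c.
Proof.
have [K [a ka]] := abelian_kernel abC (g X).
have [I [b [e [mb ee E]]]] := image_exists abC (opow j (g X)).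
have [N [c [_ ic]]] := intersection_exists abC (kernel_mono ka) mb.
exists N, c, K, I, a, b; split=> //; split=> //; exists e => //.
by rewrite E opowE.
Qed.

(** With [kci_im], this identifies Hom(P, N), for [P] projective, with the invariants in Hom(P, X^p)
    of the form g^j y. *)
Lemma kci_factor j X N (c : mor N (tpow X p)) W (x : mor W (tpow X p)) y :
  is_ker_cap_im j c -> g X ∘ x = 0 -> opow j (g X) ∘ y = x -> exists u, c ∘ u = x.
Proof.
move=> [K [I [a [b [ka [_ [e _ Ee]] [_ [_ U]]]]]]] gx Ex.
have [u Eu] := kernel_factor ka gx.
have [w [Ew _]] : exists! w, c ∘ w = a ∘ u.
  by apply: (U _ _ (e ∘ y)); rewrite compA Ee Eu -opowE Ex.
by exists w; rewrite Ew.
Qed.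

Lemma kci_ker j X N (c : mor N (tpow X p)) : is_ker_cap_im j c -> g X ∘ c = 0.
Proof.
by move=> [K [I [a [b [ka _ [[u <-] _]]]]]]; rewrite compA ka.1 comp0l.
Qed.

Lemma kci_im j X N (c : mor N (tpow X p)) P (x : mor P N) :
  is_ker_cap_im j c -> projective P -> exists y, opow j (g X) ∘ y = c ∘ x.
Proof.
move=> [K [I [a [b [_ [_ [e ee Ee]] [_ [[v Ev] _]]]]]]] pP.
have [y Ey] := pP _ _ e (v ∘ x) ee; exists y.
by rewrite opowE -Ee -compA Ey compA Ev.
Qed.

(** Factorization through a mono may be checked on a projective cover of the source; this transfers
    elementwise arguments to arbitrary [W]. *)
Lemma factor_through_mono N T W P (c : mor N T) (h : mor W T) (r : mor P W) u' :
  mono c -> epi r -> h ∘ r = c ∘ u' -> exists u, c ∘ u = h.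
Proof.
move=> mc er E; have [K [j [kj cj]]] := epi_short_exact abC er.
have [u Eu] : exists u, u ∘ r = u'.
  apply: (cokernel_factor cj); apply: (mono_eq0 mc).
  by rewrite compA -E -compA kj.1 comp0r.
by exists u; apply: er; rewrite -compA Eu E.
Qed.

Lemma kci_map j X Y (f : mor X Y) N N' (c : mor N (tpow X p)) (c' : mor N' (tpow Y p)) :
  is_ker_cap_im j c -> is_ker_cap_im j c' -> exists u, c' ∘ u = tpowm p f ∘ c.
Proof.
move=> kc kc'; have [P [r [pP er]]] := enough_projectives hC N.
have [y Ey] := kci_im r kc pP.
have [u' Eu'] : exists u', c' ∘ u' = tpowm p f ∘ c ∘ r.
  apply: (kci_factor (y := tpowm p f ∘ y) kc').
    by rewrite !compA tpowm_cycle_minus_one -(compA (tpowm p f)) (kci_ker kc) comp0r comp0l.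
  by rewrite compA tpowm_opow -!compA Ey.
exact: (factor_through_mono (kci_mono kc') er (esym Eu')).
Qed.

Lemma frob_exists i X : inhabited (frob p i X).
Proof.
have [N [c kc]] := kci_exists i.-1 X; have [D [d kd]] := kci_exists i X.
have [P [r [pP er]]] := enough_projectives hC D.
have [u' Eu'] : exists u', c ∘ u' = d ∘ r.
  have [y Ey] := kci_im r kd pP.
  have gd : g X ∘ (d ∘ r) = 0 by rewrite compA (kci_ker kd) comp0l.
  (* For [i] = 0 the predecessor is again 0; otherwise g^i y is g^(i-1) applied to g y. *)
  case: i kc kd Ey => [|i] kc kd Ey; first exact: kci_factor kc gd Ey.
  by apply: (kci_factor (y := g X ∘ y) kc gd); rewrite -Ey compA -opowSr.
have [j Ej] := factor_through_mono (kci_mono kc) er (esym Eu').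
have [F [pi kpi]] := abelian_cokernel abC j.
apply: (inhabits (@Frob k C p i X F N c pi kc _)).
by exists D, d, j.
Qed.

Lemma frob_map_exists i X Y (f : mor X Y) (FX : frob p i X) (FY : frob p i Y) :
  exists phi : mor FX FY, is_frob_map f phi.
Proof.
have [u Eu] := kci_map f (frob_incP FX) (frob_incP FY).
have [D [d [j [kd Ed kj]]]] := frob_projP FX.
have [D' [d' [j' [kd' Ed' kj']]]] := frob_projP FY.
have [w Ew] := kci_map f kd kd'.
have Euj : u ∘ j = j' ∘ w.
  by apply: (kci_mono (frob_incP FY)); rewrite !compA Eu -compA Ed Ed' Ew.
have [phi Ephi] : exists phi, phi ∘ frob_proj FX = frob_proj FY ∘ u.
  by apply: (cokernel_factor kj); rewrite -compA Euj compA kj'.1 comp0l.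
by exists phi, u.
Qed.

Lemma frob_proj_epi i X (FX : frob p i X) : epi (frob_proj FX).
Proof. by have [D [d [j [_ _ kj]]]] := frob_projP FX; apply: cokernel_epi kj. Qed.

(** Hom(P, Fr_i(X)) is the quotient of invariants by the image of g^i, computed in Hom(P, X^p). *)
Lemma frob_proj_eq0 i X (FX : frob p i X) P (x : mor P (frob_num FX)) : projective P ->
  frob_proj FX ∘ x = 0 <-> exists y, opow i (g X) ∘ y = frob_inc FX ∘ x.
Proof.
move=> pP; have [D [d [j [kd Ed kj]]]] := frob_projP FX; split.
  move=> /(projective_factor abC pP kj)[x' <-].
  by have [y Ey] := kci_im x' kd pP; exists y; rewrite Ey -Ed !compA.
move=> [y Ey]; have [|u Eu] := kci_factor kd _ Ey.
  by rewrite compA (kci_ker (frob_incP FX)) comp0l.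
have -> : x = j ∘ u by apply: (kci_mono (frob_incP FX)); rewrite compA Ed.
by rewrite compA kj.1 comp0l.
Qed.

Lemma frob_num_lift i X (FX : frob p i X) P (x : mor P (tpow X p)) y :
  g X ∘ x = 0 -> opow i.-1 (g X) ∘ y = x -> exists u, frob_inc FX ∘ u = x.
Proof. exact: kci_factor (frob_incP FX). Qed.

Section Exactness.
Variables (X Y Z : C) (f : mor X Y) (h : mor Y Z) (i : nat).
Hypothesis hf0 : h ∘ f = 0.
Hypothesis p0 : (0 < p)%N.

Hypothesis lifting : forall P, projective P ->
  exists (rho : mor P (tpow Y p) -> mor P (tpow X p))
         (sec : mor P (tpow Z p) -> mor P (tpow Y p)),
    [/\ linear rho, linear sec,
        (forall x, rho (cyc Y ∘ x) = cyc X ∘ rho x),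
        (forall x, sec (cyc Z ∘ x) = cyc Y ∘ sec x) &
     [/\ forall x, rho (tpowm p f ∘ x) = x, forall x, tpowm p h ∘ sec x = x &
         forall y z, g Y ∘ y = 0 -> tpowm p h ∘ y = opow i (g Z) ∘ z ->
         exists w, y - tpowm p f ∘ rho y = opow i (g Y) ∘ w]].

(** In [lifting], [rho] yields that [phi] is mono, [sec] that [psi] is epi, and the last clause
    exactness in the middle: modulo the image of g^i, [y] comes from X^p. *)
Lemma frob_short_exact (FX : frob p i X) (FY : frob p i Y) (FZ : frob p i Z) :
  exists (phi : mor FX FY) (psi : mor FY FZ),
    [/\ is_frob_map f phi, is_frob_map h psi & short_exact phi psi].
Proof.
have [phi mphi] := frob_map_exists f FX FY; have [psi mpsi] := frob_map_exists h FY FZ.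
exists phi, psi; split=> //.
have [u Eu Ephi] := mphi; have [v Ev Epsi] := mpsi.
have lift_proj P (F : C) W (e : mor W F) (x : mor P F) : projective P -> epi e ->
  exists y, e ∘ y = x by move=> pP ee; apply: pP.
have mono_phi : mono phi.
  apply: mono0 => W z phz; have [P [r [pP er]]] := enough_projectives hC W.
  have [x Ex] := lift_proj _ _ _ _ (z ∘ r) pP (@frob_proj_epi _ _ FX).
  apply: (epi_eq0 er); rewrite -Ex; apply/frob_proj_eq0 => //.
  have : frob_proj FY ∘ (u ∘ x) = 0 by rewrite compA -Ephi -compA Ex compA phz comp0l.
  move=> /(frob_proj_eq0 _ pP)[y Ey]; have [rho [sec [lr _ cr _ [rK _ _]]]] := lifting pP.
  exists (rho y); rewrite -(equivariant_opow lr cr) Ey compA Eu -compA rK //.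
have epi_psi : epi psi.
  have [P [r [pP er]]] := enough_projectives hC FZ.
  have [x Ex] := lift_proj _ _ _ _ r pP (@frob_proj_epi _ _ FZ).
  have [rho [sec [_ ls _ cs [_ sK _]]]] := lifting pP.
  have [z Ez] := kci_im x (frob_incP FZ) pP.
  have [y Ey] : exists y, frob_inc FY ∘ y = sec (frob_inc FZ ∘ x).
    apply: (@frob_num_lift _ _ _ _ _ (sec z)).
      have := equivariant_opow ls cs 1 (frob_inc FZ ∘ x); rewrite !opow1 => <-.
      rewrite compA (kci_ker (frob_incP FZ)) comp0l.
      by have := ls (-1) 0 0; rewrite scaler0 addr0 scaleN1r addNr.
    by rewrite -(equivariant_opow ls cs) Ez.
  apply: (@epi_cancel _ _ _ _ _ psi (frob_proj FY ∘ y)).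
  suff -> : psi ∘ (frob_proj FY ∘ y) = r by [].
  rewrite compA Epsi -compA -Ex; congr (_ ∘ _).
  by apply: (kci_mono (frob_incP FZ)); rewrite compA Ev -compA Ey sK.
have psiphi : psi ∘ phi = 0.
  apply: (epi_eq0 (@frob_proj_epi _ _ FX)); rewrite -compA Ephi compA Epsi -compA.
  suff -> : v ∘ u = 0 by rewrite comp0r.
  apply: (mono_eq0 (kci_mono (frob_incP FZ))).
  rewrite compA Ev -compA Eu compA -tpowm_comp hf0.
  by rewrite [tpowm p 0](@btensm_eq0 _ _ _ _ _ _ (Ordinal p0)) ?comp0l.
have ker_phi : is_kernel psi phi.
  apply: is_kernelP => // W z psz; have [P [r [pP er]]] := enough_projectives hC W.
  have [y Ey] := lift_proj _ _ _ _ (z ∘ r) pP (@frob_proj_epi _ _ FY).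
  have [rho [sec [lr _ cr _ [_ _ mid]]]] := lifting pP.
  set y1 := frob_inc FY ∘ y.
  have gy1 : g Y ∘ y1 = 0 by rewrite compA (kci_ker (frob_incP FY)) comp0l.
  have [a Ea] := kci_im y (frob_incP FY) pP.
  have : frob_proj FZ ∘ (v ∘ y) = 0 by rewrite compA -Epsi -compA Ey compA psz comp0l.
  move=> /(frob_proj_eq0 _ pP)[b Eb].
  have [|w Ew] := mid y1 b gy1; first by rewrite Eb compA Ev -compA.
  have [x Ex] : exists x, frob_inc FX ∘ x = rho y1.
    apply: (@frob_num_lift _ _ _ _ _ (rho a)).
      have := equivariant_opow lr cr 1 y1; rewrite !opow1 => <-; rewrite gy1.
      by have := lr (-1) 0 0; rewrite scaler0 addr0 scaleN1r addNr.
    by rewrite -(equivariant_opow lr cr) Ea.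
  have E : frob_proj FY ∘ (y - u ∘ x) = 0.
    apply/frob_proj_eq0 => //; exists w.
    by rewrite compBr [frob_inc FY ∘ (u ∘ x)]compA Eu -compA Ex -Ew.
  apply: (factor_through_mono (u' := frob_proj FX ∘ x) mono_phi er).
  rewrite -Ey compA Ephi; apply/eqP; rewrite -subr_eq0 -compA -compBr.
  by rewrite E.
by split=> //; apply: epi_cokernel.
Qed.

End Exactness.
End Frobenius.

(** * Expansion of the tensor power of a sum *)

Section Words.
Variables (k : fieldType) (C : sym_monoidal_category k).
Implicit Types (X Y : C).

Definition word_mor n X Y (a b : mor X Y) (c : {ffun 'I_n -> bool}) :
    mor (tpow X n) (tpow Y n) :=
  btensm (fun i => if c i then a else b).

Lemma tpowm_add n X Y (a b : mor X Y) :
  tpowm n (a + b) = \sum_(c : {ffun 'I_n -> bool}) word_mor a b c.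
Proof.
elim: n => [|n IH].
  rewrite (big_pred1 [ffun=> false]) // => c; symmetry; apply/eqP/ffunP => -[] //.
pose h (dc : bool * {ffun 'I_n -> bool}) : {ffun 'I_n.+1 -> bool} :=
  [ffun i => if unlift ord0 i is Some j then dc.2 j else dc.1].
pose h' (c : {ffun 'I_n.+1 -> bool}) := (c ord0, [ffun j => c (lift ord0 j)]).
rewrite (reindex h) /=; last first.
  exists h' => [[d c] _|c _].
    by congr pair; rewrite ?ffunE ?unlift_none //; apply/ffunP => j; rewrite !ffunE liftK.
  by apply/ffunP => i; rewrite ffunE; case: unliftP => [j|] -> /=; rewrite ?ffunE.
rewrite -(pair_bigA _ (fun d c => word_mor a b (h (d, c)))) big_bool /=.
have E d c : word_mor a b (h (d, c)) = (if d then a else b) ⊗' word_mor a b c.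
  rewrite /word_mor /= ffunE unlift_none; congr (_ ⊗' _).
  by apply: eq_btensm => i; rewrite ffunE liftK.
under eq_bigr => c _ do rewrite E.
under [X in _ = _ + X]eq_bigr => c _ do rewrite E.
by rewrite -!tensm_sumr -IH -tensmDl.
Qed.

Lemma word_mor_const n X Y (a b : mor X Y) (d : bool) :
  word_mor a b [ffun _ : 'I_n => d] = tpowm n (if d then a else b).
Proof. by apply: eq_btensm => i; rewrite ffunE. Qed.

Lemma braid_word n X Y (a b : mor X Y) (s : 'S_n) (c : {ffun 'I_n -> bool}) :
  braid Y s ∘ word_mor a b [ffun i => c (s i)] = word_mor a b c ∘ braid X s.
Proof.
rewrite -(braid_natural_family _ (@perm_inj _ s)); congr (_ ∘ _).
by apply: eq_btensm => i; rewrite ffunE.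
Qed.

End Words.

Section CyclicWords.
Variables (k : fieldType) (C : tensor_category k) (p : nat).
Hypothesis chp : p \in [pchar k].
Variables (P T U : C) (a b : mor T U).
Local Notation sigma := (cycle_perm p).

Definition weight (c : {ffun 'I_p -> bool}) : nat := #|[pred i | c i]|.

Lemma weight_comp (c : {ffun 'I_p -> bool}) (s : 'S_p) : weight [ffun i => c (s i)] = weight c.
Proof.
rewrite /weight -[RHS](card_imset _ (@perm_inj _ s^-1%g)); apply: eq_card => i.
rewrite !inE ffunE; apply/idP/imsetP => [ci|[j cj ->]]; last by rewrite permKV.
by exists (s i); rewrite ?permK.
Qed.

Definition mixed c := (0 < weight c < p)%N.

Lemma mixedPn c : ~~ mixed c -> c = [ffun=> true] \/ c = [ffun=> false].
Proof.
rewrite /mixed negb_and -leqNgt leqn0 -leqNgt => /orP[w0|wp].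
  right; apply/ffunP => i; rewrite ffunE.
  by have /eqP/card0_eq/(_ i) := w0; rewrite !inE.
left; apply/ffunP => i; rewrite ffunE; have := cardC [pred i | c i].
rewrite card_ord => E; have /eqP : #|[predC [pred i | c i]]| == 0%N.
  rewrite -leqn0 -(leq_add2l (weight c)) addn0; apply: leq_trans wp.
  by rewrite (eqP (introT eqP E)).
by move=> /card0_eq/(_ i); rewrite !inE => /negbFE.
Qed.

(* A mixed word of weight w is the w-th part of the sum, over the cyclic
   shifts that put one of its letters [a] first, of the shifted words. *)
Lemma mixed_words_norm (y : mor P (tpow T p)) : braid T sigma ∘ y = y ->
  exists z, \sum_(c | mixed c) word_mor a b c ∘ y = norm (braid U sigma) p ∘ z.
Proof.
move=> Ey; have pp := pcharf_prime chp; have p0 := prime_gt0 pp.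
have Eyj j : braid T (sigma ^+ j)%g ∘ y = y.
  elim: j => [|j IH]; first by rewrite expg0 braid1 comp_idl.
  by rewrite expgSr braidM -compA IH Ey.
pose o := Ordinal p0.
have oj (j : 'I_p) : (sigma ^+ j)%g o = j.
  by apply: val_inj; rewrite /= val_cycle_permX add0n modn_small.
exists (\sum_(c | mixed c && c o) ((weight c)%:R^-1 : k) *: (word_mor a b c ∘ y)).
rewrite /norm comp_suml.
have E (j : 'I_p) : opow j (braid U sigma) ∘
    (\sum_(c | mixed c && c o) ((weight c)%:R^-1 : k) *: (word_mor a b c ∘ y)) =
    \sum_(c | mixed c && c j) ((weight c)%:R^-1 : k) *: (word_mor a b c ∘ y).
  rewrite opow_braid comp_sumr; set s := (sigma ^+ j)%g.
  pose h (c : {ffun 'I_p -> bool}) : {ffun 'I_p -> bool} := [ffun i => c (s i)].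
  rewrite (reindex h) /=; last first.
    by exists (fun c => [ffun i => c (s^-1%g i)]) => c _; apply/ffunP => i;
      rewrite !ffunE ?permK ?permKV.
  apply: eq_big => [c|c _]; first by rewrite /mixed weight_comp ffunE oj.
  rewrite weight_comp compZr compA braid_word -compA.
  by rewrite Eyj.
under [RHS]eq_bigr => j _ do rewrite E.
rewrite (exchange_big_dep mixed) /=; last by move=> j c _ /andP[].
apply: eq_bigr => c mc; rewrite (eq_bigl (fun j => c j)) => [|j]; last by rewrite mc.
rewrite sumr_const -scaler_nat scalerA.
rewrite mulfV ?scale1r // -(dvdn_pcharf chp); apply/negP => /dvdn_leq.
by have /andP[w0 wp] := mc; move=> /(_ w0); rewrite leqNgt wp.
Qed.

End CyclicWords.

(** The cycle has order p, and p divides p! exactly once. *)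
Lemma cycle_perm_index (k : fieldType) p : p \in [pchar k] ->
  (#|[set: 'S_p] : <[cycle_perm p]>|%g)%:R != 0 :> k.
Proof.
move=> chp; have pp := pcharf_prime chp.
have oc : #|<[cycle_perm p]>%g| = p.
  have /primeP[_ /(_ #[cycle_perm p]%g)] := pp.
  rewrite order_dvdn cycle_permX eqxx => /(_ isT)/orP[|/eqP//].
  rewrite order_eq1 => /eqP E.
  have /eqP := val_cycle_permX 1 (Ordinal (prime_gt0 pp)).
  by rewrite E expg1n perm1 /= modn_small ?prime_gt1.
have cS : #|[set: 'S_p]| = p`!%N by rewrite -card_Sn cardsT.
rewrite -(dvdn_pcharf chp); apply/negP => dv.
have := Lagrange (subsetT <[cycle_perm p]>%g); rewrite oc /= cS => /(congr1 (logn p)).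
have lp : logn p p`! = 1%N by have := logn_fact_mul 1 pp; rewrite mul1n logn1.
have i0 : (0 < #|[set: 'S_p] : <[cycle_perm p]>|%g)%N by rewrite indexg_gt0.
rewrite lp (lognM _ (prime_gt0 pp) i0) logn_prime // eqxx => -[]; rewrite add0n => l0.
by have := pfactor_dvdn 1 pp i0; rewrite expn1 dv l0.
Qed.

(** * Frobenius-exactness and invariant lifts *)

Section FrobeniusExact.
Variables (k : fieldType) (C : tensor_category k) (p : nat).
Hypotheses (hC : has_projective_objects C) (chp : p \in [pchar k]).
Variables (Q : C) (q : mor Q tunit).
Hypotheses (pQ : projective Q) (eq : epi q).
Implicit Types (A P X Y Z : C).

Let abC := tc_abelian C.
Local Notation cyc X := (braid X (cycle_perm p)).
Local Notation g X := (cycle_minus_one p X).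

Lemma tensl_cokernel A X Y Z (f : mor X Y) (r : mor Y Z) :
  is_cokernel f r -> is_cokernel (idm A ⊗' f) (idm A ⊗' r).
Proof.
move=> kr; have kr' := tensr_cokernel A kr.
apply: is_cokernelP; first exact/tensl_epi/cokernel_epi/kr.
  by rewrite -tensm_idcomp kr.1 tensm0r.
move=> W h hf; have [u Eu] : exists u, u ∘ (r ⊗' idm A) = h ∘ braiding Y A.
  by apply: (cokernel_factor kr'); rewrite -compA braiding_natural compA hf comp0l.
exists (u ∘ braiding A Z).
by rewrite -compA braiding_natural compA Eu -compA braiding_sym comp_idr.
Qed.

Lemma g_eq0 X P (y : mor P (tpow X p)) : g X ∘ y = 0 <-> cyc X ∘ y = y.
Proof.
rewrite cycle_minus_oneE compBl comp_idl; split=> [/eqP|->]; last exact: subrr.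
by rewrite subr_eq0 => /eqP.
Qed.

Lemma norm_in_image j X : (j < p)%N ->
  exists w, norm (cyc X) p = opow j (g X) ∘ w.
Proof.
move=> lt_jp; have [|w Ew _] := @norm_opow k C _ (cyc X) p chp _ j lt_jp.
  by rewrite opow_braid cycle_permX braid1.
by exists w; rewrite Ew -cycle_minus_oneE.
Qed.

Lemma invariant_lift_frobenius_exact : invariant_lift q p -> frobenius_exact C p.
Proof.
move=> [a Ea Ha] i /andP[i0 lt_ip] X Y Z f h [kf ch] FX FY FZ.
have p0 : (0 < p)%N := ltn_trans i0 lt_ip.
apply: (frob_short_exact hC kf.1 p0) => P pP.
have [s Es] := comult_tens_exists eq pP.
have [t Et] := projective_tensr (X := Z) pQ (idm _) (@tensl_epi _ _ Q _ _ h (cokernel_epi ch)).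
have kf' : is_kernel (idm Q ⊗' h) (idm Q ⊗' f).
  apply: (mono_kernel abC); first exact/tensl_mono/kernel_mono/kf.
  exact: tensl_cokernel.
(* Tensored with [Q], the sequence splits: [t] is a section and [r] the matching retraction. *)
have [r Er] : exists r, (idm Q ⊗' f) ∘ r = idm _ - t ∘ (idm Q ⊗' h).
  by apply: (kernel_factor kf'); rewrite compBr compA Et comp_idl comp_idr subrr.
have rf : r ∘ (idm Q ⊗' f) = idm _.
  apply: (kernel_mono kf'); rewrite compA Er compBl -compA kf'.1 comp0r subr0.
  by rewrite comp_idl comp_idr.
pose K V := tpowm p (counit_tens q V).
pose B V (x : mor P (tpow V p)) := blow_up a s x.
have lB V : linear (B V) by move=> c x y; apply: blow_up_linear.
have cB V (u : 'S_p) x : B V (braid V u ∘ x) = braid (Q ⊗ V) u ∘ B V x by apply: blow_up_braid.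
have KB V x : K V ∘ B V x = x by apply: blow_upK.
have nB V W (e : mor V W) x : B W (tpowm p e ∘ x) = tpowm p (idm Q ⊗' e) ∘ B V x.
  exact: blow_up_natural.
have nK V W (e : mor V W) : K W ∘ tpowm p (idm Q ⊗' e) = tpowm p e ∘ K V.
  by rewrite /K -!tpowm_comp counit_tens_natural.
(* A morphism between the objects tensored with [Q] induces an equivariant map on Hom(P, V^p), by
   blowing up and coming back. *)
pose F V W (m : mor (Q ⊗ V) (Q ⊗ W)) x := K W ∘ (tpowm p m ∘ B V x).
have lF V W (m : mor (Q ⊗ V) (Q ⊗ W)) : linear (F V W m).
  by move=> c x y; rewrite /F lB !compDr !compZr.
have cF V W (m : mor (Q ⊗ V) (Q ⊗ W)) x : F V W m (cyc V ∘ x) = cyc W ∘ F V W m x.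
  by rewrite /F cB !compA (compE _ (esym (braid_tpowm _ _))) !compA -braid_tpowm.
have secK x : tpowm p h ∘ F Z Y t x = x.
  by rewrite /F compA -nK (compA (_ ∘ _)) -(compA _ _ (tpowm p t)) -tpowm_comp Et tpowm_id comp_idr KB.
exists (F Y X r), (F Z Y t); split=> //; split=> //.
  by move=> x; rewrite /F nB [tpowm p r ∘ _]compA -tpowm_comp rf tpowm_id comp_idl KB.
move=> y z /g_eq0 cy hy.
have BY : cyc (Q ⊗ Y) ∘ B Y y = B Y y by rewrite -cB cy.
pose b := (idm Q ⊗' f) ∘ r; pose b' := t ∘ (idm Q ⊗' h).
have Eb : b + b' = idm _ by rewrite /b Er subrK.
have [m Em] := mixed_words_norm chp b b' BY.
have [w Ew] := norm_in_image (Q ⊗ Y) lt_ip.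
have E1 : K Y ∘ (tpowm p b ∘ B Y y) = tpowm p f ∘ F Y X r y.
  by rewrite /b tpowm_comp /F !compA nK.
have E2 : K Y ∘ (tpowm p b' ∘ B Y y) = opow i (g Y) ∘ F Z Y t z.
  rewrite -(equivariant_opow (lF _ _ t) (cF _ _ t)) -hy /F nB /b' tpowm_comp.
  by rewrite !compA.
have Ey : y = tpowm p f ∘ F Y X r y + opow i (g Y) ∘ F Z Y t z +
    K Y ∘ (opow i (g (Q ⊗ Y)) ∘ (w ∘ m)).
  rewrite -{1}[y]KB -[B Y y in LHS]comp_idl -tpowm_id -Eb tpowm_add comp_suml.
  have tf : [ffun=> false] != [ffun=> true] :> {ffun 'I_p -> bool}.
    by apply/eqP => /ffunP/(_ (Ordinal p0)); rewrite !ffunE.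
  rewrite (bigD1 [ffun=> true]) //= (bigD1 [ffun=> false]) //= !word_mor_const !compDr.
  rewrite E1 E2 addrA; congr (_ + _ ∘ _).
  rewrite compA -Ew -Em; apply: eq_bigl => c; apply/andP/idP => [[ct cf]|mc].
    by apply/negPn/negP => /mixedPn[] E; [move: ct|move: cf]; rewrite E eqxx.
  split; apply/eqP => E; move: mc; rewrite /mixed /weight E.
    rewrite (eq_card (B := predT)) ?card_ord ?ltnn ?andbF // => j.
    by rewrite !inE ffunE.
  by rewrite eq_card0 // => j; rewrite !inE ffunE.
exists (F Z Y t z + K Y ∘ (w ∘ m)).
apply: (canLR (addrK _)); rewrite {1}Ey -addrA addrC compDr; congr (_ + _ + _).
by rewrite !compA tpowm_opow.
Qed.

Lemma frobenius_exact_invariant_lift : frobenius_exact C p -> invariant_lift q p.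
Proof.
move=> fe; have pp := pcharf_prime chp.
have [o [oK Ko]] := @one_tpow_iso _ C p.
have [K [j [kj cj]]] := epi_short_exact abC eq.
have [FK] := frob_exists p hC 1 K; have [FQ] := frob_exists p hC 1 Q.
have [F1] := frob_exists p hC 1 tunit.
have [phi [psi [_ [v Ev Epsi] [_ cpsi]]]] := fe 1%N (prime_gt1 pp) _ _ _ j q (conj kj cj) FK FQ F1.
(* As C_p acts trivially on powers of 1, nothing is divided out in Fr_1(1), so a lift modulo the
   image of g is a true lift. *)
have g1 : g (tunit : C) = 0 by rewrite cycle_minus_oneE braid_tunit subrr.
have [x Ex] : exists x, frob_inc F1 ∘ x = o ∘ q.
  by apply: (@frob_num_lift _ _ _ _ _ _ _ _ (o ∘ q)); rewrite ?g1 ?comp0l // opow0 comp_idl.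
have [y Ey] := pQ (frob_proj F1 ∘ x) (cokernel_epi cpsi).
have [y' Ey'] := pQ y (@frob_proj_epi _ _ _ _ _ FQ).
have E : frob_proj F1 ∘ (v ∘ y' - x) = 0.
  by rewrite compBr compA -Epsi -compA Ey' Ey subrr.
have {E} /(frob_proj_eq0 _ pQ)[z Ez] := E.
have vy : frob_inc F1 ∘ (v ∘ y') = o ∘ q.
  apply/eqP; rewrite -subr_eq0 -Ex -compBr -Ez opow1 g1 comp0l.
  by [].
pose a := frob_inc FQ ∘ y'.
have ga : cyc Q ∘ a = a.
  by apply/g_eq0; rewrite compA (kci_ker (frob_incP FQ)) comp0l.
have Ea : tpow_counit q p ∘ a = q.
  by rewrite /tpow_counit -compA [tpowm p q ∘ _]compA -Ev -compA vy compA Ko comp_idl.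
apply: (@invariant_lift_index _ _ _ _ _ <[cycle_perm p]>%G a Ea).
  move=> _ /cycleP[l ->]; elim: l => [|l IH]; first by rewrite expg0 braid1 comp_idl.
  by rewrite expgSr braidM -compA IH ga.
exact: cycle_perm_index.
Qed.

End FrobeniusExact.

(** * Freeness over the cyclic group *)

Section FreeModules.
Variables (k : fieldType) (p : nat).
Hypothesis chp : p \in [pchar k].

(** The Frobenius identity is taken in [{poly k}], which is commutative, and evaluated at [A]. *)
Lemma mx_frobenius n (A : 'M[k]_n) : A ^+ p = 1 -> (A - 1) ^+ p = 0.
Proof.
case: n A => [|n] A Ap; first exact: thinmx0.
have chX : p \in [pchar {poly k}] by rewrite pchar_poly.
have E : ('X - 1 : {poly k}) ^+ p = 'X^p - 1.
  rewrite -(pFrobenius_autE chX) pFrobenius_autB_comm; last exact: commr1.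
  by rewrite !pFrobenius_autE expr1n.
have := congr1 (horner_mx A) E.
by rewrite rmorphXn rmorphB /= horner_mx_X rmorph1 rmorphB rmorphXn /= horner_mx_X rmorph1 Ap subrr.
Qed.

Lemma sum_mx_shift m n r (T : nat -> 'M[k]_(n, r)) (X : 'M[k]_(r, m)) (Y : 'M[k]_m) :
  (0 < p)%N -> Y ^+ p = 0 -> \sum_(j < p) T j *m X *m Y ^+ j.+1 =
  \sum_(j < p) (if (j : nat) is j'.+1 then T j' else 0) *m X *m Y ^+ j.
Proof.
case: p => // q _ Yq; rewrite big_ord_recr [RHS]big_ord_recl /= Yq.
by rewrite mulmx0 addr0 !mul0mx add0r.
Qed.

Variable V : repS k p.
Local Notation n := (rdegree V).
Local Notation sigma := (cycle_perm p).
Local Notation G := (V sigma - 1%:M : 'M[k]_n).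
(** Freeness over C_p read on the socle: each invariant vector is the bottom of a Jordan block of
    full size p. *)
Hypothesis freeV : forall v : 'rV[k]_n, v *m G = 0 ->
  exists v' : 'rV[k]_n, v = v' *m (G : 'M[k]_n) ^+ p.-1.

Lemma rep_expr (W : repS k p) (s : 'S_p) j :
  (W s : 'M[k]_(rdegree W)) ^+ j = W (s ^+ j)%g.
Proof.
elim: j => [|j IH]; first by rewrite expr0 expg0 repr_mx1.
by rewrite expgS repr_mxM ?inE // exprS IH.
Qed.

Lemma rep_cycle_char (W : repS k p) :
  (W sigma - 1%:M : 'M[k]_(rdegree W)) ^+ p = 0.
Proof. by apply: mx_frobenius; rewrite rep_expr cycle_permX repr_mx1. Qed.

Let p0 : (0 < p)%N := prime_gt0 (pcharf_prime chp).

(* A k[g]/(g^p)-basis of V: V is the direct sum of the images of A g^j. *)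
Lemma free_basis : exists r (A : 'M[k]_(r, n)),
  (exists R : nat -> 'M[k]_(n, r), \sum_(j < p) R j *m A *m G ^+ j = 1%:M) /\
  forall m (S : nat -> 'M[k]_(m, r)),
    \sum_(j < p) S j *m A *m G ^+ j = 0 -> forall j, (j < p)%N -> S j = 0.
Proof.
pose B := row_base (kermx G).
have Gp : G ^+ p = 0 := rep_cycle_char V.
have [A EA] : exists A, B = A *m G ^+ p.-1.
  apply/submxP; rewrite eq_row_base; apply/row_subP => i.
  have [v' ->] : exists v', row i (kermx G) = v' *m G ^+ p.-1.
    by apply: freeV; rewrite -row_mul mulmx_ker row0.
  exact: submxMl.
have Gbig j : (p <= j)%N -> G ^+ j = 0.
  by move=> /subnKC <-; rewrite exprD Gp mul0r.
exists _, A; split.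
  (* If U is killed by G^(m+1), then U G^m lies in the socle, so it equals L A G^(p-1); subtracting
     L A G^(p-1-m) leaves a matrix killed by G^m. *)
  have span m (U : 'M[k]_(n, n)) : (m <= p)%N -> U *m G ^+ m = 0 ->
    exists R : nat -> 'M[k]_(n, _), \sum_(j < p) R j *m A *m G ^+ j = U.
    elim: m U => [|m IH] U le_mp UG.
      move: UG; rewrite expr0 mulmx1 => ->; exists (fun=> 0); rewrite big1 // => j _.
      by rewrite !mul0mx.
    have /submxP[L EL] : (U *m G ^+ m <= B)%MS.
      by rewrite eq_row_base; apply/sub_kermxP; rewrite -mulmxA [_ *m G](_ : _ = G ^+ m.+1) // exprSr.
    have [|R ER] := IH (U - L *m A *m G ^+ (p.-1 - m)) (ltnW le_mp).
      have GG : G ^+ (p.-1 - m) *m G ^+ m = G ^+ p.-1.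
        by transitivity (G ^+ (p.-1 - m + m)); [rewrite exprD|congr (G ^+ _); lia].
      by rewrite mulmxBl -(mulmxA (L *m A)) GG EL EA mulmxA subrr.
    have lt : (p.-1 - m < p)%N by lia.
    exists (fun j => R j + (if j == (p.-1 - m)%N then L else 0)).
    under eq_bigr => j _ do rewrite !mulmxDl.
    rewrite big_split /= ER (bigD1 (Ordinal lt)) //= eqxx big1 ?addr0 ?subrK // => j.
    by rewrite -val_eqE /= => /negPf ->; rewrite !mul0mx.
  by apply: (span p); rewrite // Gp mulmx0.
(* Multiplying by G^(p-1-j) kills the later terms; the earlier ones vanish by induction, and the
   rows of [B] are independent. *)
move=> m S ES; elim/ltn_ind => j IH lt_jp.
have := congr1 (mulmxr (G ^+ (p.-1 - j))) ES.
rewrite /= mul0mx mulmx_suml (bigD1 (Ordinal lt_jp)) //= [X in _ + X]big1 ?addr0.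
  have GG : G ^+ j *m G ^+ (p.-1 - j) = G ^+ p.-1.
    by transitivity (G ^+ (j + (p.-1 - j))); [rewrite exprD|congr (G ^+ _); lia].
  rewrite -(mulmxA (S j *m A)) GG.
  rewrite -mulmxA -EA => SB; apply: (row_free_inj (row_base_free (kermx G))).
  by rewrite mul0mx.
move=> i; rewrite -val_eqE /= neq_ltn => /orP[lt_ij|lt_ji].
  by rewrite IH // !mul0mx.
rewrite -(mulmxA (S i *m A)).
have -> : G ^+ i *m G ^+ (p.-1 - j) = G ^+ (i + (p.-1 - j)) by rewrite exprD.
rewrite Gbig ?mulmx0 //.
lia.
Qed.

(** A lift is first built over C_p from the free basis and then averaged over cosets, the index
    being prime to p. *)
Lemma free_projective : rep_projective V.
Proof.
move=> M N h f hh full_h hf.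
have [r [A [[R ER] freeA]]] := free_basis.
pose GM := M sigma - 1%:M; pose GN := N sigma - 1%:M.
have Gp : G ^+ p = 0 := rep_cycle_char V.
have GMp : GM ^+ p = 0 := rep_cycle_char M.
have powG (W : repS k p) (e : 'M_(rdegree W, rdegree N)) : is_rep_hom e ->
    forall j, (W sigma - 1%:M) ^+ j *m e = e *m GN ^+ j.
  move=> he; elim=> [|j IH]; first by rewrite !expr0 mul1mx mulmx1.
  rewrite exprS -mulmxA IH mulmxA mulmxBl he mul1mx -{2}[e]mulmx1 -mulmxBr.
  by rewrite -mulmxA exprS.
have /submxP[a Ea] : (A *m f <= h)%MS by rewrite submx_full.
(* The basis [A] is sent to preimages [a] of its image under [f], and the map is extended
   k[g]-linearly. *)
pose F := \sum_(j < p) R j *m a *m GM ^+ j.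
have Fh : F *m h = f.
  rewrite mulmx_suml -[RHS]mul1mx -ER mulmx_suml; apply: eq_bigr => j _.
  by rewrite -!mulmxA powG // powG // !mulmxA -(mulmxA (R j)) -Ea !mulmxA.
have GR j : (j < p)%N -> G *m R j = if j is j'.+1 then R j' else 0.
  move=> lt_jp; apply/eqP; rewrite -subr_eq0; apply/eqP; move: j lt_jp.
  apply: (freeA _ (fun j => G *m R j - if j is j'.+1 then R j' else 0)).
  under eq_bigr => j _ do rewrite (mulmxBl (G *m R j)) (mulmxBl (G *m R j *m A)).
  rewrite sumrB -sum_mx_shift //; apply/eqP; rewrite subr_eq0; apply/eqP.
  transitivity (G *m \sum_(j < p) R j *m A *m G ^+ j).
    by rewrite mulmx_sumr; apply: eq_bigr => j _; rewrite !mulmxA.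
  rewrite ER mulmx1; transitivity ((\sum_(j < p) R j *m A *m G ^+ j) *m G).
    by rewrite ER mul1mx.
  by rewrite mulmx_suml; apply: eq_bigr => j _; rewrite [in RHS]exprSr mulmxA.
have GF : G *m F = F *m GM.
  rewrite mulmx_sumr mulmx_suml.
  transitivity (\sum_(j < p) (if (j : nat) is j'.+1 then R j' else 0) *m a *m GM ^+ j).
    by apply: eq_bigr => j _; rewrite !mulmxA GR.
  by rewrite -sum_mx_shift //; apply: eq_bigr => j _; rewrite [in LHS]exprSr mulmxA.
have cF : V sigma *m F = F *m M sigma.
  by move: GF; rewrite mulmxBl mulmxBr mul1mx mulmx1 => /addIr.
have cFX j : V (sigma ^+ j)%g *m F = F *m M (sigma ^+ j)%g.
  elim: j => [|j IH]; first by rewrite !expg0 !repr_mx1 mul1mx mulmx1.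
  by rewrite !expgS !repr_mxM ?inE // -mulmxA IH mulmxA cF mulmxA.
(* The conjugates of [F] depend only on the coset of C_p, and each still lifts [f]. *)
pose T (s : 'S_p) := V s^-1%g *m F *m M s.
have TH c s : c \in <[sigma]>%G -> T (c * s)%g = T s.
  move=> /cycleP[j ->]; rewrite /T invMg !repr_mxM ?inE // -!mulmxA; congr (_ *m _).
  rewrite [F *m _]mulmxA -cFX !mulmxA -repr_mxM ?inE // mulVg repr_mx1 mul1mx.
  by [].
have nz := cycle_perm_index chp.
set idx := #|_ : _|%g in nz.
exists (idx%:R^-1 *: \sum_(B in rcosets <[sigma]>%g [set: 'S_p]%g) T (repr B)).
  move=> s; rewrite -scalemxAr -scalemxAl; congr (_ *: _).
  rewrite mulmx_sumr mulmx_suml.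
  have := @sum_rcosets_mulr _ <[sigma]>%G _ (fun c => T c *m M s) (s^-1)%g.
  rewrite /= => <-; last by move=> c u /TH ->.
  apply: eq_bigr => B _; rewrite /T invMg invgK !repr_mxM ?inE // -!mulmxA.
  by rewrite -[M (s^-1)%g *m _]repr_mxM ?inE // mulVg repr_mx1 mulmx1.
rewrite -scalemxAl mulmx_suml (eq_bigr (fun=> f)) => [|B _].
  by rewrite sumr_const -scaler_nat scalerA mulVf // scale1r.
rewrite /T -(mulmxA _ (M _) h) hh mulmxA -(mulmxA _ F h) Fh -(mulmxA _ f) -hf mulmxA.
by rewrite -repr_mxM ?inE // mulVg repr_mx1 mul1mx.
Qed.

End FreeModules.

(** * Non-projective cyclic summands *)

Section Gram.
Variables (k : fieldType) (C : tensor_category k) (p : nat).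
Hypothesis chp : p \in [pchar k].
Variables (Q : C) (q : mor Q tunit).
Hypothesis cq : projective_cover q.
Implicit Types (A B D P X T : C).

Let abC := tc_abelian C.
Local Notation sigma := (cycle_perm p).
Local Notation cyc X := (braid X (cycle_perm p)).
Local Notation g X := (cycle_minus_one p X).

(** If v M = 0, the column n-1-a involves only the entries of v up to index a; they vanish one after
    the other. *)
Lemma antitriangular_unit n (M : 'M[k]_n) :
  (forall a b : 'I_n, (n <= a + b)%N -> M a b = 0) ->
  (forall a b : 'I_n, (a + b).+1 = n -> M a b != 0) -> M \in unitmx.
Proof.
move=> M0 M1; rewrite -row_free_unit; apply: inj_row_free => v vM.
apply/rowP => a; rewrite mxE; have [m] := ubnP (nat_of_ord a).
elim: m a => // m IH a /ltnSE le_am.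
have lt : (n.-1 - a < n)%N by have := ltn_ord a; lia.
have ab : (a + Ordinal lt).+1 = n by have := ltn_ord a; rewrite /=; lia.
have /rowP/(_ (Ordinal lt)) := vM; rewrite !mxE (bigD1 a) //= big1 ?addr0.
  by move=> /eqP; rewrite mulf_eq0 (negPf (M1 _ _ ab)) orbF => /eqP.
move=> c; rewrite -val_eqE /= neq_ltn => /orP[lt_ca|lt_ac].
  by rewrite IH ?mul0r //; lia.
by rewrite M0 ?mulr0 //=; lia.
Qed.

(* The contraction of a nilpotent Jordan block with a dual one: with Gram
   matrix G for an invariant pairing, the tensor \sum (G^-1)_ba e_a ⊗ f_b is
   invariant and pairs to its size. *)
Lemma gram_invariant n (G S : 'M[k]_n) : G \in unitmx -> S *m G *m S^T = G ->
  S \in unitmx -> S^T *m (invmx G)^T *m S = (invmx G)^T.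
Proof.
move=> uG SG uS; have uSt : S^T \in unitmx by rewrite unitmx_tr.
have SG' : S *m G = G *m invmx S^T by rewrite -[in RHS]SG mulmxK.
apply: trmx_inj; rewrite !trmx_mul !trmxK.
rewrite -[LHS](mulmxK uG) mulmxA -(mulmxA _ S) SG' (mulmxA _ G) mulmxKV //.
by rewrite mulmxV // mul1mx.
Qed.

Section Pairing.
Variables (X D : C) (ev : mor (D ⊗ X) tunit) (coev : mor tunit (X ⊗ D)).
Hypothesis dXD : dual_pair ev coev.
Local Notation T := (tpow X p).
Local Notation DT := (tpow D p).
Local Notation E := (tpow_pairing ev p).

Lemma pairing_cyc A P (a : mor A DT) (b : mor P T) :
  E ∘ ((cyc D ∘ a) ⊗' (cyc X ∘ b)) = E ∘ (a ⊗' b).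
Proof. by rewrite tensm_comp compA tpow_pairing_braid. Qed.

(** The adjoint of σ is its inverse, so the adjoint of g = σ - 1 is -σ^(-1) g; hence the sign and
    the power of σ. *)
Lemma pairing_opow A P (a : mor A DT) (b : mor P T) j :
  E ∘ ((opow j (g D) ∘ a) ⊗' b) =
  (-1) ^+ j *: (E ∘ (a ⊗' (opow j (g X) ∘ (braid X (sigma ^- j)%g ∘ b)))).
Proof.
elim: j a b => [|j IH] a b.
  by rewrite !opow0 expr0 scale1r expg0 invg1 braid1 !comp_idl.
rewrite opowSr -compA IH exprS -scalerA scaleN1r -scalerN; congr (_ *: _).
set c := opow j _ ∘ _.
rewrite {1}cycle_minus_oneE compBl comp_idl.
have -> : (cyc D ∘ a - a) ⊗' c = (cyc D ∘ a) ⊗' c - a ⊗' c.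
  by rewrite -[- a]scaleN1r tensmDl tensmZl scaleN1r.
have {1}-> : c = cyc X ∘ (braid X sigma^-1%g ∘ c) by rewrite compA braidKV comp_idl.
rewrite compBr pairing_cyc -compBr -compNr; congr (_ ∘ _).
have -> : a ⊗' (braid X sigma^-1%g ∘ c) - a ⊗' c = a ⊗' (braid X sigma^-1%g ∘ c - c).
  by rewrite tensmDr -[- c]scaleN1r tensmZr scaleN1r.
rewrite -[RHS]scaleN1r -tensmZr scaleN1r; congr (_ ⊗' _).
have cs : g X ∘ braid X sigma^-1%g = braid X sigma^-1%g ∘ g X.
  by rewrite cycle_minus_oneE compBl compBr comp_idl comp_idr braidKV braidK.
have -> : opow j.+1 (g X) ∘ (braid X (sigma ^- j.+1)%g ∘ b) =
    g X ∘ (braid X sigma^-1%g ∘ c).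
  rewrite opowS /c -!compA; congr (_ ∘ _).
  rewrite [RHS]compA -(opow_comm _ cs) -!compA; congr (_ ∘ _).
  by rewrite !compA -braidM expgS invMg.
rewrite cycle_minus_oneE compBl comp_idl compA braidKV comp_idl opprB.
by [].
Qed.

Lemma braid_opow_comm (Y : C) (s : 'S_p) j : (s * sigma = sigma * s)%g ->
  braid Y s ∘ opow j (g Y) = opow j (g Y) ∘ braid Y s.
Proof.
move=> cs; rewrite opow_comm // cycle_minus_oneE compBl compBr comp_idl comp_idr.
by rewrite -!braidM cs.
Qed.

Lemma nilpotent_invariant_lift P (x : mor P T) i : projective X -> projective P ->
  (0 < i < p)%N -> opow i (g X) ∘ x = 0 ->
  (forall z, opow i (g X) ∘ z <> opow i.-1 (g X) ∘ x) -> invariant_lift q p.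
Proof.
move=> pX pP /andP[i0 lt_ip] gx nz; set y := opow i.-1 (g X) ∘ x.
have [pQ eq _] := cq.
(* [y] is not in the image of g^i, so it survives in the cokernel [B]. The dual block is generated
   by [w], which represents evaluation on [B]; it is killed by g^i because [c] is. *)
have [B [c kc]] := abelian_cokernel abC (opow i (g X)).
have cy : c ∘ y <> 0 by move=> /(projective_factor abC pP kc)[z]; apply: nz.
have [DB [evB [coB dB]]] := rigidP B.
have [w Ew] := (tpow_pairing_perfect dXD p).1 _ (evB ∘ (idm DB ⊗' c)).
have hE V (b : mor V T) : E ∘ (w ⊗' b) = evB ∘ (idm DB ⊗' (c ∘ b)).
  by rewrite -tensm_lr compA Ew -compA -tensm_idcomp.
have gw : opow i (g D) ∘ w = 0.
  apply: (tpow_pairing_perfect dXD p).2; rewrite pairing_opow hE compA kc.1.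
  by rewrite comp0l tensm0r tensm0l !comp0r scaler0.
have u0 : E ∘ (w ⊗' y) <> 0 by rewrite hE => /(perfect_eq0r dB).
(* The pairing of [w] with [y] is nonzero, hence epi; lifting [q] through it normalizes the
   antidiagonal Gram coefficients to signs. *)
have [l El] := pQ _ _ _ q (nonzero_epi_simple abC (tunit_simple C) u0).
pose e a := opow a (g D) ∘ w; pose f b := opow b (g X) ∘ x.
have eS a : cyc D ∘ e a = e a + e a.+1.
  by rewrite /e opowS -compA [X in _ + X ∘ _]cycle_minus_oneE compBl comp_idl addrC subrK.
have fS b : cyc X ∘ f b = f b + f b.+1.
  by rewrite /f opowS -compA [X in _ + X ∘ _]cycle_minus_oneE compBl comp_idl addrC subrK.
have ei : e i = 0 by [].
have fbig b : (i <= b)%N -> f b = 0.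
  by move=> /subnK <-; rewrite /f opow_add -compA gx comp0r.
pose coef a b := cover_coef cq (E ∘ (e a ⊗' f b) ∘ l).
have coefE a b : E ∘ (e a ⊗' f b) ∘ l = coef a b *: q by apply: cover_coefE.
have cs a : (sigma ^- a * sigma = sigma * sigma ^- a)%g.
  by apply/esym; apply: commuteV; apply: commuteX.
have pairE a b : E ∘ (e a ⊗' f b) =
    (-1) ^+ a *: (E ∘ (w ⊗' (braid X (sigma ^- a)%g ∘ f (a + b)%N))).
  rewrite pairing_opow; congr (_ *: (_ ∘ (_ ⊗' _))).
  by rewrite /f opow_add !compA braid_opow_comm.
have coef0 a b : (i <= a + b)%N -> coef a b = 0.
  move=> le; apply: (scale_cover_inj cq).
  by rewrite -coefE pairE fbig // comp0r tensm0r comp0r scaler0 comp0l scale0r.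
have coef1 a b : (a + b).+1 = i -> coef a b != 0.
  move=> ab; have cyc_y : cyc X ∘ y = y.
    have := fS i.-1; rewrite prednK // (fbig i (leqnn i)) addr0.
    by [].
  have inv_y j : braid X (sigma ^- j)%g ∘ y = y.
    elim: j => [|j IH]; first by rewrite expg0 invg1 braid1 comp_idl.
    by rewrite -{1}cyc_y compA -braidM expgSr invMg mulgA mulgV mul1g.
  suff -> : coef a b = (-1) ^+ a by rewrite signr_eq0.
  apply: (scale_cover_inj cq); rewrite -coefE pairE.
  have -> : (a + b)%N = i.-1 by rewrite -ab.
  by rewrite -/y inv_y compZl El.
pose G := \matrix_(a < i, b < i) coef a b.
(* The matrix of the cycle in both Jordan bases: the a-th vector goes to itself plus the next one,
   the i-th being 0. *)
pose S := \matrix_(a < i, b < i) ((a == b :> nat)%:R + (a.+1 == b :> nat)%:R : k).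
have uG : G \in unitmx.
  by apply: antitriangular_unit => a b; rewrite mxE; [apply: coef0|apply: coef1].
have sumS (V W : C) (h : nat -> mor V W) (a : 'I_i) : h i = 0 ->
    \sum_(b < i) S a b *: h b = h a + h a.+1.
  move=> hi; under eq_bigr => b _ do rewrite mxE scalerDl.
  rewrite big_split /= (bigD1 a) //= eqxx scale1r big1 ?addr0 => [|b]; last first.
    by rewrite -val_eqE eq_sym /= => /negPf ->; rewrite scale0r.
  congr (_ + _); have [lt|] := ltnP a.+1 i.
    rewrite (bigD1 (Ordinal lt)) //= eqxx scale1r big1 ?addr0 // => b.
    by rewrite -val_eqE eq_sym /= => /negPf ->; rewrite scale0r.
  move=> le; have E1 : a.+1 = i by apply/eqP; rewrite eqn_leq le ltn_ord.
  rewrite E1 hi big1 // => b _; rewrite gtn_eqF ?scale0r //.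
have cyc_sum (a b : 'I_i) : (cyc D ∘ e a) ⊗' (cyc X ∘ f b) =
    \sum_(a' < i) \sum_(b' < i) (S a a' * S b b') *: (e a' ⊗' f b').
  rewrite eS fS -(sumS _ _ e a ei) -(sumS _ _ f b (fbig _ (leqnn i))).
  rewrite tensm_suml; apply: eq_bigr => a' _; rewrite tensm_sumr.
  by apply: eq_bigr => b' _; rewrite tensmZl tensmZr scalerA.
have SG : S *m G *m S^T = G.
  apply/matrixP => a b; rewrite [RHS]mxE; apply: (scale_cover_inj cq).
  rewrite -coefE -pairing_cyc cyc_sum mxE scaler_suml comp_sumr comp_suml.
  under [RHS]eq_bigr => a' _ do rewrite comp_sumr comp_suml.
  rewrite [RHS]exchange_big; apply: eq_bigr => b' _.
  rewrite [(S *m G) a b']mxE mulr_suml scaler_suml; apply: eq_bigr => a' _.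
  by rewrite compZr compZl coefE scalerA [G a' b']mxE [S^T b' b]mxE mulrAC.
have uS : S \in unitmx.
  have : S *m (G *m S^T *m invmx G) = 1%:M by rewrite !mulmxA SG mulmxV.
  by move=> /mulmx1_unit[].
have MS := gram_invariant uG SG uS.
pose M := (invmx G)^T; pose Phi := \sum_(a < i) \sum_(b < i) M a b *: ((e a ⊗' f b) ∘ l).
have EPhi : E ∘ Phi = i%:R *: q.
  have -> : (i%:R : k) = \tr (invmx G *m G) by rewrite mulVmx // mxtrace1.
  rewrite /mxtrace scaler_suml comp_sumr.
  under [RHS]eq_bigr => b _ do rewrite mxE scaler_suml.
  rewrite [RHS]exchange_big; apply: eq_bigr => a _.
  rewrite comp_sumr; apply: eq_bigr => b _.
  by rewrite compZr compA coefE scalerA mxE [G a b]mxE.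
have sPhi : (cyc D ⊗' cyc X) ∘ Phi = Phi.
  pose co (u v : 'I_i * 'I_i) := M u.1 u.2 * (S u.1 v.1 * S u.2 v.2).
  transitivity (\sum_u \sum_v co u v *: ((e v.1 ⊗' f v.2) ∘ l)).
    rewrite /Phi pair_bigA /= comp_sumr; apply: eq_bigr => u _.
    rewrite compZr compA -tensm_comp cyc_sum pair_bigA /= comp_suml scaler_sumr.
    by apply: eq_bigr => v _; rewrite compZl scalerA.
  rewrite exchange_big /Phi [RHS]pair_bigA /=; apply: eq_bigr => v _.
  rewrite -scaler_suml; congr (_ *: _).
  rewrite -[M in RHS]MS -/M mxE -(pair_bigA _ (fun a b => co (a, b) v)) /=.
  rewrite exchange_big /=; apply: eq_bigr => b _; rewrite mxE mulr_suml.
  by apply: eq_bigr => a _; rewrite /co /= [S^T _ _]mxE mulrCA mulrA.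
(* [D ⊗ X] is projective, so [ev] factors through [q]; this carries the tensor to Q^p and turns the
   contraction into the counit. *)
have [m Em] : exists m, q ∘ m = ev by apply: (projective_tensl (X := D) pX).
have ip : (i%:R : k) != 0.
  by rewrite -(dvdn_pcharf chp); apply/negP => /(dvdn_leq i0); rewrite leqNgt lt_ip.
pose al := (i%:R)^-1 *: (tpowm p m ∘ (tzip D X p ∘ Phi)).
have sal : cyc Q ∘ al = al.
  rewrite /al compZr compA braid_tpowm -compA [_ ∘ (tzip _ _ _ ∘ _)]compA -tzip_braid.
  by rewrite -compA sPhi.
apply: (@invariant_lift_index _ _ _ _ _ <[sigma]>%G al).
- rewrite /al /tpow_counit compZr !compA (compE _ (esym (tpowm_comp p _ _))) Em EPhi.
  by rewrite scalerA mulVf // scale1r.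
- move=> _ /cycleP[j ->]; elim: j => [|j IH]; first by rewrite expg0 braid1 comp_idl.
  by rewrite expgSr braidM -compA IH sal.
- exact: cycle_perm_index.
Qed.

End Pairing.

Lemma nonprojective_invariant_lift (V : repS k p) :
  BPr C V -> ~ rep_projective V -> invariant_lift q p.
Proof.
move=> [r [P [X [f [h [pPX fE hE fh]]]]]] npV.
apply: contrapT => nlift; apply: npV; apply: (free_projective chp) => v vG.
have pp := pcharf_prime chp; have p0 := prime_gt0 pp.
(* Without an invariant lift, no vector generates a maximal Jordan block of size less than p. *)
have step i (x : mor (P i) (tpow (X i) p)) j : (0 < j < p)%N ->
    opow j (g (X i)) ∘ x = 0 -> exists z, opow j (g (X i)) ∘ z = opow j.-1 (g (X i)) ∘ x.
  move=> jp gx; apply: contrapT => nz; apply: nlift.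
  have [D [ev [coev d]]] := rigidP (X i).
  apply: (nilpotent_invariant_lift d (pPX i).2 (pPX i).1 jp gx) => z Ez.
  by apply: nz; exists z.
(* Iterating [step] writes an invariant vector as g z, then g^2 z, up to g^(p-1) z, with a new z
   each time. *)
have ker i (x : mor (P i) (tpow (X i) p)) : g (X i) ∘ x = 0 ->
    exists z, opow p.-1 (g (X i)) ∘ z = x.
  move=> gx; suff H j : (j < p)%N -> exists z, opow j (g (X i)) ∘ z = x.
    by apply: H; rewrite prednK.
  elim: j => [|j IH] lt_jp; first by exists x; rewrite opow0 comp_idl.
  have [z Ez] := IH (ltnW lt_jp).
  have [|z' Ez'] := step i z j.+1 lt_jp; last by exists z'; rewrite Ez'.
  by rewrite opowS -compA Ez.
have fG i (u : 'rV_(rdegree V)) : f i (u *m (V sigma - 1%:M)) = g (X i) ∘ f i u.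
  by rewrite mulmxBr mulmx1 linearB /= fE cycle_minus_oneE compBl comp_idl.
have hG i x j : h i (opow j (g (X i)) ∘ x) = h i x *m (V sigma - 1%:M) ^+ j.
  elim: j x => [|j IH] x; first by rewrite opow0 comp_idl expr0 mulmx1.
  rewrite opowS -compA {1}cycle_minus_oneE compBl comp_idl linearB /= hE IH.
  by rewrite -[X in _ - X]mulmx1 -mulmxBr -mulmxA exprSr.
have z i : {z | opow p.-1 (g (X i)) ∘ z = f i v}.
  by apply: cid; apply: ker; rewrite -fG vG linear0.
exists (\sum_i h i (projT1 (z i))); rewrite -[LHS]fh mulmx_suml.
by apply: eq_bigr => i _; case: (z i) => zi /= <-; rewrite hG.
Qed.

End Gram.

(** * The inductive system of projective objects *)

Section SystemBasics.
Variables (k : fieldType) (C : sym_monoidal_category k).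
Implicit Types (P X Y Z : C) (n : nat).

Lemma BPr_fin n (V : repS k n) (I : finType) (P X : I -> C)
    (f : forall i, 'rV[k]_(rdegree V) -> mor (P i) (tpow (X i) n))
    (g : forall i, mor (P i) (tpow (X i) n) -> 'rV[k]_(rdegree V)) :
  (forall i, projective (P i)) -> (forall i, projective (X i)) ->
  (forall i, linear (f i)) -> (forall i, linear (g i)) ->
  (forall i (s : 'S_n) v, f i (v *m V s) = braid (X i) s ∘ f i v) ->
  (forall i (s : 'S_n) x, g i (braid (X i) s ∘ x) = g i x *m V s) ->
  (forall v, \sum_i g i (f i v) = v) -> BPr C V.
Proof.
move=> pP pX lf lg fE gE gf.
exists #|I|, (P \o enum_val), (X \o enum_val).
exists (fun i => linear_of (lf (enum_val i))), (fun i => linear_of (lg (enum_val i))).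
split=> [i|i s v|i s x|v] /=; [by split|exact: fE|exact: gE|].
rewrite -[RHS]gf (reindex (@enum_val I I)) //=.
by exists enum_rank => x _; rewrite ?enum_valK ?enum_rankK.
Qed.

Lemma BPr_zero n : BPr C (grepr0 : repS k n).
Proof.
have l0 (i : 'I_0) : linear (fun _ : 'rV[k]_0 => 0 : mor (tunit : C) (tpow tunit n)).
  by move=> a x y; rewrite scaler0 addr0.
have l1 (i : 'I_0) : linear (fun _ : mor (tunit : C) (tpow tunit n) => 0 : 'rV[k]_0).
  by move=> a x y; rewrite scaler0 addr0.
apply: (@BPr_fin _ grepr0 'I_0 (fun=> tunit) (fun=> tunit) (fun _ _ => 0) (fun _ _ => 0)) => //;
  try by case.
by move=> v; rewrite big_ord0; apply/esym/thinmx0.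
Qed.

Lemma BPr_sum n (V W : repS k n) : BPr C V -> BPr C W -> BPr C (dadd_grepr V W).
Proof.
move=> [r [P [X [f [g [pPX fE gE gf]]]]]] [r' [P' [X' [f' [g' [pPX' fE' gE' gf']]]]]].
pose PP (i : 'I_r + 'I_r') := match i with inl i => P i | inr i => P' i end.
pose XX (i : 'I_r + 'I_r') := match i with inl i => X i | inr i => X' i end.
pose F (i : 'I_r + 'I_r') : 'rV[k]_(rdegree V + rdegree W) -> mor (PP i) (tpow (XX i) n) :=
  match i with inl i => fun v => f i (lsubmx v) | inr i => fun v => f' i (rsubmx v) end.
pose G (i : 'I_r + 'I_r') : mor (PP i) (tpow (XX i) n) -> 'rV[k]_(rdegree V + rdegree W) :=
  match i with inl i => fun x => row_mx (g i x) 0 | inr i => fun x => row_mx 0 (g' i x) end.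
apply: (@BPr_fin _ (dadd_grepr V W) _ PP XX F G) => [[]i|[]i|[]i|[]i|[]i s v|[]i s x|v] /=.
- by case: (pPX i).
- by case: (pPX' i).
- by case: (pPX i).
- by case: (pPX' i).
- by move=> a u v; rewrite !linearP.
- by move=> a u v; rewrite !linearP.
- by move=> a u v; rewrite linearP scale_row_mx add_row_mx scaler0 addr0.
- by move=> a u v; rewrite linearP scale_row_mx add_row_mx scaler0 addr0.
- by rewrite -fE -{1}[v]hsubmxK mul_row_block row_mxKl mulmx0 addr0.
- by rewrite -fE' -{1}[v]hsubmxK mul_row_block row_mxKr mulmx0 add0r.
- by rewrite gE mul_row_block !mulmx0 mul0mx !addr0.
- by rewrite gE' mul_row_block !mulmx0 mul0mx !add0r.
rewrite big_sumType /= -[RHS]hsubmxK -[in RHS](gf (lsubmx v)) -[in RHS](gf' (rsubmx v)).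
have addl (x y : 'rV[k]_(rdegree V)) :
    row_mx (x + y) (0 : 'rV[k]_(rdegree W)) = row_mx x 0 + row_mx y 0.
  by rewrite add_row_mx addr0.
have addr (x y : 'rV[k]_(rdegree W)) :
    row_mx (0 : 'rV[k]_(rdegree V)) (x + y) = row_mx 0 x + row_mx 0 y.
  by rewrite add_row_mx addr0.
rewrite -(big_morph _ addl (row_mx0 _ _ _ _)) -(big_morph _ addr (row_mx0 _ _ _ _)).
by rewrite add_row_mx addr0 add0r.
Qed.

Lemma BPr_summand n (V W : repS k n) : rep_summand V W -> BPr C W -> BPr C V.
Proof.
move=> [a [b [ha hb ab]]] [r [P [X [f [g [pPX fE gE gf]]]]]].
apply: (@BPr_fin _ V _ P X (fun i v => f i (v *m a)) (fun i x => g i x *m b)) => /=.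
- by move=> i; exact: (pPX i).1.
- by move=> i; exact: (pPX i).2.
- by move=> i c u v; rewrite mulmxDl -scalemxAl linearP.
- by move=> i c u v; rewrite linearP mulmxDl -scalemxAl.
- by move=> i s v; rewrite -mulmxA ha mulmxA fE.
- by move=> i s x; rewrite gE -mulmxA hb mulmxA.
- by move=> v; rewrite -mulmx_suml gf -mulmxA ab mulmx1.
Qed.

End SystemBasics.

Section SystemUnit.
Variables (k : fieldType) (C : tensor_category k).

Variables (Q : C) (q : mor Q tunit).
Hypothesis cq : projective_cover q.

Lemma BPr_triv n : invariant_lift q n -> BPr C (triv_rep k n).
Proof.
move=> [a Ea Ha]; have [pQ _ _] := cq.
pose F (_ : unit) (v : 'rV[k]_(rdegree (triv_rep k n))) : mor Q (tpow Q n) := v 0 0 *: a.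
pose G (_ : unit) (x : mor Q (tpow Q n)) : 'rV[k]_(rdegree (triv_rep k n)) :=
  const_mx (cover_coef cq (tpow_counit q n ∘ x)).
apply: (@BPr_fin k C n (triv_rep k n) unit (fun=> Q) (fun=> Q) F G) => //=; rewrite /F /G.
- by move=> _ c u v; rewrite !mxE scalerDl scalerA.
- move=> _ c u v; apply/matrixP => i j; rewrite !mxE compDr compZr.
  exact: cover_coef_linear.
- by move=> _ s v; rewrite mulmx1 compZr Ha.
- by move=> _ s x; rewrite mulmx1 compA tpow_counit_braid.
move=> v; rewrite big_const /= card_unit /= addr0; apply/matrixP => i j; rewrite !ord1 mxE.
by apply: cover_coefP; rewrite compZr Ea.
Qed.

Lemma invariant_lift_section n : invariant_lift q n -> has_equivariant_section_unit n q.
Proof.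
move=> [a Ea Ha].
have ls : linear (fun f => cover_coef cq f *: a).
  by move=> c f f'; rewrite cover_coef_linear scalerDl scalerA.
exists (linear_of ls); split=> [f|s f] /=; last by rewrite compZr Ha.
by rewrite compZr -/(tpow_counit q n) Ea -cover_coefE.
Qed.

Lemma section_unit_invariant_lift n : has_equivariant_section_unit n q -> invariant_lift q n.
Proof. by move=> [sec [E1 E2]]; exists (sec q); rewrite ?[_ ∘ sec q]E1. Qed.

End SystemUnit.

(** A section of the sum map on the permutation module k^p would have all coordinates equal, by
    transpositions, and its sum would be p times one of them, hence 0. *)
Lemma triv_not_projective (k : fieldType) p : p \in [pchar k] ->
  ~ rep_projective (triv_rep k p).
Proof.
move=> chp pr; have p0 := prime_gt0 (pcharf_prime chp).
have mr : mx_repr [set: 'S_p]%G (fun s : 'S_p => perm_mx s : 'M[k]_p).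
  by split=> [|s t _ _]; rewrite ?perm_mx1 ?perm_mxM.
pose M : repS k p := Representation (MxRepresentation mr).
have [|||h hh E] := pr M (triv_rep k p) (const_mx 1 : 'M[k]_(p, 1)) 1%:M.
- move=> s /=; rewrite mulmx1; apply/matrixP => i j; rewrite !mxE.
  rewrite (bigD1 (s i)) //= !mxE eqxx mulr1 big1 ?addr0 // => l.
  by rewrite !mxE eq_sym => /negPf ->; rewrite mul0r.
- apply/row_fullP; exists (delta_mx 0 (Ordinal p0)); apply/matrixP => i j.
  by rewrite !ord1 mxE (bigD1 (Ordinal p0)) //= !mxE !eqxx mulr1 big1 ?addr0 // => l /negPf;
    rewrite !mxE => ->; rewrite andbF mul0r.
- by [].
have hc i : h 0 i = h 0 (Ordinal p0).
  have /matrixP/(_ 0 i) := hh (tperm i (Ordinal p0)); rewrite mul1mx => ->.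
  rewrite mxE (bigD1 (Ordinal p0)) //= big1 ?addr0 => [|l /negPf nl].
    by rewrite !mxE tpermR eqxx mulr1.
  rewrite !mxE -[X in _ == X](tpermR i (Ordinal p0)) (inj_eq perm_inj) nl mulr0 //.
have := E; move=> /matrixP/(_ 0 0); rewrite !mxE eqxx.
rewrite (eq_bigr (fun=> h 0 (Ordinal p0))) => [|i _]; last by rewrite mxE mulr1.
rewrite sumr_const card_ord -mulr_natr (pcharf0 chp) mulr0 => /eqP.
by rewrite eq_sym oner_eq0.
Qed.

(** * A trace pairing *)

Section TracePairing.
Variables (k : fieldType) (C : tensor_category k).
Implicit Types (P X Y Z S : C).
Let abC := tc_abelian C.

(** The cokernel of [i], tensored with [P], is projective, so [i ⊗ P] is split: projectives act as
    injectives here. *)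
Lemma tensr_extension P X Z B (i : mor X Z) (a : mor (X ⊗ P) B) :
  projective P -> mono i -> exists a', a' ∘ (i ⊗' idm P) = a.
Proof.
move=> pP mi; have [W [c [ki kc]]] := mono_short_exact abC mi.
have mi' : mono (i ⊗' idm P) by apply: tensr_mono.
have ki' := mono_kernel abC mi' (tensr_cokernel P kc).
have [t Et] := @projective_tensl _ _ P W pP _ _ (c ⊗' idm P) (idm _)
  (cokernel_epi (tensr_cokernel P kc)).
have [|r Er] := kernel_factor (h := idm _ - t ∘ (c ⊗' idm P)) ki'.
  by rewrite compBr comp_idr compA Et comp_idl subrr.
exists (a ∘ r); rewrite -compA -[RHS]comp_idr; congr (_ ∘ _); apply: mi'.
by rewrite compA Er compBl comp_idl -compA ki'.1 comp0r subr0 comp_idr.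
Qed.

Variables (Q : C) (q : mor Q tunit) (tau : mor Q (Q ⊗ Q)).
Hypothesis cq : projective_cover q.
Hypothesis Etau : lunit tunit ∘ (q ⊗' q) ∘ tau = q.

(** [tau] supplies the copy of [Q] that the form takes as its second argument; the result lies on
    the line spanned by [q]. *)
Definition trace_pairing Z (c : mor (Z ⊗ Q) tunit) (x : mor Q Z) : k :=
  cover_coef cq (c ∘ (x ⊗' idm Q) ∘ tau).

Lemma trace_pairingE Z (c : mor (Z ⊗ Q) tunit) (x : mor Q Z) :
  c ∘ (x ⊗' idm Q) ∘ tau = trace_pairing c x *: q.
Proof. exact: cover_coefE. Qed.

Lemma trace_pairingP Z (c : mor (Z ⊗ Q) tunit) (x : mor Q Z) a :
  c ∘ (x ⊗' idm Q) ∘ tau = a *: q -> trace_pairing c x = a.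
Proof. exact: cover_coefP. Qed.

Lemma trace_pairing_linearl Z a (c c' : mor (Z ⊗ Q) tunit) x :
  trace_pairing (a *: c + c') x = a * trace_pairing c x + trace_pairing c' x.
Proof. by rewrite /trace_pairing !compDl !compZl cover_coef_linear. Qed.

Lemma trace_pairing_linearr Z a (c : mor (Z ⊗ Q) tunit) x x' :
  trace_pairing c (a *: x + x') = a * trace_pairing c x + trace_pairing c x'.
Proof.
by rewrite /trace_pairing tensmDl tensmZl compDr compZr compDl compZl cover_coef_linear.
Qed.

Lemma trace_pairing_comp Y Z (c : mor (Z ⊗ Q) tunit) (f : mor Y Z) x :
  trace_pairing c (f ∘ x) = trace_pairing (c ∘ (f ⊗' idm Q)) x.
Proof. by rewrite /trace_pairing tensm_compid compA. Qed.

(* [lunit (u ⊗ q)] extends along [m] to [D ⊗ Q], and [f] is its transpose. *)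
Lemma trace_pairing_nondegenerate Z (c : mor (Z ⊗ Q) tunit) :
  (forall x, trace_pairing c x = 0) -> c = 0.
Proof.
move=> c0; apply: contrapT => nz; have [pQ eq _] := cq.
have [D [ev [coev d]]] := rigidP Z.
have [g Eg] := (dual_perfect d).1 _ (c ∘ braiding Q Z).
have g0 : g <> 0.
  move=> g0; apply: nz; apply: (@epi_eq0 _ _ _ _ (braiding Q Z)).
    exact/iso_epi/iso_braiding.
  by rewrite -Eg g0 tensm0l comp0r.
have [J [m [e [mm ee E]]]] := image_exists abC g.
have e0 : e <> 0 by move=> e0; apply: g0; rewrite -E e0 comp0r.
have [u Eu] := cover_factor cq ee e0.
have [w Ew] := tensr_extension (lunit tunit ∘ (u ⊗' q)) pQ mm.
have [f Ef] := (dual_perfect (dual_pair_sym d)).1 _ (w ∘ braiding Q D).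
have Ef' : ev ∘ (idm D ⊗' f) = w.
  apply: (iso_epi (iso_braiding Q D)).
  by rewrite -Ef -!compA -braiding_natural.
have Ec : c = ev ∘ (g ⊗' idm Z) ∘ braiding Z Q.
  by rewrite Eg -compA braiding_sym comp_idr.
apply: (cover_nonzero cq); rewrite -[0](scale0r q) -(c0 f) -trace_pairingE Ec.
rewrite -(compA _ (braiding _ _)) braiding_natural compA -(compA ev) tensm_swap.
rewrite compA Ef' -E tensm_compid compA Ew -(compA _ (u ⊗' q)) -tensm_comp Eu comp_idr.
rewrite -(compA _ (q ⊗' q)) -braiding_natural compA lunit_braiding runit_tunit.
by rewrite Etau.
Qed.

(** Induction on a composition series: forms extend along the subobject, and the top factor [S] adds
    at most one basis vector. *)
Lemma dual_bases_exist Z : exists (I : finType) (b : I -> mor Q Z) (c : I -> mor (Z ⊗ Q) tunit),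
  (forall i j, trace_pairing (c i) (b j) = (i == j)%:R) /\
  (forall x, exists a : I -> k, x = \sum_i a i *: b i).
Proof.
have [pQ eq _] := cq.
elim: (tc_finite_length Z) => {Z} [Z zZ|X Z S f g [kf kg] _ [I [b [c [cb sb]]]] sS].
  exists void, (fun=> 0), (fun=> 0); split=> [[]//|x]; exists (fun=> 0).
  by rewrite big_pred0 ?(zero_mor_to x zZ) //; case.
have mf := kernel_mono kf; have eg := cokernel_epi kg.
have /choice[c1 Ec1] i := tensr_extension (c i) pQ mf.
have c1b i j : trace_pairing (c1 i) (f ∘ b j) = (i == j)%:R.
  by rewrite trace_pairing_comp Ec1.
(* Either [Q] has no nonzero map to [S] and the basis is unchanged, or [S] embeds in 1 by [u] and
   [r] lifts to one new vector [y]. *)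
have [[r r0]|nr] := pselect (exists r : mor Q S, r <> 0); last first.
  exists I, (fun i => f ∘ b i), c1; split=> // x.
  have gx : g ∘ x = 0 by apply: contrapT => gx; apply: nr; exists (g ∘ x).
  have [y <-] := kernel_factor kf gx; have [a ->] := sb y.
  by exists a; rewrite comp_sumr; apply: eq_bigr => i _; rewrite compZr.
have er := nonzero_epi_simple abC sS r0.
have [u Eu] := cover_factor cq er r0.
have mu : mono u.
  apply: mono0 => W h uh; have [K [i ki]] := abelian_kernel abC u.
  have [zK|ii] := sS.2 _ _ (kernel_mono ki).
    by have [v <-] := kernel_factor ki uh; rewrite (zero_mor_to v zK) comp0r.
  have u0 : u = 0 by apply: (@epi_eq0 _ _ _ _ i); [exact: iso_epi|exact: ki.1].
  by case: (cover_nonzero cq); rewrite -Eu u0 comp0l.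
have [y Ey] := pQ _ _ g r eg.
pose c2 := lunit tunit ∘ (u ⊗' q) ∘ (g ⊗' idm Q).
have c2f x : trace_pairing c2 (f ∘ x) = 0.
  apply: trace_pairingP; rewrite /c2 -(compA _ (g ⊗' _)) -tensm_compid compA kf.1 comp0l.
  by rewrite tensm0l comp0r comp0l scale0r.
have c2y : trace_pairing c2 y = 1.
  apply: trace_pairingP; rewrite /c2 -(compA _ (g ⊗' _)) -tensm_compid Ey.
  by rewrite -(compA _ (u ⊗' _)) -tensm_comp Eu comp_idr Etau scale1r.
(* The extended forms are corrected by multiples of [c2] so that they vanish on [y]. *)
exists (I + unit)%type, (fun s => match s with inl i => f ∘ b i | inr _ => y end),
  (fun s => match s with inl i => - trace_pairing (c1 i) y *: c2 + c1 i | inr _ => c2 end).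
split=> [[i|[]] [j|[]]|x] //=.
- by rewrite trace_pairing_linearl c2f mulr0 add0r c1b.
- by rewrite trace_pairing_linearl c2y mulr1 addNr.
pose a := cover_coef cq (u ∘ (g ∘ x)).
have gx : g ∘ (x - a *: y) = 0.
  by apply: (mono_eq0 mu); rewrite !compBr !compZr Ey Eu -cover_coefE subrr.
have [z Ez] := kernel_factor kf gx; have [e Ee] := sb z.
exists (fun s => match s with inl i => e i | inr _ => a end).
rewrite big_sumType /= big_const card_unit /= addr0.
by rewrite -[LHS](subrK (a *: y)) -Ez Ee comp_sumr; congr (_ + _); apply: eq_bigr => i _; rewrite compZr.
Qed.

End TracePairing.

Lemma untranspose_exists (k : fieldType) (C : sym_monoidal_category k) (X D : C) ev coev :
  @dual_pair _ C X D ev coev -> forall A B : C,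
  exists u : mor (A ⊗ X) B -> mor A (B ⊗ D),
    [/\ forall f, transpose ev (u f) = f, forall a, u (transpose ev a) = a, linear u
      & forall h f, u (h ∘ f) = (h ⊗' idm D) ∘ u f].
Proof.
move=> d A B; have /choice[u uK] := transpose_surj d (A := A) (B := B).
exists u; split=> // [a|c f g|h f]; apply: (transpose_inj d); rewrite ?uK //.
- by rewrite transpose_linear !uK.
- by rewrite transpose_compr uK.
Qed.

(** * Reduction to the projective cover of the unit *)

Section Forms.
Variables (k : fieldType) (C : tensor_category k).
Implicit Types (P X Y Z R : C) (n : nat).
Let abC := tc_abelian C.

Lemma projective_biproduct P P' S (i1 : mor P S) (i2 : mor P' S) p1 p2 :
  projective P -> projective P' -> i1 ∘ p1 + i2 ∘ p2 = idm S -> projective S.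
Proof.
move=> pP pP' E Y Z e f ee; have [h Eh] := pP _ _ e (f ∘ i1) ee.
have [h' Eh'] := pP' _ _ e (f ∘ i2) ee; exists (h ∘ p1 + h' ∘ p2).
by rewrite compDr !compA Eh Eh' -!compA -compDr E comp_idr.
Qed.

(** Dualizing [R] moves it to the source: Hom(P, X^n ⊗ R) is Hom(P ⊗ D, X^n) with [D] the dual of
    [R]. *)
Lemma BPr_intro n (V : repS k n) P X R
    (f : 'rV[k]_(rdegree V) -> mor P (tpow X n ⊗ R))
    (g : mor P (tpow X n ⊗ R) -> 'rV[k]_(rdegree V)) :
  projective P -> projective X -> linear f -> linear g ->
  (forall (s : 'S_n) v, f (v *m V s) = (braid X s ⊗' idm R) ∘ f v) ->
  (forall (s : 'S_n) x, g ((braid X s ⊗' idm R) ∘ x) = g x *m V s) ->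
  (forall v, g (f v) = v) -> BPr C V.
Proof.
move=> pP pX lf lg fE gE gf; have [D [ev [coev d]]] := rigidP R.
have [u [uK Ku lu uE]] := untranspose_exists (dual_pair_sym d) P (tpow X n).
set ev' := ev ∘ _ in uK Ku.
apply: (@BPr_fin k C n V unit (fun=> P ⊗ D) (fun=> X) (fun _ v => transpose ev' (f v))
  (fun _ x => g (u x))) => //=.
- by move=> _; apply: projective_tensr.
- by move=> _ c v w; rewrite lf transpose_linear.
- by move=> _ c x y; rewrite lu lg.
- by move=> _ s v; rewrite fE transpose_compr.
- by move=> _ s x; rewrite uE gE.
- by move=> v; rewrite big_const /= card_unit /= addr0 Ku gf.
Qed.

(** Sums over the family embed in one Hom space between biproducts; [P0] serves for the empty
    family. The induction keeps the composite as a sum, since partial sums are not the identity. *)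
Lemma BPr_single n (V : repS k n) P0 : projective P0 -> BPr C V ->
  exists P X (f : 'rV[k]_(rdegree V) -> mor P (tpow X n))
    (g : mor P (tpow X n) -> 'rV[k]_(rdegree V)),
  [/\ projective P /\ projective X, linear f /\ linear g,
    forall (s : 'S_n) v, f (v *m V s) = braid X s ∘ f v,
    forall (s : 'S_n) x, g (braid X s ∘ x) = g x *m V s
    & forall v, g (f v) = v].
Proof.
move=> pP0 [r [P [X [f [g [pPX fE gE gf]]]]]].
suff [P' [X' [f' [g' [pPX' lfg' fE' gE' gf']]]]] :
    exists P' X' (f' : 'rV[k]_(rdegree V) -> mor P' (tpow X' n))
    (g' : mor P' (tpow X' n) -> 'rV[k]_(rdegree V)),
  [/\ projective P' /\ projective X', linear f' /\ linear g',
    forall (s : 'S_n) v, f' (v *m V s) = braid X' s ∘ f' v,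
    forall (s : 'S_n) x, g' (braid X' s ∘ x) = g' x *m V s
    & forall v, g' (f' v) = \sum_i g i (f i v)].
  by exists P', X', f', g'; split=> // v; rewrite gf'.
elim: r P X f g pPX fE gE {gf} => [|r IH] P X f g pPX fE gE.
  exists P0, P0, (fun=> 0), (fun=> 0); split=> //; first 1 [split].
  - by move=> c v w; rewrite scaler0 addr0.
  - by move=> c v w; rewrite scaler0 addr0.
  - by move=> s v; rewrite comp0r.
  - by move=> s x; rewrite mul0mx.
  - by move=> v; rewrite big_ord0.
have [//|s v|s x|P' [X' [f' [g' [[pP' pX'] [lf' lg'] fE' gE' gf']]]]] :=
    IH (P \o lift ord0) (X \o lift ord0) (fun i => f (lift ord0 i)) (fun i => g (lift ord0 i)).
- by move=> i; apply: pPX.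
- exact: fE.
- exact: gE.
have [S [i1 [i2 [p1 [p2 [pi1 pi2 pi12 pi21 pi]]]]]] := abelian_biproduct abC (P ord0) P'.
have [T [j1 [j2 [r1 [r2 [rj1 rj2 _ _ rj]]]]]] := abelian_biproduct abC (X ord0) X'.
exists S, T, (fun v => tpowm n j1 ∘ f ord0 v ∘ p1 + tpowm n j2 ∘ f' v ∘ p2),
  (fun x => g ord0 (tpowm n r1 ∘ x ∘ i1) + g' (tpowm n r2 ∘ x ∘ i2)).
split.
- have [pP pX] := pPX ord0.
  by split; [exact: projective_biproduct pi|exact: projective_biproduct rj].
- split=> [c v w|c x y].
    rewrite linearP lf' !compDr !compDl !compZr !compZl scalerDr -!addrA.
    by congr (_ + _); rewrite addrCA.
  rewrite !compDr !compDl !compZr !compZl linearP lg' scalerDr -!addrA.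
  by congr (_ + _); rewrite addrCA.
- by move=> s v; rewrite fE fE' compDr !compA !braid_tpowm.
- move=> s x; rewrite mulmxDl -gE -gE'.
  by rewrite !compA !braid_tpowm.
- move=> v; rewrite big_ord_recl -gf' !compDr !compDl; congr (g _ _ + g' _).
    rewrite !compA -!tpowm_comp rj1 tpowm_id comp_idl -(compA _ p1) pi1 comp_idr.
    by rewrite -(compA _ p2) pi21 comp0r addr0.
  rewrite !compA -!tpowm_comp rj2 tpowm_id comp_idl -(compA _ p2) pi2 comp_idr.
  by rewrite -(compA _ p1) pi12 comp0r add0r.
Qed.

Variables (Q : C) (q : mor Q tunit) (tau : mor Q (Q ⊗ Q)).
Hypothesis cq : projective_cover q.
Hypothesis Etau : lunit tunit ∘ (q ⊗' q) ∘ tau = q.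

Let pairing := trace_pairing tau cq.

Lemma pairing_suml Z (I : finType) (a : I -> k) (c : I -> mor (Z ⊗ Q) tunit) x :
  pairing (\sum_i a i *: c i) x = \sum_i a i * pairing (c i) x.
Proof.
rewrite /pairing; elim/big_rec2: _ => [|i y z _ <-].
  by apply: trace_pairingP; rewrite !comp0l scale0r.
by rewrite trace_pairing_linearl.
Qed.

Lemma pairing_sumr Z (I : finType) (a : I -> k) (c : mor (Z ⊗ Q) tunit) x :
  pairing c (\sum_i a i *: x i) = \sum_i a i * pairing c (x i).
Proof.
rewrite /pairing; elim/big_rec2: _ => [|i y z _ <-].
  by apply: trace_pairingP; rewrite tensm0l comp0r comp0l scale0r.
by rewrite trace_pairing_linearr.
Qed.

Lemma pairing_inj Z (c c' : mor (Z ⊗ Q) tunit) :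
  (forall x, pairing c x = pairing c' x) -> c = c'.
Proof.
move=> E; apply/eqP; rewrite -subr_eq0; apply/eqP.
apply: (@trace_pairing_nondegenerate _ _ _ _ _ cq Etau) => x.
by rewrite addrC -scaleN1r trace_pairing_linearl -[trace_pairing _ _ c' _]E mulN1r addNr.
Qed.

(** Linear maps on Hom(Q, Z) come from morphisms [Z ⊗ Q -> 1], by expansion in dual bases. *)
Lemma pairing_represent Z d (g : mor Q Z -> 'rV[k]_d) : linear g ->
  exists c : 'I_d -> mor (Z ⊗ Q) tunit, forall j x, pairing (c j) x = g x 0 j.
Proof.
move=> lg; have [I [b [c [cb sb]]]] := dual_bases_exist cq Etau Z.
exists (fun j => \sum_i g (b i) 0 j *: c i) => j x; have [a ->] := sb x.
rewrite pairing_suml -[g]/(linear_of lg : _ -> _) linear_sum summxE; apply: eq_bigr => i _.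
rewrite linearZ mxE pairing_sumr (bigD1 i) //= /pairing cb eqxx mulr1 big1 => [|l nl].
  by rewrite addr0 mulrC.
by rewrite cb eq_sym (negPf nl) mulr0.
Qed.

(* A form of [V] presents it as a summand of [Hom(Q, X^n ⊗ R)]; the
   projection is given by morphisms, through the trace pairing. *)
Record bform n (V : repS k n) X R (f : 'rV[k]_(rdegree V) -> mor Q (tpow X n ⊗ R))
    (c : 'I_(rdegree V) -> mor ((tpow X n ⊗ R) ⊗ Q) tunit) : Prop := BForm {
  bform_linear : linear f;
  bform_equiv : forall (s : 'S_n) v, f (v *m V s) = (braid X s ⊗' idm R) ∘ f v;
  bform_coequiv : forall (s : 'S_n) j,
    c j ∘ ((braid X s ⊗' idm R) ⊗' idm Q) = \sum_l V s l j *: c l;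
  bform_pairing : forall v j, pairing (c j) (f v) = v 0 j
}.

Lemma BPr_bform n (V : repS k n) : BPr C V ->
  exists X R f c, projective X /\ @bform n V X R f c.
Proof.
have [pQ eq _] := cq; move=> /(BPr_single pQ).
move=> [P [X [f [g [[pP pX] [lf lg] fE gE gf]]]]]; exists X.
have [D [ev [coev d]]] := rigidP P.
have [s Es] := pP _ _ (counit_tens q P) (idm P)
  (@counit_tens_is_epi _ _ _ _ eq P).
have [u [uK Ku lu uE]] := untranspose_exists d Q (tpow X n).
(* Hom(P, X^n) is a retract of Hom(Q ⊗ P, X^n), through the counit and its section [s], and [P] is
   then dualized into the factor [R]. *)
pose F v := u (f v ∘ counit_tens q P).
pose G a := g (transpose ev a ∘ s).
have lG : linear G.
  by move=> a x y; rewrite /G transpose_linear compDl compZl lg.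
have [c Ec] := pairing_represent lG.
exists D, F, c; split=> //; split=> [a v w|t v|t j|v j].
- by rewrite /F lf compDl compZl lu.
- by rewrite /F fE -compA uE.
- apply: pairing_inj => x; rewrite pairing_suml /pairing -trace_pairing_comp.
  rewrite -/(pairing _ _) Ec /G transpose_compr -compA gE mxE; apply: eq_bigr => l _.
  by rewrite mulrC -/(pairing _ _) Ec.
- by rewrite Ec /G /F uK -compA Es comp_idr gf.
Qed.

End Forms.

(** * Tensor products of matrices *)

Section Tprod.
Variable (k : fieldType).

Lemma tprod_linearl m1 n1 m2 n2 a (A A' : 'M[k]_(m1, n1)) (B : 'M[k]_(m2, n2)) :
  tprod (a *: A + A') B = a *: tprod A B + tprod A' B.
Proof.
elim: m1 A A' => [|m1 IH] A A' /=; first by rewrite scaler0 addr0.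
by rewrite !linearP /= IH -!trowbE linearP /= scale_col_mx add_col_mx.
Qed.

Lemma tprod_linearr m1 n1 m2 n2 a (A : 'M[k]_(m1, n1)) (B B' : 'M[k]_(m2, n2)) :
  tprod A (a *: B + B') = a *: tprod A B + tprod A B'.
Proof.
elim: m1 A => [|m1 IH] A /=; first by rewrite scaler0 addr0.
by rewrite IH linearP /= scale_col_mx add_col_mx.
Qed.

Lemma tprod_suml m1 n1 m2 n2 (I : finType) (a : I -> k) (A : I -> 'M[k]_(m1, n1))
    (B : 'M[k]_(m2, n2)) :
  tprod (\sum_i a i *: A i) B = \sum_i a i *: tprod (A i) B.
Proof.
have lT : linear (fun A : 'M[k]_(m1, n1) => tprod A B).
  by move=> c X Y; rewrite tprod_linearl.
rewrite -[LHS]/(linear_of lT _) linear_sum; apply: eq_bigr => i _; exact: linearZ.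
Qed.

Lemma tprod_sumr m1 n1 m2 n2 (I : finType) (a : I -> k) (A : 'M[k]_(m1, n1))
    (B : I -> 'M[k]_(m2, n2)) :
  tprod A (\sum_i a i *: B i) = \sum_i a i *: tprod A (B i).
Proof.
have lT : linear (fun B : 'M[k]_(m2, n2) => tprod A B).
  by move=> c X Y; rewrite tprod_linearr.
rewrite -[LHS]/(linear_of lT _) linear_sum; apply: eq_bigr => i _; exact: linearZ.
Qed.

Lemma id_sum_delta n : 1%:M = \sum_i (1 : k) *: (delta_mx i (0 : 'I_1) *m delta_mx (0 : 'I_1) i) :> 'M[k]_n.
Proof.
rewrite -[LHS]mul1mx; apply/matrixP => i j; rewrite mul1mx summxE.
rewrite (bigD1 i) //= scale1r mul_delta_mx !mxE eqxx eq_sym big1 ?addr0 // => l nl.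
by rewrite scale1r mul_delta_mx !mxE eq_sym (negPf nl).
Qed.

(** Coordinates in the tensor basis, obtained by multiplying with pure tensors so that the index
    arithmetic of [tprod] never appears. *)
Definition tcoord d d' (v : 'rV[k]_(d * d')) i j : k :=
  (v *m tprod (delta_mx i (0 : 'I_1)) (delta_mx j (0 : 'I_1))) 0 0.

Lemma tcoordE d d' (v : 'rV[k]_(d * d')) :
  v = \sum_i \sum_j tcoord v i j *: tprod (delta_mx (0 : 'I_1) i) (delta_mx (0 : 'I_1) j).
Proof.
rewrite -[LHS]mulmx1 -tprod1 !id_sum_delta tprod_suml mulmx_sumr; apply: eq_bigr => i _.
rewrite scale1r tprod_sumr mulmx_sumr; apply: eq_bigr => j _.
rewrite scale1r tprodE mulmxA [X in X *m _]mx11_scalar; exact: mul_scalar_mx.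
Qed.

Lemma tcoord_linear d d' i j a (v w : 'rV[k]_(d * d')) :
  tcoord (a *: v + w) i j = a * tcoord v i j + tcoord w i j.
Proof. by rewrite /tcoord mulmxDl -scalemxAl !mxE. Qed.

Lemma tcoord_tprod d d' (u : 'rV[k]_d) (w : 'rV[k]_d') i j :
  tcoord (tprod u w : 'rV_(d * d')) i j = u 0 i * w 0 j.
Proof.
rewrite /tcoord -[(_ *m _)](tprodE u (delta_mx i 0) w (delta_mx j 0)) -!colE.
suff H (x y : 'M[k]_1) : (tprod x y : 'M[k]_1) 0 0 = x 0 0 * y 0 0 by rewrite H !mxE.
change ((col_mx (row_mx (lsubmx (usubmx (x : 'M_(1 + 0, 1 + 0))) 0 0 *: y) 0)
  (0 : 'M_(0, 1 + 0)) : 'M_(1 + 0, 1 + 0)) 0 0 = x 0 0 * y 0 0).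
have -> : 0 = lshift 0 0 :> 'I_(1 + 0) by apply: val_inj.
by rewrite col_mxEu row_mxEl !mxE; congr (x _ _ * y _ _); apply: val_inj.
Qed.

Section Extension.
Variables (M : lmodType k) (d d' : nat).

Lemma tprod_ext (F F' : 'rV[k]_(d * d') -> M) : linear F -> linear F' ->
  (forall (u : 'rV_d) (w : 'rV_d'), F (tprod u w) = F' (tprod u w)) -> forall v, F v = F' v.
Proof.
move=> lF lF' E v.
rewrite [v]tcoordE -[F]/(linear_of lF : _ -> _) -[F']/(linear_of lF' : _ -> _).
rewrite !linear_sum; apply: eq_bigr => i _; rewrite !linear_sum; apply: eq_bigr => j _.
by rewrite !linearZ; congr (_ *: _); exact: E.
Qed.

Lemma tprod_extend (b : 'rV[k]_d -> 'rV[k]_d' -> M) :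
  (forall u, linear (b u)) -> (forall w, linear (b^~ w)) ->
  exists F : 'rV[k]_(d * d') -> M, linear F /\ forall (u : 'rV_d) (w : 'rV_d'), F (tprod u w) = b u w.
Proof.
move=> lr ll; exists (fun v => \sum_i \sum_j tcoord v i j *: b (delta_mx 0 i) (delta_mx 0 j)).
split=> [a v w|u w].
  rewrite scaler_sumr -big_split; apply: eq_bigr => i _.
  rewrite scaler_sumr -big_split; apply: eq_bigr => j _.
  by rewrite tcoord_linear scalerDl scalerA.
rewrite {2}[u]row_sum_delta.
rewrite -[RHS]/(linear_of (ll w) _) linear_sum; apply: eq_bigr => i _.
rewrite linearZ /= {2}[w]row_sum_delta -[b _ _ in RHS]/(linear_of (lr _) _).
rewrite linear_sum scaler_sumr.
by apply: eq_bigr => j _; rewrite linearZ tcoord_tprod scalerA.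
Qed.

End Extension.
End Tprod.

(** * Tensor products and duals *)

Section TensorDual.
Variables (k : fieldType) (C : tensor_category k).
Implicit Types (P X Y Z R T : C) (n : nat).
Variables (Q : C) (q : mor Q tunit) (tau : mor Q (Q ⊗ Q)).
Hypothesis cq : projective_cover q.
Hypothesis Etau : lunit tunit ∘ (q ⊗' q) ∘ tau = q.

Local Notation pairing := (trace_pairing tau cq).

Section External.
Variables (T R T' R' : C) (d d' : nat).
Variables (f : 'rV[k]_d -> mor Q (T ⊗ R)) (c : 'I_d -> mor ((T ⊗ R) ⊗ Q) tunit).
Variables (f' : 'rV[k]_d' -> mor Q (T' ⊗ R')) (c' : 'I_d' -> mor ((T' ⊗ R') ⊗ Q) tunit).
Hypotheses (lf : linear f) (lf' : linear f').
Hypothesis cf : forall v j, pairing (c j) (f v) = v 0 j.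
Hypothesis cf' : forall v j, pairing (c' j) (f' v) = v 0 j.

(** The copy of [Q] used by a single pairing is doubled at both ends: [tau] is applied three times
    and the four copies are regrouped, so that a product of elements is paired to the product of
    scalars. *)
Let product_pairing (e : mor ((T ⊗ R) ⊗ Q) tunit) (e' : mor ((T' ⊗ R') ⊗ Q) tunit)
    (x : mor (Q ⊗ Q) ((T ⊗ T') ⊗ (R ⊗ R'))) : mor Q tunit :=
  lunit tunit ∘ (e ⊗' e') ∘ mid4 _ _ _ _ ∘ ((mid4 _ _ _ _ ∘ x) ⊗' idm (Q ⊗ Q))
    ∘ (mid4 _ _ _ _ ∘ (tau ⊗' tau) ∘ tau).

Let product_pairing_mid4 e e' (y : mor Q (T ⊗ R)) (y' : mor Q (T' ⊗ R')) :
  product_pairing e e' (mid4 _ _ _ _ ∘ (y ⊗' y')) = (pairing e y * pairing e' y') *: q.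
Proof.
rewrite /product_pairing (compA (mid4 _ _ _ _)) mid4K comp_idl -tensm_id !compA.
rewrite (compE _ (mid4_natural y y' (idm Q) (idm Q))) !compA (compE _ (mid4K Q Q Q Q)) comp_idr.
rewrite (compE _ (esym (tensm_comp _ _ _ _))) (compE _ (esym (tensm_comp _ _ _ _))).
rewrite !compA !(trace_pairingE tau cq) tensmZl tensmZr.
by rewrite compZr compZr compZl compZl Etau scalerA.
Qed.

Let product_pairing_comp (a : mor T T) (a' : mor T' T') e e' x :
  product_pairing e e' (((a ⊗' a') ⊗' (idm R ⊗' idm R')) ∘ x) =
  product_pairing (e ∘ ((a ⊗' idm R) ⊗' idm Q)) (e' ∘ ((a' ⊗' idm R') ⊗' idm Q)) x.
Proof.
rewrite /product_pairing !compA mid4_natural -(compA _ (mid4 _ _ _ _) x).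
rewrite tensm_compid -tensm_id !compA; congr (_ ∘ _ ∘ _ ∘ _ ∘ _).
rewrite (compE _ (mid4_natural _ _ _ _)) !compA tensm_comp compA.
by congr (_ ∘ _ ∘ _); rewrite tensm_id.
Qed.

Lemma external_form : exists (F : 'rV[k]_(d * d') -> mor (Q ⊗ Q) ((T ⊗ T') ⊗ (R ⊗ R')))
    (G : mor (Q ⊗ Q) ((T ⊗ T') ⊗ (R ⊗ R')) -> 'rV[k]_(d * d')),
  [/\ linear F, linear G, forall v, G (F v) = v,
    forall a a' (A : 'M_d) (A' : 'M_d'), (forall v, f (v *m A) = (a ⊗' idm R) ∘ f v) ->
      (forall v, f' (v *m A') = (a' ⊗' idm R') ∘ f' v) ->
      forall v, F (v *m tprod A A') = ((a ⊗' a') ⊗' idm (R ⊗ R')) ∘ F v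
    & forall a a' (A : 'M_d) (A' : 'M_d'),
      (forall j, c j ∘ ((a ⊗' idm R) ⊗' idm Q) = \sum_l A l j *: c l) ->
      (forall j, c' j ∘ ((a' ⊗' idm R') ⊗' idm Q) = \sum_l A' l j *: c' l) ->
      forall x, G (((a ⊗' a') ⊗' idm (R ⊗ R')) ∘ x) = G x *m tprod A A'].
Proof.
have [|u a v w|F [lF FE]] := @tprod_extend k _ d d' (fun u w => mid4 _ _ _ _ ∘ (f u ⊗' f' w)).
- by move=> u a v w; rewrite lf' tensmDr tensmZr compDr compZr.
- by rewrite lf tensmDl tensmZl compDr compZr.
pose co i j x := cover_coef cq (product_pairing (c i) (c' j) x).
have lco i j a x y : co i j (a *: x + y) = a * co i j x + co i j y.
  rewrite /co /product_pairing compDr compZr tensmDl tensmZl compDr compZr compDl compZl.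
  exact: cover_coef_linear.
pose G x := \sum_i \sum_j co i j x *: (tprod (delta_mx (0 : 'I_1) i) (delta_mx (0 : 'I_1) j) : 'rV[k]_(d * d')).
have lG : linear G.
  move=> a x y; rewrite scaler_sumr -big_split; apply: eq_bigr => i _.
  rewrite scaler_sumr -big_split; apply: eq_bigr => j _.
  by rewrite lco scalerDl scalerA.
exists F, G; split=> //.
- apply: tprod_ext => [a x y|a x y|u w] //; first by rewrite lF lG.
  rewrite FE [RHS]tcoordE; apply: eq_bigr => i _; apply: eq_bigr => j _.
  congr (_ *: _); rewrite tcoord_tprod /co product_pairing_mid4.
  by rewrite -{1}(cf u) -{1}(cf' w); apply: cover_coefP.
- move=> a a' A A' fA fA'; apply: tprod_ext => [b x y|b x y|u w].
  + by rewrite mulmxDl -scalemxAl lF.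
  + by rewrite lF compDr compZr.
  + rewrite -[_ *m _](tprodE u A w A') !FE fA fA' tensm_comp -tensm_id !compA.
    by rewrite mid4_natural.
move=> a a' A A' cA cA' x.
have E i j : co i j (((a ⊗' a') ⊗' idm (R ⊗ R')) ∘ x) =
    \sum_l \sum_m (A l i * A' m j) * co l m x.
  apply: cover_coefP; rewrite -tensm_id product_pairing_comp cA cA' /product_pairing.
  rewrite tensm_suml comp_sumr !comp_suml scaler_suml; apply: eq_bigr => l _.
  rewrite tensm_sumr comp_sumr !comp_suml scaler_suml; apply: eq_bigr => m _.
  rewrite tensmZl tensmZr !(compZr, compZl) scalerA.
  by rewrite -[RHS]scalerA /co -cover_coefE.
have rowE m (B : 'M[k]_m) l : delta_mx (0 : 'I_1) l *m B = \sum_i B l i *: delta_mx 0 i.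
  by rewrite -rowE [LHS]row_sum_delta; apply: eq_bigr => i _; rewrite mxE.
transitivity (\sum_l \sum_m \sum_i \sum_j (co l m x * (A l i * A' m j)) *:
    (tprod (delta_mx (0 : 'I_1) i) (delta_mx (0 : 'I_1) j) : 'rV[k]_(d * d'))).
  rewrite /G pair_big /= [RHS]pair_big /=.
  under [RHS]eq_bigr => lm _ do rewrite pair_big /=.
  rewrite exchange_big /=; apply: eq_bigr => ij _; rewrite E pair_big scaler_suml /=.
  by apply: eq_bigr => lm _; rewrite [_ * co _ _ _]mulrC.
rewrite /G mulmx_suml; apply: eq_bigr => l _; rewrite mulmx_suml; apply: eq_bigr => m _.
rewrite -scalemxAl -[X in _ *: X](tprodE (delta_mx (0 : 'I_1) l) A (delta_mx (0 : 'I_1) m) A') !rowE.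
rewrite tprod_suml scaler_sumr; apply: eq_bigr => i _.
rewrite tprod_sumr scaler_sumr scaler_sumr; apply: eq_bigr => j _.
by rewrite !scalerA.
Qed.

End External.
Lemma BPr_tensor n (V W : repS k n) : BPr C V -> BPr C W -> BPr C (tensor_rep V W).
Proof.
have [pQ _ _] := cq.
move=> /(BPr_bform cq Etau)[X [R [f [c [pX [lf fE cE cf]]]]]].
move=> /(BPr_bform cq Etau)[X' [R' [f' [c' [pX' [lf' fE' cE' cf']]]]]].
have [F [G [lF lG GF FE GE]]] := external_form lf lf' cf cf'.
have [z [zK Kz]] := tzip_iso X X' n.
have zE (s : 'S_n) : z ∘ braid (X ⊗ X') s = (braid X s ⊗' braid X' s) ∘ z.
  apply: (iso_epi (tzip_iso X X' n)).
  by rewrite -compA -tzip_braid compA zK comp_idl -compA zK comp_idr.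
apply: (@BPr_intro k C n (tensor_rep V W) (Q ⊗ Q) (X ⊗ X') (R ⊗ R')
  (fun v => (tzip X X' n ⊗' idm _) ∘ F v) (fun x => G ((z ⊗' idm _) ∘ x))) => /=.
- exact: projective_tensr.
- exact: projective_tensr.
- by move=> a v w; rewrite lF compDr compZr.
- by move=> a x y; rewrite compDr compZr lG.
- move=> s v; rewrite (FE (braid X s) (braid X' s)) ?compA -?tensm_compid ?tzip_braid //; exact: fE.
- move=> s x; rewrite compA -tensm_compid zE tensm_compid -compA.
  by apply: GE => j; [apply: cE|apply: cE'].
- by move=> v; rewrite compA -tensm_compid zK tensm_id comp_idl GF.
Qed.

(** The forms of [V] transform contragrediently. They embed the dual module, and evaluating a form
    on the vectors [f (delta_mx 0 j)] projects back. *)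
Lemma BPr_dual n (V : repS k n) : BPr C V -> BPr C (dual_rep V).
Proof.
have [pQ _ _] := cq.
move=> /(BPr_bform cq Etau)[X [R [f [c [pX [lf fE cE cf]]]]]].
have [D [ev [coev d]]] := rigidP X; have pD := dual_projective d pX.
have [surj inj] := tpow_pairing_perfect d n; set e := tpow_pairing ev n in surj inj.
(* A bijection from Hom(R ⊗ Q, D^n) to the space of forms, by dualizing X^n. *)
pose K (a : mor (R ⊗ Q) (tpow D n)) := e ∘ (a ⊗' idm _) ∘ braiding _ _ ∘ assoc (tpow X n) R Q.
have lK : linear K by move=> b x y; rewrite /K tensmDl tensmZl !(compDr, compZr, compDl, compZl).
have KE (s : 'S_n) a : K (braid D s ∘ a) = K a ∘ ((braid X s^-1%g ⊗' idm R) ⊗' idm Q).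
  have eE : e ∘ (braid D s ⊗' idm _) = e ∘ (idm _ ⊗' braid X s^-1%g).
    have eB : e ∘ (braid D s^-1%g ⊗' braid X s^-1%g) = e by apply: tpow_pairing_braid.
    by rewrite -[in LHS]eB -compA -tensm_comp braidK comp_idr.
  rewrite /K -[RHS]compA assoc_natural [RHS]compA; congr (_ ∘ _).
  rewrite tensm_id -[RHS]compA braiding_natural [RHS]compA; congr (_ ∘ _).
  by rewrite tensm_compid compA eE -!compA tensm_lr tensm_rl.
have /choice[K' K'K] b : exists a, K a = b.
  have [a Ea] := surj _ (b ∘ assocV _ _ _ ∘ braiding _ (tpow X n)).
  exists a; rewrite /K Ea -!compA [braiding _ _ ∘ (_ ∘ _)]compA braiding_sym comp_idl.
  by rewrite assocK comp_idr.
have K_inj a b : K a = K b -> a = b.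
  by move=> /(iso_epi (iso_assoc _ _ _))/(iso_epi (iso_braiding _ _))/inj.
pose comb (w : 'rV[k]_(rdegree V)) := \sum_j w 0 j *: c j.
have lcomb : linear comb.
  move=> a v w; rewrite scaler_sumr -big_split; apply: eq_bigr => j _.
  by rewrite !mxE scalerDl scalerA.
have lp (e1 : mor ((tpow X n ⊗ R) ⊗ Q) tunit) w :
    pairing e1 (f w) = \sum_l w 0 l * pairing e1 (f (delta_mx 0 l)).
  rewrite -(pairing_sumr tau cq) {1}[w]row_sum_delta -[f _]/(linear_of lf _) linear_sum.
  by congr (pairing _ _); apply: eq_bigr => l _; rewrite linearZ.
have combE (s : 'S_n) w : comb (w *m (V s^-1%g)^T) =
    comb w ∘ ((braid X s^-1%g ⊗' idm R) ⊗' idm Q).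
  rewrite comp_suml; under [RHS]eq_bigr => j _ do rewrite compZl cE scaler_sumr.
  rewrite exchange_big; apply: eq_bigr => l _; rewrite mxE scaler_suml.
  by apply: eq_bigr => j _; rewrite !mxE scalerA.
apply: (@BPr_fin k C n (dual_rep V) unit (fun=> R ⊗ Q) (fun=> D)
  (fun _ w => K' (comb w)) (fun _ a => \row_j pairing (K a) (f (delta_mx 0 j)))) => /=.
- by move=> _; apply: projective_tensl.
- by [].
- by move=> _ a v w; apply: K_inj; rewrite lK !K'K lcomb.
- move=> _ a x y; apply/rowP => j; rewrite !mxE lK; exact: trace_pairing_linearl.
- by move=> _ s w; apply: K_inj; rewrite KE !K'K combE.
- move=> _ s a; apply/rowP => j; rewrite !mxE KE -trace_pairing_comp -fE lp.
  by apply: eq_bigr => l _; rewrite -rowE !mxE mulrC.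
- move=> w; rewrite big_const /= card_unit /= addr0; apply/rowP => j; rewrite mxE K'K.
  rewrite (pairing_suml tau cq) (bigD1 j) //= cf mxE !eqxx mulr1 big1 ?addr0 // => l /negPf nl.
  by rewrite cf mxE eqxx nl mulr0.
Qed.

End TensorDual.

(** * Restriction *)

(* Conjugates the stabilizer of the last point into that of the first. *)
Definition last_first n : 'S_n.+1 := lift_perm ord_max ord0 1%g.

Section LastFirst.
Variables (k : fieldType) (C : tensor_category k).
Implicit Types (X R : C).

Lemma last_first_exists X n : exists (t : mor (tpow X n.+1) (X ⊗ tpow X n))
    (t' : mor (X ⊗ tpow X n) (tpow X n.+1)),
  [/\ t' ∘ t = idm _, t ∘ t' = idm _,
    forall s : 'S_n, t ∘ braid X (lift_perm ord_max ord_max s) = (idm X ⊗' braid X s) ∘ t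
    & forall s : 'S_n, t' ∘ (idm X ⊗' braid X s) = braid X (lift_perm ord_max ord_max s) ∘ t'].
Proof.
have tt' := braidKV X (last_first n); have t't := braidK X (last_first n).
have tE (s : 'S_n) : braid X (last_first n) ∘ braid X (lift_perm ord_max ord_max s) =
    (idm X ⊗' braid X s) ∘ braid X (last_first n).
  by rewrite -braid_lift0 -!braidM !lift_permM mulg1 mul1g.
exists (braid X (last_first n)), (braid X (last_first n)^-1%g).
move: (braid X (last_first n)) (braid X (last_first n)^-1%g) => t t' in tt' t't tE *.
split=> // s; move: (tE s); set b := braid X (lift_perm _ _ s); move: b => b E.
rewrite -[LHS]comp_idr -tt' compA -(compA _ (_ ⊗' _)).
by rewrite -E compA t't comp_idl.
Qed.

End LastFirst.

Lemma lin_mx_exists (k : fieldType) m n (f : 'rV[k]_m -> 'rV[k]_n) : linear f ->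
  exists A, forall v, v *m A = f v.
Proof. by move=> lf; exists (lin1_mx (linear_of lf)) => v; rewrite mul_rV_lin1. Qed.

Lemma mulmx_inj_rows (k : fieldType) m n (A B : 'M[k]_(m, n)) :
  (forall v : 'rV_m, v *m A = v *m B) -> A = B.
Proof. by move=> E; apply/row_matrixP => i; rewrite !rowE. Qed.

Section Restriction.
Variables (k : fieldType) (C : tensor_category k).
Implicit Types (P X Y Z R T : C) (n : nat).
Let abC := tc_abelian C.
Variables (Q : C) (q : mor Q tunit) (tau : mor Q (Q ⊗ Q)).
Hypothesis cq : projective_cover q.
Hypothesis Etau : lunit tunit ∘ (q ⊗' q) ∘ tau = q.

Local Notation pairing := (trace_pairing tau cq).

(** The factor of X^(n+1) that S_n fixes takes the role of [R]. *)
Lemma BPr_res n (W : repS k n.+1) : BPr C W -> BPr C (res_rep W).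
Proof.
have [pQ _ _] := cq; move=> /(BPr_single pQ)[P [X [f [g [[pP pX] [lf lg] fE gE gf]]]]].
have [t [t' [t't _ tE t'E]]] := last_first_exists X n.
apply: (@BPr_intro k C n (res_rep W) P X X (fun v => braiding X (tpow X n) ∘ (t ∘ f v))
  (fun x => g (t' ∘ (braiding (tpow X n) X ∘ x)))) => //=.
- by move=> a v w; rewrite lf !(compDr, compZr).
- by move=> a x y; rewrite !(compDr, compZr) lg.
- by move=> s v; rewrite fE (compA t) tE -compA compA braiding_natural -compA.
- move=> s x; rewrite -gE; congr g; rewrite (compA (braiding _ _)) braiding_natural.
  by rewrite -(compA (_ ⊗' _)) (compA t') t'E -compA.
- by move=> v; rewrite (compA (braiding _ _)) braiding_sym comp_idl compA t't comp_idl gf.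
Qed.

Lemma hom_rep_exists n X R : exists (E : repS k n)
    (f : 'rV[k]_(rdegree E) -> mor Q (tpow X n ⊗ R))
    (g : mor Q (tpow X n ⊗ R) -> 'rV[k]_(rdegree E)),
  [/\ linear f /\ linear g, forall v, g (f v) = v, forall x, f (g x) = x
    & forall (s : 'S_n) v, f (v *m E s) = (braid X s ⊗' idm R) ∘ f v].
Proof.
have [I [b [c [cb sb]]]] := dual_bases_exist cq Etau (tpow X n ⊗ R).
pose f (v : 'rV[k]_#|I|) := \sum_i v 0 (enum_rank i) *: b i.
pose g x := \row_(j < #|I|) pairing (c (enum_val j)) x.
have lf : linear f.
  move=> a v w; rewrite scaler_sumr -big_split; apply: eq_bigr => i _.
  by rewrite !mxE scalerDl scalerA.
have lg : linear g by move=> a x y; apply/rowP => j; rewrite !mxE trace_pairing_linearr.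
have pb i a : pairing (c i) (\sum_j a j *: b j) = a i.
  rewrite (pairing_sumr tau cq) (bigD1 i) //= cb eqxx mulr1 big1 ?addr0 // => j nj.
  by rewrite cb eq_sym (negPf nj) mulr0.
have gf v : g (f v) = v by apply/rowP => j; rewrite mxE pb enum_valK.
have fg x : f (g x) = x.
  have [a Ea] := sb x; rewrite {2}Ea; apply: eq_bigr => i _.
  by rewrite mxE enum_rankK Ea pb.
have /choice[E EE] (s : 'S_n) : exists A, forall v,
    v *m A = g ((braid X s ⊗' idm R) ∘ f v).
  by apply: lin_mx_exists => a v w; rewrite lf compDr compZr lg.
have mE : mx_repr [set: 'S_n]%G E.
  split=> [|s t _ _]; apply: mulmx_inj_rows => v; rewrite ?mulmxA !EE.
    by rewrite braid1 tensm_id comp_idl gf mulmx1.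
  by rewrite fg braidM tensm_compid compA.
exists (Representation (MxRepresentation mE)), f, g; split=> // s v /=.
by rewrite EE fg.
Qed.

(** With U = X ⊕ Q, the power U^(n+1) has the S_n-stable summand Q ⊗ X^n, and Hom(Q, X^n ⊗ R) is a
    retract of Hom(Q, Q ⊗ X^n ⊗ R). *)
Lemma BPr_extend n (V : repS k n) : BPr C V ->
  exists2 W : repS k n.+1, BPr C W & rep_summand V (res_rep W).
Proof.
have [pQ eq _] := cq; move=> /(BPr_bform cq Etau)[X [R [f [c [pX [lf fE cE cf]]]]]].
have [U [i1 [i2 [p1 [p2 [pi1 pi2 _ _ pi]]]]]] := abelian_biproduct abC X Q.
have pU : projective U by apply: projective_biproduct pi.
have [E [h [h' [[lh lh'] h'h hh' hE]]]] := hom_rep_exists n.+1 U R.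
have h'E (s : 'S_n.+1) x : h' ((braid U s ⊗' idm R) ∘ x) = h' x *m E s.
  by rewrite -[LHS]/(h' _) -{1}(hh' x) -hE h'h.
exists E; first by apply: (BPr_intro pQ pU lh lh' hE h'E h'h).
have [s Es] := pQ _ _ (counit_tens q Q) (idm Q) (@counit_tens_is_epi _ _ _ _ eq Q).
have [t [t' [t't tt' tE t'E]]] := last_first_exists U n.
pose m : mor (Q ⊗ tpow X n) (tpow U n.+1) := t' ∘ (i2 ⊗' tpowm n i1).
pose m' : mor (tpow U n.+1) (Q ⊗ tpow X n) := (p2 ⊗' tpowm n p1) ∘ t.
have m'm : m' ∘ m = idm _.
  rewrite /m /m' compA (compE _ tt') comp_idr -tensm_comp pi2 -tpowm_comp pi1.
  by rewrite tpowm_id tensm_id.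
have mE (z : 'S_n) : m ∘ (idm Q ⊗' braid X z) = braid U (lift_perm ord_max ord_max z) ∘ m.
  rewrite /m (compA _ t') -t'E -!compA -!tensm_comp; congr (_ ∘ (_ ⊗' _)).
    by rewrite comp_idl comp_idr.
  exact: (esym (braid_tpowm z i1)).
have m'E (z : 'S_n) : m' ∘ braid U (lift_perm ord_max ord_max z) = (idm Q ⊗' braid X z) ∘ m'.
  rewrite /m' -(compA _ t) tE !compA -!tensm_comp; congr ((_ ⊗' _) ∘ _).
    by rewrite comp_idl comp_idr.
  exact: (esym (braid_tpowm z p1)).
clearbody m m'; move=> {t t' t't tt' tE t'E}.
pose F v := (m ⊗' idm R) ∘ assocV _ _ _ ∘ (idm Q ⊗' f v) ∘ s.
pose G y := \row_j pairing (c j) (counit_tens q _ ∘ (assoc _ _ _ ∘ ((m' ⊗' idm R) ∘ y))).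
have lF : linear F by move=> a v w; rewrite /F lf tensmDr tensmZr !(compDr, compZr, compDl, compZl).
have lG : linear G.
  by move=> a x y; apply/rowP => j; rewrite !mxE !(compDr, compZr) trace_pairing_linearr.
have GF v : G (F v) = v.
  apply/rowP => j; rewrite mxE -[RHS]cf /F !compA (compE _ (esym (tensm_compid _ _ _))) m'm.
  rewrite tensm_id comp_idr (compE _ (assocVK _ _ _)) comp_idr counit_tens_natural.
  by rewrite -compA Es comp_idr.
have FE (t : 'S_n) v : F (v *m V t) =
    (braid U (lift_perm ord_max ord_max t) ⊗' idm R) ∘ F v.
  rewrite /F fE tensm_idcomp !compA -tensm_compid -mE tensm_compid.
  congr (_ ∘ _ ∘ _); rewrite -!compA; congr (_ ∘ _).
  by rewrite assocV_natural.
have GE (t : 'S_n) y : G ((braid U (lift_perm ord_max ord_max t) ⊗' idm R) ∘ y) =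
    G y *m V t.
  apply/rowP => j; rewrite !mxE !compA -(compA _ (m' ⊗' _)) -tensm_compid m'E tensm_compid.
  rewrite compA -(compA _ (assoc _ _ _)) assoc_natural !compA counit_tens_natural -!compA.
  rewrite trace_pairing_comp cE (pairing_suml tau cq); apply: eq_bigr => l _.
  by rewrite mxE mulrC !compA.
have [|A AE] := lin_mx_exists (f := fun v => h' (F v)).
  by move=> a v w; rewrite lF lh'.
have [|B BE] := lin_mx_exists (f := fun v => G (h v)).
  by move=> a v w; rewrite lh lG.
exists A, B; split=> [z|z|]; apply: mulmx_inj_rows => v; rewrite ?mulmxA !(AE, BE) //=.
- by rewrite FE h'E.
- by rewrite -GE hE.
- by rewrite hh' GF mulmx1.
Qed.

End Restriction.

(** * Induction *)

Section YoungSubgroup.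
Variables m n : nat.
Implicit Types (s : 'S_m) (t : 'S_n).

Lemma young_permM s t s' t' :
  (young_perm s t * young_perm s' t' = young_perm (s * s') (t * t'))%g.
Proof.
apply/permP => i; rewrite permM !permE /young_fun.
by case: (split i) => j; rewrite ?(unsplitK (inl _)) ?(unsplitK (inr _)) permM.
Qed.

Lemma young_perm1 : young_perm (1 : 'S_m) (1 : 'S_n) = 1%g.
Proof.
apply/permP => i; rewrite !permE /young_fun.
by case: (split_ordP i) => j ->; rewrite ?(unsplitK (inl _)) ?(unsplitK (inr _)) perm1.
Qed.

Lemma young_perm_inj s t s' t' : young_perm s t = young_perm s' t' -> (s, t) = (s', t').
Proof.
move=> E; congr pair; apply/permP => j.
  have := congr1 (fun u : 'S_(m + n) => u (lshift n j)) E.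
  by rewrite !permE /young_fun (unsplitK (inl _)) => /lshift_inj.
have := congr1 (fun u : 'S_(m + n) => u (rshift m j)) E.
by rewrite !permE /young_fun (unsplitK (inr _)) => /rshift_inj.
Qed.

Definition young_set : {set 'S_(m + n)} := [set young_perm st.1 st.2 | st : 'S_m * 'S_n].

Lemma young_group_set : group_set young_set.
Proof.
apply/group_setP; split=> [|x y].
  by apply/imsetP; exists (1, 1)%g; rewrite //= young_perm1.
move=> /imsetP[[s t] _ ->] /imsetP[[s' t'] _ ->]; rewrite young_permM.
by apply/imsetP; exists (s * s', t * t')%g.
Qed.
Canonical young_group := Group young_group_set.

Lemma young_setP (x : 'S_(m + n)) :
  (forall i, (x i < m)%N = (i < m)%N) -> x \in young_set.
Proof.
move=> xE.
have xl j : exists j', x (lshift n j) = lshift n j'.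
  have xj : (x (lshift n j) < m)%N by rewrite xE /= ltn_ord.
  by exists (Ordinal xj); apply: val_inj.
have xr j : exists j', x (rshift m j) = rshift m j'.
  have xj : (m <= x (rshift m j))%N by rewrite leqNgt xE /= -leqNgt leq_addr.
  have lt : (x (rshift m j) - m < n)%N by have := ltn_ord (x (rshift m j)); lia.
  by exists (Ordinal lt); apply: val_inj => /=; lia.
have [f fE] := boolp.choice xl; have [g gE] := boolp.choice xr.
have fI : injective f.
  by move=> i j /(congr1 (lshift n)); rewrite -!fE => /perm_inj/lshift_inj.
have gI : injective g.
  by move=> i j /(congr1 (@rshift m n)); rewrite -!gE => /perm_inj/rshift_inj.
apply/imsetP; exists (perm fI, perm gI) => //=; apply/permP => i.
rewrite permE /young_fun.
by case: (split_ordP i) => j ->; rewrite ?(unsplitK (inl _)) ?(unsplitK (inr _)) permE.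
Qed.

End YoungSubgroup.

(** * Matrices of an induced representation *)

Section InducedMatrices.
Variables (k : fieldType) (N d : nat) (H : {group 'S_N}) (A : 'S_N -> 'M[k]_d).
Hypothesis A_out : forall x, x \notin H -> A x = 0.
Hypothesis AM : forall h x, h \in H -> A (h * x)%g = A h *m A x.
Hypothesis A1 : A 1%g = 1%:M.
Variables (W : repS k N) (i : 'M[k]_(d, rdegree W)).
Hypothesis iA : forall h, h \in H -> A h *m i = i *m W h.
Hypothesis univ : forall (U : repS k N) (f : 'M[k]_(d, rdegree U)),
  (forall h, h \in H -> A h *m f = f *m U h) ->
  exists! g : 'M[k]_(rdegree W, rdegree U), is_rep_hom g /\ i *m g = f.

Let reg (x : 'S_N) : 'M[k]_#|'S_N| :=
  \matrix_(a, b) (enum_val b == enum_val a * x)%g%:R.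

Let mul_reg w (f : 'S_N -> 'M[k]_(w, 1)) x :
  (\matrix_(a, b) f (enum_val b)^-1%g a 0) *m reg x =
  \matrix_(a, b) f (x * (enum_val b)^-1)%g a 0.
Proof.
apply/matrixP => a b; rewrite !mxE (bigD1 (enum_rank (enum_val b * x^-1)%g)) //=.
rewrite !mxE enum_rankK mulgKV eqxx mulr1 invMg invgK big1 ?addr0 // => c nc.
rewrite !mxE; case: eqP => [E|_]; last by rewrite mulr0.
by case/eqP: nc; rewrite E mulgK enum_valK.
Qed.

Let reg_repr : mx_repr [set: 'S_N]%G reg.
Proof.
split=> [|x y _ _]; apply/matrixP => a b; rewrite !mxE.
  by rewrite mulg1 (inj_eq enum_val_inj) eq_sym.
rewrite (bigD1 (enum_rank (enum_val a * x)%g)) //= !mxE enum_rankK eqxx mul1r mulgA.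
rewrite big1 ?addr0 // => c nc; rewrite !mxE; case: eqP => [E|_]; last by rewrite mul0r.
by case/eqP: nc; rewrite -E enum_valK.
Qed.

Let regular : repS k N := Representation (MxRepresentation reg_repr).

(* Uniqueness, for the target k[S_N]: a column [r] gives the morphism sending
   [v] to the function [x |-> v W(x^-1) r]. *)
Lemma induced_span w (r : 'M[k]_(rdegree W, w)) :
  (forall s, i *m W s *m r = 0) -> r = 0.
Proof.
move=> ir; apply/matrixP => a j; rewrite mxE.
pose f : 'M[k]_(rdegree W, rdegree regular) :=
  \matrix_(a, b) (W (enum_val b)^-1%g *m col j r) a 0.
have [|g0 [_ gU]] := @univ regular 0; first by move=> h _; rewrite mulmx0 mul0mx.
have fE : g0 = f.
  apply: gU; split=> [s|]; last first.
    apply/matrixP => b c; rewrite !mxE.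
    have /matrixP/(_ b j) := ir (enum_val c)^-1%g; rewrite -mulmxA !mxE => E.
    by rewrite -[RHS]E; apply: eq_bigr => l _; rewrite !mxE; congr (_ * _);
      apply: eq_bigr => l' _; rewrite mxE.
  rewrite [RHS](mul_reg (fun x => W x *m col j r)); apply/matrixP => b c.
  rewrite [RHS]mxE repr_mxM ?inE // -mulmxA mxE [RHS]mxE; apply: eq_bigr => l _.
  by rewrite /f mxE.
have /matrixP/(_ a (enum_rank 1%g)) : f = 0.
  by rewrite -fE; apply: gU; split; rewrite ?mulmx0 // => s; rewrite mulmx0 mul0mx.
by rewrite [RHS]mxE /f mxE enum_rankK invg1 repr_mx1 mul1mx mxE.
Qed.

(** Existence, again for the regular target: for each [j], the map sending v to the function taking
    x to entry [j] of v A(x^-1) extends to [W]; its value at 1 is column [j] of [r]. *)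
Lemma induced_retraction : exists r : 'M[k]_(rdegree W, d), forall s, i *m W s *m r = A s.
Proof.
have ex_col j : exists c : 'cV[k]_(rdegree W), forall s, i *m W s *m c = col j (A s).
  pose f : 'M[k]_(d, rdegree regular) := \matrix_(a, b) (col j (A (enum_val b)^-1%g)) a 0.
  have [h hH|g [[gE ig] _]] := @univ regular f.
    rewrite [RHS](mul_reg (fun x => col j (A x))); apply/matrixP => a b.
    by rewrite !mxE AM // mxE; apply: eq_bigr => l _; rewrite !mxE.
  exists (col (enum_rank 1%g) g) => s.
  rewrite colE mulmxA -(mulmxA i) gE mulmxA ig.
  rewrite [f *m _](mul_reg (fun x => col j (A x))) -colE; apply/matrixP => a b.
  by rewrite !mxE enum_rankK invg1 mulg1.
have [c Ec] := boolp.choice ex_col.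
exists (\matrix_(a, j) c j a 0) => s; apply/matrixP => a j.
have /matrixP/(_ a 0) := Ec j s; rewrite [RHS]mxE => <-.
by rewrite mxE [RHS]mxE; apply: eq_bigr => l _; rewrite [X in _ * X]mxE.
Qed.

Variable r : 'M[k]_(rdegree W, d).
Hypothesis ir : forall s, i *m W s *m r = A s.

Lemma induced_retraction_hom h : h \in H -> W h *m r = r *m A h.
Proof.
move=> hH; apply/eqP; rewrite -subr_eq0; apply/eqP; apply: induced_span => s.
rewrite mulmxBr !mulmxA ir -(mulmxA i) -repr_mxM ?inE // ir.
have [sH|sH] := boolP (s \in H); first by rewrite AM // subrr.
by rewrite (A_out sH) mul0mx subr0 A_out // groupMr.
Qed.

(** By [induced_span] it is enough to compare after each [i *m W s]; only the coset of [s]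
    contributes, since [A] vanishes outside [H]. *)
Lemma induced_decomposition :
  \sum_(B in rcosets H [set: 'S_N]%g) W (repr B)^-1%g *m r *m i *m W (repr B) = 1%:M.
Proof.
apply/eqP; rewrite -subr_eq0; apply/eqP; apply: induced_span => s.
rewrite mulmxBr mulmx1 mulmx_sumr.
have sB : (H :* s)%g \in rcosets H [set: 'S_N]%g by apply/rcosetsP; exists s; rewrite ?inE.
have rH : (s * (repr (H :* s))^-1)%g \in H.
  by have /rcosetP[h hH ->] := mem_repr_rcoset H s; rewrite invMg mulKVg groupV.
have E (x : 'S_N) : i *m W s *m (W x^-1%g *m r *m i *m W x) =
    A (s * x^-1)%g *m i *m W x.
  by rewrite !mulmxA -(mulmxA i) -repr_mxM ?inE // ir.
rewrite (bigD1 _ sB) /= E iA // -mulmxA -repr_mxM ?inE // mulgKV.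
rewrite big1 ?addr0 ?subrr // => B /andP[/rcosetsP[t _ ->] nB]; rewrite E A_out ?mul0mx //.
apply: contra nB; have /rcosetP[h hH ->] := mem_repr_rcoset H t.
rewrite invMg mulgA groupMr ?groupV // => stH; apply/eqP/rcoset_eqP.
by rewrite mem_rcoset -groupV invMg invgK.
Qed.

End InducedMatrices.

Section Induction.
Variables (k : fieldType) (C : tensor_category k).
Implicit Types (P X Y Z R T : C).
Let abC := tc_abelian C.

Section Core.
Variables (N d : nat) (H : {group 'S_N}) (A : 'S_N -> 'M[k]_d).
Hypothesis A_out : forall x, x \notin H -> A x = 0.
Hypothesis AM : forall (h x : 'S_N), h \in H -> A (h * x)%g = A h *m A x.
Hypothesis A1 : A 1%g = 1%:M.
Variables (W : repS k N) (i : 'M[k]_(d, rdegree W)).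
Hypothesis iA : forall h, h \in H -> A h *m i = i *m W h.
Hypothesis univ : forall (U : repS k N) (f : 'M[k]_(d, rdegree U)),
  (forall h, h \in H -> A h *m f = f *m U h) ->
  exists! g : 'M[k]_(rdegree W, rdegree U), is_rep_hom g /\ i *m g = f.

Variables (P U R : C).
Hypotheses (pP : projective P) (pU : projective U).
Variables (f : 'rV[k]_d -> mor P (tpow U N ⊗ R)) (g : mor P (tpow U N ⊗ R) -> 'rV[k]_d).
Hypotheses (lf : linear f) (lg : linear g).
Hypothesis fE : forall (h : 'S_N) v, h \in H -> f (v *m A h) = (braid U h ⊗' idm R) ∘ f v.
Hypothesis gE : forall (h : 'S_N) x, h \in H -> g ((braid U h ⊗' idm R) ∘ x) = g x *m A h.
Hypothesis gf : forall (s : 'S_N) v, g ((braid U s ⊗' idm R) ∘ f v) = v *m A s.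

Local Notation act s := (braid U (s : 'S_N) ⊗' idm R).

Let actM (s t : 'S_N) Y (x : mor Y _) : act (s * t)%g ∘ x = act t ∘ (act s ∘ x).
Proof. by rewrite braidM tensm_compid compA. Qed.

(** By [gf] the translates of the image of [f] by distinct cosets are orthogonal for [g], so their
    sum is a copy of the induced module; [F] and [G] sum over cosets. *)
Lemma BPr_induced_core : BPr C W.
Proof.
have [r ir] := induced_retraction AM univ.
have rE := induced_retraction_hom A_out AM univ ir.
have ri := induced_decomposition A_out iA univ ir.
pose S := [set: 'S_N]%g.
pose F w := \sum_(B in rcosets H S) act (repr B) ∘ f (w *m W (repr B)^-1%g *m r).
pose G x := \sum_(B in rcosets H S) g (act (repr B)^-1%g ∘ x) *m i *m W (repr B).
have WM (s t : 'S_N) : W (s * t)%g = W s *m W t by rewrite repr_mxM ?inE.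
have lF : linear F.
  move=> a v w; rewrite scaler_sumr -big_split; apply: eq_bigr => B _.
  by rewrite !mulmxDl -!scalemxAl lf compDr compZr.
have lG : linear G.
  move=> a x y; rewrite scaler_sumr -big_split; apply: eq_bigr => B _.
  by rewrite compDr compZr lg !mulmxDl -!scalemxAl.
apply: (@BPr_intro k C N W P U R F G) => //.
- move=> s w; pose phi x := act x ∘ f (w *m W s *m W x^-1%g *m r).
  rewrite -[F _]/(\sum_(B in rcosets H S) phi (repr B)) -(sum_rcosets_mulr s).
    rewrite comp_sumr; apply: eq_bigr => B _; rewrite /phi invMg WM mulmxA.
    by rewrite -(mulmxA w) -WM mulgV repr_mx1 mulmx1 actM.
  move=> h x hH; rewrite /phi invMg WM -!mulmxA rE ?groupV // !mulmxA fE ?groupV //.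
  by rewrite -actM mulKg.
- move=> s x; pose psi y := g (act (s * y^-1)%g ∘ x) *m i *m W y.
  rewrite mulmx_suml -[RHS]/(\sum_(B in rcosets H S) (fun _ => _) B).
  transitivity (\sum_(B in rcosets H S) psi (repr B)).
    by apply: eq_bigr => B _; rewrite /psi actM.
  rewrite -(sum_rcosets_mulr s); last first.
    move=> h y hH; rewrite /psi invMg mulgA [in LHS]actM gE ?groupV // WM.
    by rewrite !mulmxA -(mulmxA _ (A _)) iA ?groupV // !mulmxA -(mulmxA _ _ (W h)) -WM mulVg
      repr_mx1 mulmx1.
  by apply: eq_bigr => B _; rewrite /psi invMg mulKVg WM mulmxA.
- move=> w; rewrite -[RHS]mulmx1 -ri mulmx_sumr; apply: eq_bigr => B HB.
  rewrite !mulmxA; congr (_ *m _ *m _).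
  rewrite comp_sumr -[g]/(linear_of lg : _ -> _) linear_sum (bigD1 B) //= -actM gf.
  rewrite mulgV A1 mulmx1 big1 ?addr0 // => B' /andP[HB' nB].
  rewrite -actM gf A_out ?mulmx0 //; apply: contra nB.
  case/rcosetsP: HB => t _ ->; case/rcosetsP: HB' => t' _ ->.
  have /rcosetP[h hH ->] := mem_repr_rcoset H t.
  have /rcosetP[h' h'H ->] := mem_repr_rcoset H t'.
  rewrite invMg -mulgA groupMl // mulgA groupMr ?groupV // => tt'.
  by apply/eqP/rcoset_eqP; rewrite mem_rcoset.
Qed.

End Core.

(** A permutation mixing the two blocks places [e1] against [e2] in some slot. *)
Lemma young_vanish U (e1 e2 : mor U U) m n (x : 'S_(m + n)) :
  e1 ∘ e2 = 0 -> e2 ∘ e1 = 0 -> x \notin young_set m n ->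
  let e : mor (tpow U (m + n)) (tpow U (m + n)) :=
    @btensm k C (m + n) (fun=> U) (fun=> U) (catfun (fun _ : 'I_m => e1) (fun _ : 'I_n => e2)) in
  e ∘ braid U x ∘ e = 0.
Proof.
move=> e12 e21 nx /=; set e := catfun _ _.
have [i xi] : exists i, (x i < m)%N != (i < m)%N.
  apply: contrapT => nex; case/negP: nx; apply: young_setP => i.
  by have [//|xi] := eqVneq (x i < m)%N (i < m)%N; case: nex; exists i.
have E := braid_natural_family e (@perm_inj _ x).
transitivity (braid U x ∘ btensm (fun i => e (x i)) ∘ btensm e : mor (tpow U _) (tpow U _)).
  by congr (_ ∘ _); rewrite E.
rewrite -compA -btensm_comp.
rewrite (btensm_eq0 (i := i)) ?comp0r //; move: xi; rewrite /e.
case: (split_ordP i) => j ->; case: (split_ordP (x _)) => j' ->;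
  rewrite ?catfun_lshift ?catfun_rshift //=; by move: (ltn_ord j) (ltn_ord j'); lia.
Qed.

Variables (Q : C) (q : mor Q tunit) (tau : mor Q (Q ⊗ Q)).
Hypothesis cq : projective_cover q.
Hypothesis Etau : lunit tunit ∘ (q ⊗' q) ∘ tau = q.

Lemma BPr_induced m n (M : repS k m) (N : repS k n) (W : repS k (m + n)) :
  BPr C M -> BPr C N -> is_induced M N W -> BPr C W.
Proof.
have [pQ _ _] := cq.
move=> /(BPr_bform cq Etau)[X [R [f [c [pX [lf fE cE cf]]]]]].
move=> /(BPr_bform cq Etau)[X' [R' [f' [c' [pX' [lf' fE' cE' cf']]]]]].
move=> [i iE univ].
have [F [G [lF lG GF FE GE]]] := external_form Etau lf lf' cf cf'.
have [U [i1 [i2 [p1 [p2 [pi1 pi2 pi12 pi21 pi]]]]]] := abelian_biproduct abC X X'.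
have pU : projective U by apply: projective_biproduct pi.
have [z [zK Kz]] := tcat_iso U m n.
(* The external product as one matrix function on S_(m+n), extended by zero outside the Young
   subgroup. *)
pose A (x : 'S_(m + n)) : 'M[k]_(rdegree M * rdegree N) :=
  if [pick st : 'S_m * 'S_n | young_perm st.1 st.2 == x] is Some st
  then tprod (M st.1) (N st.2) else 0.
have AE s t : A (young_perm s t) = tprod (M s) (N t).
  rewrite /A; case: pickP => [[s' t'] /= /eqP/young_perm_inj[-> ->] //|/(_ (s, t))/=].
  by rewrite eqxx.
have A_out x : x \notin young_group m n -> A x = 0.
  rewrite /A; case: pickP => // -[s t] /= /eqP <- /negP[].
  by apply/imsetP; exists (s, t).
have AM (h x : 'S_(m + n)) : h \in young_group m n -> A (h * x)%g = A h *m A x.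
  move=> hH; have [xH|xH] := boolP (x \in young_group m n); last first.
    by rewrite (A_out x xH) mulmx0 A_out // groupMl.
  case/imsetP: hH => -[s t] _ ->; case/imsetP: xH => -[s' t'] _ ->.
  by rewrite young_permM !AE !repr_mxM ?inE // tprodE.
(* With U = X ⊕ X', the object X^m ⊗ X'^n is a summand of U^(m+n), and its translates by distinct
   cosets are independent. *)
pose j := tcat U m n ∘ (tpowm m i1 ⊗' tpowm n i2).
pose l := (tpowm m p1 ⊗' tpowm n p2) ∘ z.
pose e : mor (tpow U (m + n)) (tpow U (m + n)) :=
  @btensm k C (m + n) (fun=> U) (fun=> U) (catfun (fun _ : 'I_m => i1 ∘ p1) (fun _ : 'I_n => i2 ∘ p2)).
have ej : e ∘ j = j.
  rewrite /e /j compA -tcat_btensm -compA -tensm_comp -!tpowm_comp.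
  by rewrite -!compA pi1 pi2 !comp_idr.
have le : l ∘ e = l.
  apply: (iso_epi (tcat_iso U m n)); rewrite -compA -tcat_btensm /l.
  rewrite -!compA (compA z) zK comp_idl comp_idr -tensm_comp -!tpowm_comp.
  by rewrite !compA pi1 pi2 !comp_idl.
have lj : l ∘ j = idm _.
  rewrite /l /j -compA (compA z) zK comp_idl -tensm_comp -!tpowm_comp pi1 pi2.
  by rewrite !tpowm_id tensm_id.
have jE (s : 'S_m) (t : 'S_n) : j ∘ (braid X s ⊗' braid X' t) = braid U (young_perm s t) ∘ j.
  rewrite /j -compA -tensm_comp -!braid_tpowm tensm_comp !compA.
  by rewrite tcat_braid.
have lE (s : 'S_m) (t : 'S_n) : l ∘ braid U (young_perm s t) = (braid X s ⊗' braid X' t) ∘ l.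
  apply: (iso_epi (tcat_iso U m n)); rewrite -compA -tcat_braid /l.
  rewrite -!compA (compA z) zK !comp_idl comp_idr -!tensm_comp.
  by rewrite !braid_tpowm.
have lj0 (x : 'S_(m + n)) : x \notin young_group m n -> l ∘ braid U x ∘ j = 0.
  move=> xH; rewrite -le -ej !compA -(compA l) -(compA l) young_vanish ?comp0r ?comp0l //.
    by rewrite compA -(compA i1) pi12 comp0r comp0l.
  by rewrite compA -(compA i2) pi21 comp0r comp0l.
clearbody j l.
have fE2 (h : 'S_(m + n)) v : h \in young_group m n ->
    (j ⊗' idm (R ⊗ R')) ∘ F (v *m A h) = (braid U h ⊗' idm _) ∘ ((j ⊗' idm _) ∘ F v).
  case/imsetP=> -[s t] _ ->; rewrite AE (FE (braid X s) (braid X' t)).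
  - by rewrite !compA -!tensm_compid jE.
  - exact: fE.
  - exact: fE'.
apply: (@BPr_induced_core (m + n) _ (young_group m n) A A_out AM _ W i _ _ (Q ⊗ Q) U
  (R ⊗ R') _ pU (fun v => (j ⊗' idm _) ∘ F v) (fun x => G ((l ⊗' idm _) ∘ x))).
- by rewrite -young_perm1 AE !repr_mx1 tprod1.
- by move=> h /imsetP[[s t] _ ->]; rewrite AE iE.
- move=> V g gE; apply: univ => s t; rewrite -AE gE //.
  by apply/imsetP; exists (s, t).
- exact: projective_tensr.
- by move=> a v w; rewrite lF compDr compZr.
- by move=> a x y; rewrite compDr compZr lG.
- exact: fE2.
- move=> h x /imsetP[[s t] _ ->]; rewrite compA -tensm_compid lE tensm_compid -compA AE.
  by apply: GE => a; [apply: cE|apply: cE'].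
- move=> s v; have [sH|sH] := boolP (s \in young_group m n).
    by rewrite -fE2 // compA -tensm_compid lj tensm_id comp_idl GF.
  rewrite !compA -!tensm_compid lj0 // tensm0l comp0l A_out // mulmx0.
  by have := lG (-1) 0 0; rewrite scaler0 addr0 scaleN1r addNr.
Qed.

End Induction.

Section Closed.
Variables (k : fieldType) (C : tensor_category k).
Variables (Q : C) (q : mor Q tunit).
Hypothesis cq : projective_cover q.

Lemma BPr_inductive_system : inductive_system (@BPr k C).
Proof.
have [pQ eq _] := cq; have [tau Etau] := comult_exists pQ eq.
split=> [n _|n V W _|n V W _|n V _]; [exact: BPr_zero|exact: BPr_sum|exact: BPr_summand|].
split=> [/(BPr_extend cq Etau)[W BW [f [g [fE gE fg]]]]|[r [W [BW VW]]]].
  exists 1%N, (fun=> W); split=> //; rewrite big_ord_recl big_ord0.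
  exists (row_mx f 0), (col_mx g 0); split=> [s|s|] /=.
  - by rewrite mul_mx_row mulmx0 fE mul_row_block !mul0mx !mulmx0 !addr0.
  - by rewrite mul_block_col mul_col_mx !mul0mx addr0 !mulmx0 gE addr0.
  - by rewrite mul_row_col mulmx0 addr0.
apply: BPr_summand VW _; apply: (big_ind (fun V => BPr C V)) => [|V' W'|i _].
- exact: BPr_zero.
- exact: BPr_sum.
- exact/(BPr_res cq)/BW.
Qed.

Lemma BPr_closed : (forall n, invariant_lift q n) -> closed_inductive_system (@BPr k C).
Proof.
have [pQ eq _] := cq; have [tau Etau] := comult_exists pQ eq => lift.
split=> [|n _|n V W _|n V _|m n M N W _ _].
- exact: BPr_inductive_system.
- exact/(BPr_triv cq)/lift.
- exact: (BPr_tensor cq Etau).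
- exact: (BPr_dual cq Etau).
- exact: (BPr_induced cq Etau).
Qed.

End Closed.

Local Close Scope cat_scope.
Local Close Scope ring_scope.

Theorem theorem5p1p5 (k : closedFieldType) (p : nat) (hp : p \in [pchar k]%R)
    (C : tensor_category k) (hC : has_projective_objects C) :
  [<-> frobenius_exact C p;
       closed_inductive_system (@BPr k C);
       BPr C (triv_rep k p);
       ~ (forall V : repS k p, BPr C V -> rep_projective V);
       forall (Q : C) (q : mor Q tunit), projective_cover q ->
         has_equivariant_section_unit p q;
       forall (P : C) (l : nat) (lambda : 'I_l -> nat) (Y Z : 'I_l -> C)
           (e : forall i, mor (Y i) (Z i)),
         projective P -> (forall i, (0 < lambda i)%N) ->
         (forall i, epi (e i)) ->
         has_equivariant_section P lambda e].
Proof.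
have p0 := prime_gt0 (pcharf_prime hp).
have [Q [q cq]] := projective_cover_exists hC; have [pQ eq _] := cq.
tfae.
- move=> /(frobenius_exact_invariant_lift hC hp pQ eq) lift.
  exact: (BPr_closed cq (invariant_lift_all pQ eq hp lift)).
- by move=> cl; apply: (closed_triv cl).
- by move=> triv proj; apply: (triv_not_projective hp); apply: proj.
- move=> nproj Q' q' cq'; apply: (invariant_lift_section cq').
  apply: contrapT => nlift; apply: nproj => V BV; apply: contrapT => nV.
  by apply: nlift; apply: (nonprojective_invariant_lift hp cq' BV nV).
- move=> sec P l lambda Y Z e pP _ ee.
  have lift := section_unit_invariant_lift (sec _ _ cq).
  exact: (equivariant_section_exists pQ eq _ (invariant_lift_all pQ eq hp lift)).
(* Condition (6) for one block of size p and the epimorphism [q], with [P] = [Q], contains an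
   invariant lift. *)
- move=> sec; apply: (invariant_lift_frobenius_exact hC hp pQ eq).
  by apply: section_invariant_lift; apply: sec.
Qed.
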